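(* Let $\mathbb{D}_Q$ be a nc operator ball, let $\mathcal{A}$ be either $A(\mathbb{D}_Q)$ or $H^\infty(\mathbb{D}_Q)$, and let $\mathfrak{V}\subset\mathbb{D}_Q$ be a subvariety. Correspondingly, let $\mathcal{A}(\mathfrak{V})$ denote $A(\mathfrak{V})$ if $\mathcal{A}=A(\mathbb{D}_Q)$ and $H^\infty(\mathfrak{V})$ if $\mathcal{A}=H^\infty(\mathbb{D}_Q)$. Then $R:\mathcal{A}\to\mathcal{A}(\mathfrak{V})$ defined by $R(F)=F|_{\mathfrak{V}}$ for all $F\in\mathcal{A}$ is a complete contraction with $\ker(R)=I(\mathfrak{V})$. Also, the induced map $\overline{R}:\mathcal{A}/I(\mathfrak{V})\to\mathcal{A}(\mathfrak{V})$ is a completely isometric isomorphism of algebras in either one of the following two cases: (1) $\mathcal{A}=H^\infty(\mathbb{D}_Q)$. (2) $\mathfrak{V}$ is homogeneous.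
   Context: $M_n^d$ is the set of $d$-tuples of complex $n\times n$ matrices ($M_n=M_n^1$); $\mathbb{M}^d=\sqcup_{n\ge1}M_n^d$; for $\Omega\subseteq\mathbb{M}^d$, $\Omega(n)=\Omega\cap M_n^d$. A nc function $f:\Omega\to\mathbb{M}^1$ on a set $\Omega$ closed under direct sums is a graded map ($X\in\Omega(n)\Rightarrow f(X)\in M_n$) with $f(X\oplus Y)=f(X)\oplus f(Y)$ and $f(S^{-1}XS)=S^{-1}f(X)S$ whenever $S\in GL_n$ and $X,S^{-1}XS\in\Omega(n)$. NC operator ball: given Hilbert spaces $\mathcal{R},\mathcal{S}$ and linearly independent $Q_1,\dots,Q_d\in\mathcal{L}(\mathcal{R},\mathcal{S})$, put $Q(X)=\sum_jQ_j\otimes X_j$ for $X\in\mathbb{M}^d$ and $\mathbb{D}_Q=\{X\in\mathbb{M}^d:\|Q(X)\|<1\}$. For a nc set $\mathfrak{X}\subseteq\mathbb{D}_Q$, $H^\infty(\mathfrak{X})$ is the algebra of bounded nc functions $\mathfrak{X}\to\mathbb{M}^1$ with norm $\|f\|=\sup_{X\in\mathfrak{X}}\|f(X)\|$ and matrix norms $\|[f_{jk}]\|=\sup_{X\in\mathfrak{X}}\|[f_{jk}(X)]\|$; $A(\mathfrak{X})$ is the norm closure in $H^\infty(\mathfrak{X})$ of the restrictions to $\mathfrak{X}$ of free nc polynomials in $d$ variables. A subvariety of $\mathbb{D}_Q$ is a joint zero set $\{X\in\mathbb{D}_Q:f(X)=0\ \forall f\in S\}$ with $S\subseteq\mathcal{A}$;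 it is homogeneous if $\lambda\mathfrak{V}\subseteq\mathfrak{V}$ for all $\lambda\in\mathbb{C}$, $|\lambda|\le1$. $I(\mathfrak{V})=\{F\in\mathcal{A}:F(X)=0\ \forall X\in\mathfrak{V}\}$. The quotient $\mathcal{A}/I(\mathfrak{V})$ carries the quotient matrix norms from $M_n(\mathcal{A}/I(\mathfrak{V}))=M_n(\mathcal{A})/M_n(I(\mathfrak{V}))$. *)

(* Defs.v *)
From HB Require Import structures.
From mathcomp Require Import all_boot all_order all_algebra.
From mathcomp Require Import complex.
From mathcomp Require Import ring.
From mathcomp Require Import all_classical all_reals all_analysis.

Set Implicit Arguments.
Unset Strict Implicit.
Unset Printing Implicit Defensive.

Import Order.TTheory GRing.Theory Num.Theory.
Import numFieldNormedType.Exports.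

Local Open Scope classical_set_scope.
Local Open Scope ring_scope.
Local Open Scope complex_scope.
Local Open Scope quotient_scope.

Definition is_hilbert (R : realType) (H : completeNormedModType R[i]) : Prop :=
  exists ip : {dot H for Num.conj}, forall x : H, `|x| ^+ 2 = ip x x.

Section OperatorNorm.
Variable R : realType.
Local Notation C := R[i].

(* The norm of a Hilbert space over R[i] takes values in R[i]; Re brings it
   back to R. The functions 'I_n -> H carry the norm of the Hilbert direct sum
   of n copies of H, that is of H (x) C^n. *)
Definition l2norm (H : normedZmodType C) (n : nat) (u : 'I_n -> H) : R :=
  Num.sqrt (\sum_i complex.Re `|u i| ^+ 2).

(* sup is 0 on sets without upper bound, so this is the operator norm of
   bounded maps only. *)
Definition opnorm (H K : normedZmodType C) (n m : nat)
    (T : ('I_n -> H) -> ('I_m -> K)) : R :=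
  sup [set l2norm (T u) | u in [set u | l2norm u <= 1]].

Definition mxact (m n : nat) (A : 'M[C]_(m, n)) (u : 'I_n -> C) (i : 'I_m) : C :=
  \sum_j A i j * u j.

Definition mxnorm (m n : nat) (A : 'M[C]_(m, n)) : R := opnorm (mxact A).

Lemma Re_norm_ge0 (H : normedZmodType C) (x : H) : 0 <= complex.Re `|x|.
Proof. by have := normr_ge0 x; rewrite lecE => /andP[]. Qed.

Lemma Re_normD (H : normedZmodType C) (x y : H) :
  complex.Re `|x + y| <= complex.Re `|x| + complex.Re `|y|.
Proof.
have := ler_normD x y; rewrite lecE => /andP[_].
by case: `|x| `|y| => [a b] [c e].
Qed.

Lemma Re_norm_real (H : normedZmodType C) (x : H) :
  `|x| = (complex.Re `|x|)%:C.
Proof. by have := normr_ge0 x; rewrite lecE; case: `|x| => a b /= /andP[/eqP->]. Qed.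

Lemma Re_normM (x y : C) :
  complex.Re `|x * y| = complex.Re `|x| * complex.Re `|y|.
Proof. by rewrite normrM (Re_norm_real x) (Re_norm_real y) /= mulr0 subr0. Qed.

Lemma l2norm_ge0 (H : normedZmodType C) n (u : 'I_n -> H) : 0 <= l2norm u.
Proof. exact: sqrtr_ge0. Qed.

Lemma l2norm_sqr (H : normedZmodType C) n (u : 'I_n -> H) :
  l2norm u ^+ 2 = \sum_i complex.Re `|u i| ^+ 2.
Proof. by rewrite sqr_sqrtr // sumr_ge0 // => i _; rewrite sqr_ge0. Qed.

Lemma le_l2norm (H : normedZmodType C) n (u : 'I_n -> H) i :
  complex.Re `|u i| <= l2norm u.
Proof.
rewrite -(@ler_pXn2r _ 2) ?nnegrE ?Re_norm_ge0 ?l2norm_ge0 // l2norm_sqr.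
by rewrite (bigD1 i) //= lerDl sumr_ge0 // => j _; rewrite sqr_ge0.
Qed.

Lemma l2norm0 (H : normedZmodType C) n : l2norm (fun _ : 'I_n => 0 : H) = 0.
Proof.
by rewrite /l2norm big1 ?sqrtr0 // => i _; rewrite normr0 /= expr0n.
Qed.

Lemma l2norm_eq0 (H : normedZmodType C) n (u : 'I_n -> H) :
  l2norm u = 0 -> u = fun _ => 0.
Proof.
move=> u0; apply/funext => i; apply/eqP; rewrite -normr_eq0 Re_norm_real.
rewrite (_ : complex.Re _ = 0) ?eqxx//.
by apply/eqP; rewrite eq_le Re_norm_ge0 andbT -u0 le_l2norm.
Qed.

Lemma l2normD (H : normedZmodType C) n (u v : 'I_n -> H) :
  l2norm (fun i => u i + v i) <= l2norm u + l2norm v.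
Proof.
have [u0|u0] := eqVneq (l2norm u) 0.
  rewrite u0 add0r (l2norm_eq0 u0) (_ : (fun i => _) = v) //.
  by apply/funext => i; rewrite add0r.
have [v0|v0] := eqVneq (l2norm v) 0.
  rewrite v0 addr0 (l2norm_eq0 v0) (_ : (fun i => _) = u) //.
  by apply/funext => i; rewrite addr0.
have {}u0 : 0 < l2norm u by rewrite lt_def u0 l2norm_ge0.
have {}v0 : 0 < l2norm v by rewrite lt_def v0 l2norm_ge0.
set s := l2norm u in u0 *; set t := l2norm v in v0 *.
rewrite -(@ler_pXn2r _ 2) ?nnegrE ?l2norm_ge0 ?addr_ge0 ?l2norm_ge0 // l2norm_sqr.
rewrite -(ler_pM2r (mulr_gt0 u0 v0)).
have -> : (s + t) ^+ 2 * (s * t) = (s + t) * (t * s ^+ 2 + s * t ^+ 2) by ring.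
rewrite !l2norm_sqr !mulr_sumr -big_split /= mulr_suml mulr_sumr.
apply: ler_sum => i _.
set a := complex.Re `|u i|; set b := complex.Re `|v i|.
have ab : complex.Re `|u i + v i| ^+ 2 <= (a + b) ^+ 2.
  by rewrite ler_pXn2r ?nnegrE ?addr_ge0 ?Re_norm_ge0 ?Re_normD.
apply: (le_trans (ler_wpM2r _ ab)); first by rewrite ltW ?mulr_gt0.
rewrite -subr_ge0; have -> : (s + t) * (t * a ^+ 2 + s * b ^+ 2)
  - (a + b) ^+ 2 * (s * t) = (t * a - s * b) ^+ 2 by ring.
exact: sqr_ge0.
Qed.

Lemma l2normZ n (c : C) (u : 'I_n -> C) :
  l2norm (fun i => c * u i) = complex.Re `|c| * l2norm u.
Proof.
rewrite -[in RHS](@ger0_norm _ (complex.Re _)) ?Re_norm_ge0 // -sqrtr_sqr.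
rewrite -sqrtrM ?sqr_ge0 // mulr_sumr; congr Num.sqrt.
by apply: eq_bigr => i _; rewrite Re_normM exprMn.
Qed.

Section mxnorm_theory.
Variables m n : nat.
Implicit Types A B : 'M[C]_(m, n).

Lemma mxact_bounded A :
  exists M, forall u, l2norm u <= 1 -> l2norm (mxact A u) <= M.
Proof.
exists (Num.sqrt (\sum_i (\sum_j complex.Re `|A i j|) ^+ 2)) => u u1.
rewrite ler_sqrt; last by apply: sumr_ge0 => i _; exact: sqr_ge0.
apply: ler_sum => i _.
rewrite ler_pXn2r ?nnegrE ?Re_norm_ge0 ?sumr_ge0 // => [|j _]; last first.
  exact: Re_norm_ge0.
rewrite /mxact; elim/big_ind2: _ => [|x a y b xa yb|j _].
- by rewrite normr0.
- exact: le_trans (Re_normD _ _) (lerD xa yb).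
- by rewrite Re_normM ler_piMr ?Re_norm_ge0 // (le_trans (le_l2norm u j)).
Qed.

Lemma mxnorm_has_sup A :
  has_sup [set l2norm (mxact A u) | u in [set u | l2norm u <= 1]].
Proof.
split; first by exists (l2norm (mxact A (fun=> 0))), (fun=> 0) => //=;
  rewrite l2norm0.
have [M AM] := mxact_bounded A.
by exists M => _ [u /= u1 <-]; exact: AM.
Qed.

Lemma mxnorm_ge0 A : 0 <= mxnorm A.
Proof.
have := sup_upper_bound (mxnorm_has_sup A).
move=> /(_ (l2norm (mxact A (fun=> 0)))) h.
apply: le_trans (h _); first exact: l2norm_ge0.
by exists (fun=> 0) => //=; rewrite l2norm0.
Qed.

Lemma mxact_le A u : l2norm (mxact A u) <= mxnorm A * l2norm u.
Proof.
have [u0|u0] := eqVneq (l2norm u) 0.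
  rewrite u0 mulr0 (_ : mxact A u = fun=> 0) ?l2norm0 //.
  apply/funext => i; rewrite /mxact (l2norm_eq0 u0) big1 // => j _.
  by rewrite mulr0.
have {}u0 : 0 < l2norm u by rewrite lt_def u0 l2norm_ge0.
pose c : C := ((l2norm u)^-1)%:C.
have cE : complex.Re `|c| = (l2norm u)^-1.
  rewrite ger0_norm //; last by rewrite lecE /= eqxx invr_ge0 l2norm_ge0.
have E : mxact A (fun i => c * u i) = fun i => c * mxact A u i.
  apply/funext => i; rewrite /mxact mulr_sumr; apply: eq_bigr => j _.
  by rewrite mulrCA.
have := sup_upper_bound (mxnorm_has_sup A).
move=> /(_ (l2norm (mxact A (fun i => c * u i)))); rewrite -/(mxnorm A) => h.
rewrite -ler_pdivrMr // mulrC -cE -l2normZ -E; apply: h.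
by exists (fun i => c * u i) => //=; rewrite l2normZ cE mulVf // gt_eqF.
Qed.

Lemma mxnorm_le A M : 0 <= M ->
  (forall u, l2norm (mxact A u) <= M * l2norm u) -> mxnorm A <= M.
Proof.
move=> M0 AM; apply: ge_sup; first by case: (mxnorm_has_sup A).
move=> _ [u /= u1 <-]; apply: le_trans (AM u) _.
exact: ler_piMr.
Qed.

Lemma mxnormD A B : mxnorm (A + B) <= mxnorm A + mxnorm B.
Proof.
apply: mxnorm_le; first by rewrite addr_ge0 ?mxnorm_ge0.
move=> u; rewrite mulrDl.
apply: le_trans (lerD (mxact_le A u) (mxact_le B u)).
apply: le_trans (l2normD _ _); rewrite le_eqVlt; apply/orP; left; apply/eqP.
congr l2norm; apply/funext => i; rewrite /mxact -big_split /=.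
by apply: eq_bigr => j _; rewrite mxE mulrDl.
Qed.

Lemma mxnormZ (c : C) A : mxnorm (c *: A) <= complex.Re `|c| * mxnorm A.
Proof.
apply: mxnorm_le; first by rewrite mulr_ge0 ?mxnorm_ge0 ?Re_norm_ge0.
move=> u; rewrite (_ : mxact _ u = fun i => c * mxact A u i).
  by rewrite l2normZ -mulrA ler_wpM2l ?Re_norm_ge0 ?mxact_le.
apply/funext => i; rewrite /mxact mulr_sumr.
by apply: eq_bigr => j _; rewrite mxE mulrA.
Qed.

Lemma mxnorm0 : mxnorm (0 : 'M[C]_(m, n)) = 0.
Proof.
apply/eqP; rewrite eq_le mxnorm_ge0 andbT.
by have := mxnormZ 0 0; rewrite scale0r normr0 mul0r.
Qed.

End mxnorm_theory.

Lemma mxnormM m n p (A : 'M[C]_(m, n)) (B : 'M[C]_(n, p)) :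
  mxnorm (A *m B) <= mxnorm A * mxnorm B.
Proof.
apply: mxnorm_le; first by rewrite mulr_ge0 ?mxnorm_ge0.
move=> u; rewrite (_ : mxact _ u = mxact A (mxact B u)).
  apply: (le_trans (mxact_le _ _)).
  by rewrite -mulrA ler_wpM2l ?mxnorm_ge0 ?mxact_le.
apply/funext => i; rewrite /mxact.
under eq_bigr do rewrite mxE mulr_suml.
rewrite exchange_big /=; apply: eq_bigr => j _; rewrite mulr_sumr.
by apply: eq_bigr => k _; rewrite mulrA.
Qed.

Lemma mxnorm1 n : mxnorm (1%:M : 'M[C]_n) <= 1.
Proof.
apply: mxnorm_le => // u; rewrite mul1r (_ : mxact _ u = u) //.
apply/funext => i; rewrite /mxact (bigD1 i) //= mxE eqxx mul1r big1 ?addr0 //.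
by move=> j /negPf ji; rewrite mxE eq_sym ji mul0r.
Qed.

End OperatorNorm.

(* d-tuples of matrices of size n.+1: in this file the graded components are
   indexed by n = size - 1, so that only sizes >= 1 occur. *)
Notation mtuple R d n := {ffun 'I_d -> 'M[R[i]]_n.+1}.

(* A subset of the nc universe M^d, given by its graded components. *)
Definition ncdom (R : realType) (d : nat) := forall n, set (mtuple R d n).

Section NcFunctions.
Variables (R : realType) (d : nat).
Local Notation C := R[i].
Implicit Types (W V : ncdom R d).

Definition ncsub V W : Prop := forall n, V n `<=` W n.

(* n.+1 + m.+1 and (n + m.+1).+1 are convertible *)
Definition dsum n m (X : mtuple R d n) (Y : mtuple R d m) :
  mtuple R d (n + m.+1) := [ffun j => block_mx (X j) 0 0 (Y j)].

Definition conjmt n (S : 'M[C]_n.+1) (X : mtuple R d n) : mtuple R d n :=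
  [ffun j => S^-1 * X j * S].

Definition homogeneous V : Prop :=
  forall (c : C), `|c| <= 1 -> forall n X, V n X -> V n (c *: X).

(* Graded maps W -> M^1. *)
Definition gfun W := forall n (X : mtuple R d n), W n X -> 'M[C]_n.+1.

HB.instance Definition _ W := gen_eqMixin (gfun W).
HB.instance Definition _ W := gen_choiceMixin (gfun W).

Section gfun_algebra.
Variable W : ncdom R d.
Arguments W : clear implicits.
Implicit Types f g h : gfun W.

Lemma gfunP f g : (forall n X hX, f n X hX = g n X hX) -> f = g.
Proof.
by move=> fg; apply/functional_extensionality_dep => n;
  apply/functional_extensionality_dep => X;
  apply/functional_extensionality_dep => hX; exact: fg.
Qed.

Definition gfun_zero : gfun W := fun n X hX => 0.
Definition gfun_one : gfun W := fun n X hX => 1.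
Definition gfun_opp f : gfun W := fun n X hX => - f n X hX.
Definition gfun_add f g : gfun W := fun n X hX => f n X hX + g n X hX.
Definition gfun_mul f g : gfun W := fun n X hX => f n X hX * g n X hX.
Definition gfun_scale (c : C) f : gfun W := fun n X hX => c *: f n X hX.

Fact gfun_addA : associative gfun_add.
Proof. by move=> f g h; apply: gfunP => *; exact: addrA. Qed.
Fact gfun_addC : commutative gfun_add.
Proof. by move=> f g; apply: gfunP => *; exact: addrC. Qed.
Fact gfun_add0 : left_id gfun_zero gfun_add.
Proof. by move=> f; apply: gfunP => *; exact: add0r. Qed.
Fact gfun_addN : left_inverse gfun_zero gfun_opp gfun_add.
Proof. by move=> f; apply: gfunP => *; exact: addNr. Qed.

HB.instance Definition _ :=
  GRing.isZmodule.Build (gfun W) gfun_addA gfun_addC gfun_add0 gfun_addN.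

Fact gfun_mulA : associative gfun_mul.
Proof. by move=> f g h; apply: gfunP => *; exact: mulrA. Qed.
Fact gfun_mul1l : left_id gfun_one gfun_mul.
Proof. by move=> f; apply: gfunP => *; exact: mul1r. Qed.
Fact gfun_mul1r : right_id gfun_one gfun_mul.
Proof. by move=> f; apply: gfunP => *; exact: mulr1. Qed.
Fact gfun_mulDl : left_distributive gfun_mul +%R.
Proof. by move=> f g h; apply: gfunP => *; exact: mulrDl. Qed.
Fact gfun_mulDr : right_distributive gfun_mul +%R.
Proof. by move=> f g h; apply: gfunP => *; exact: mulrDr. Qed.

(* The algebras of this file may be zero (empty domain), hence pzRingType. *)
HB.instance Definition _ := GRing.Zmodule_isPzRing.Build (gfun W)
  gfun_mulA gfun_mul1l gfun_mul1r gfun_mulDl gfun_mulDr.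

Fact gfun_scaleA a b f : gfun_scale a (gfun_scale b f) = gfun_scale (a * b) f.
Proof. by apply: gfunP => *; exact: scalerA. Qed.
Fact gfun_scale1 : left_id 1 gfun_scale.
Proof. by move=> f; apply: gfunP => *; exact: scale1r. Qed.
Fact gfun_scaleDr : right_distributive gfun_scale +%R.
Proof. by move=> c f g; apply: gfunP => *; exact: scalerDr. Qed.
Fact gfun_scaleDl f : {morph gfun_scale^~ f : a b / a + b}.
Proof. by move=> a b; apply: gfunP => *; exact: scalerDl. Qed.

HB.instance Definition _ := GRing.Zmodule_isLmodule.Build C (gfun W)
  gfun_scaleA gfun_scale1 gfun_scaleDr gfun_scaleDl.

(* On a set W closed under direct sums this is the usual definition of a nc
   function; in general only the direct sums lying in W are constrained. *)
Definition is_ncfun f : Prop :=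
  (forall n m (X : mtuple R d n) (Y : mtuple R d m)
     (hX : W n X) (hY : W m Y) (hXY : W (n + m.+1)%N (dsum X Y)),
     f (n + m.+1)%N (dsum X Y) hXY = block_mx (f n X hX) 0 0 (f m Y hY)) /\
  (forall n (X : mtuple R d n) (S : 'M[C]_n.+1)
     (hX : W n X) (hSX : W n (conjmt S X)), S \is a GRing.unit ->
     f n (conjmt S X) hSX = S^-1 * f n X hX * S).

Definition in_Hinf f : Prop :=
  is_ncfun f /\ exists M : R, forall n X hX, mxnorm (f n X hX) <= M.

(* A free nc polynomial is a formal linear combination of words in 'I_d. *)
Definition ncpoly := seq (C * seq 'I_d).

Definition ncpoly_eval (p : ncpoly) n (X : mtuple R d n) : 'M[C]_n.+1 :=
  \sum_(t <- p) t.1 *: \prod_(j <- t.2) X j.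

(* Closure, for the sup norm over W, of the nc polynomials in H^oo(W). *)
Definition in_Acont f : Prop :=
  in_Hinf f /\ forall e : R, 0 < e -> exists p : ncpoly,
    forall n X hX, mxnorm (f n X hX - ncpoly_eval p X) <= e.

End gfun_algebra.

(* Acont: norm closure of the polynomials, A(W); Hinf: H^oo(W). *)
Inductive alg_kind := Acont | Hinf.

Definition in_algebra (k : alg_kind) W (f : gfun W) : Prop :=
  match k with Acont => in_Acont f | Hinf => in_Hinf f end.

Section algebra_closed.
Variable W : ncdom R d.
Arguments W : clear implicits.
Implicit Types f g : gfun W.

Lemma in_Hinf1 : in_Hinf (1 : gfun W).
Proof.
split; last by exists 1 => n X hX; exact: mxnorm1.
split=> [n m X Y hX hY hXY|n X S hX hSX uS].
  exact: (@scalar_mx_block _ n.+1 m.+1).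
by rewrite mulr1 mulVr.
Qed.

Lemma diag_blockD n m (c : C) (A A' : 'M[C]_n) (B B' : 'M[C]_m) :
  c *: block_mx A 0 0 B + block_mx A' 0 0 B' =
  block_mx (c *: A + A') 0 0 (c *: B + B').
Proof. by rewrite scale_block_mx add_block_mx !scaler0 !addr0. Qed.

Lemma diag_blockM n m (A A' : 'M[C]_n) (B B' : 'M[C]_m) :
  block_mx A 0 0 B *m block_mx A' 0 0 B' =
  block_mx (A *m A') 0 0 (B *m B').
Proof. by rewrite mulmx_block !mulmx0 !mul0mx !addr0 !add0r. Qed.

Lemma in_HinfB c f g : in_Hinf f -> in_Hinf g -> in_Hinf (c *: f + g).
Proof.
move=> [[f1 f2] [M fM]] [[g1 g2] [N gN]]; split; [split|].
- move=> n m X Y hX hY hXY.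
  rewrite -[LHS]/(c *: f _ _ hXY + g _ _ hXY) (f1 _ _ _ _ hX hY).
  by rewrite (g1 _ _ _ _ hX hY); exact: (@diag_blockD n.+1 m.+1).
- move=> n X S hX hSX uS.
  rewrite -[LHS]/(c *: f _ _ hSX + g _ _ hSX) (f2 _ _ _ hX hSX uS).
  rewrite (g2 _ _ _ hX hSX uS).
  by rewrite -[(c *: f + g) n X hX]/(c *: f _ _ hX + g _ _ hX) mulrDr mulrDl
    -scalerAr -scalerAl.
- exists (complex.Re `|c| * M + N) => n X hX.
  apply: (le_trans (mxnormD _ _)); apply: lerD (gN _ _ _).
  by apply: (le_trans (mxnormZ _ _)); rewrite ler_wpM2l ?Re_norm_ge0.
Qed.

Lemma in_HinfM f g : in_Hinf f -> in_Hinf g -> in_Hinf (f * g).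
Proof.
move=> [[f1 f2] [M fM]] [[g1 g2] [N gN]]; split; [split|].
- move=> n m X Y hX hY hXY.
  rewrite -[LHS]/(f _ _ hXY * g _ _ hXY) (f1 _ _ _ _ hX hY).
  by rewrite (g1 _ _ _ _ hX hY); exact: (@diag_blockM n.+1 m.+1).
- move=> n X S hX hSX uS.
  rewrite -[LHS]/(f _ _ hSX * g _ _ hSX) (f2 _ _ _ hX hSX uS).
  rewrite (g2 _ _ _ hX hSX uS) -[(f * g) n X hX]/(f _ _ hX * g _ _ hX).
  by rewrite !mulrA mulrK.
- exists (`|M| * `|N|) => n X hX; apply: (le_trans (mxnormM _ _)).
  by apply: ler_pM; rewrite ?mxnorm_ge0 ?(le_trans (fM _ _ _)) ?ler_norm //
    (le_trans (gN _ _ _)) ?ler_norm.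
Qed.

Definition ncpoly_scale (c : C) (p : ncpoly) : ncpoly :=
  [seq (c * t.1, t.2) | t <- p].

Definition ncpoly_mul (p q : ncpoly) : ncpoly :=
  [seq (t.1 * s.1, t.2 ++ s.2) | t <- p, s <- q].

Lemma ncpoly_evalD p q n (X : mtuple R d n) :
  ncpoly_eval (p ++ q) X = ncpoly_eval p X + ncpoly_eval q X.
Proof. exact: big_cat. Qed.

Lemma ncpoly_evalZ c p n (X : mtuple R d n) :
  ncpoly_eval (ncpoly_scale c p) X = c *: ncpoly_eval p X.
Proof.
rewrite /ncpoly_eval big_map scaler_sumr.
by apply: eq_bigr => t _; rewrite scalerA.
Qed.

Lemma ncpoly_evalM p q n (X : mtuple R d n) :
  ncpoly_eval (ncpoly_mul p q) X = ncpoly_eval p X * ncpoly_eval q X.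
Proof.
rewrite /ncpoly_eval /ncpoly_mul big_allpairs_dep /= mulr_suml.
apply: eq_bigr => t _; rewrite mulr_sumr; apply: eq_bigr => s _ /=.
by rewrite big_cat /= -scalerAl -scalerAr scalerA.
Qed.

Lemma in_Acont1 : in_Acont (1 : gfun W).
Proof.
split; first exact: in_Hinf1.
move=> e e0; exists [:: (1, [::])] => n X hX.
rewrite /ncpoly_eval big_seq1 big_nil scale1r -[X in mxnorm (X - _)]/1 subrr.
by rewrite mxnorm0 ltW.
Qed.

Lemma in_AcontB c f g : in_Acont f -> in_Acont g -> in_Acont (c *: f + g).
Proof.
move=> [hf af] [hg ag]; split; first exact: in_HinfB.
move=> e e0; set s := complex.Re `|c|.
have s1 : 0 < s + 1 by rewrite ltr_wpDl ?Re_norm_ge0.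
have e2 : 0 < e / 2 by rewrite divr_gt0.
have [p fp] := af (e / 2 / (s + 1)) (divr_gt0 e2 s1).
have [q gq] := ag (e / 2) e2.
exists (ncpoly_scale c p ++ q) => n X hX.
rewrite ncpoly_evalD ncpoly_evalZ.
have -> : (c *: f + g) n X hX - (c *: ncpoly_eval p X + ncpoly_eval q X) =
    c *: (f n X hX - ncpoly_eval p X) + (g n X hX - ncpoly_eval q X).
  by rewrite scalerBr opprD addrACA.
apply: (le_trans (mxnormD _ _)); rewrite [leRHS]splitr.
apply: lerD (gq _ _ _); apply: (le_trans (mxnormZ _ _)).
apply: (le_trans (ler_wpM2l (Re_norm_ge0 _) (fp _ _ _))); rewrite -/s.
rewrite mulrCA ler_piMr ?(ltW e2) // ler_pdivrMr // mul1r lerDl.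
exact: ler01.
Qed.

Lemma in_AcontM f g : in_Acont f -> in_Acont g -> in_Acont (f * g).
Proof.
move=> [hf af] [hg ag]; split; first exact: in_HinfM.
move=> e e0.
have [_ [M fM]] := hf; have [_ [N gN]] := hg.
have e2 : 0 < e / 2 by rewrite divr_gt0.
have M1 : 0 < `|M| + 1 by rewrite ltr_wpDl.
have [q gq] := ag (Num.min 1 (e / 2 / (`|M| + 1)))
  ltac:(by rewrite lt_min ltr01 divr_gt0).
have N1 : 0 < `|N| + 1 by rewrite ltr_wpDl.
have [p fp] := af (e / 2 / (`|N| + 1)) (divr_gt0 e2 N1).
exists (ncpoly_mul p q) => n X hX; rewrite ncpoly_evalM.
set P := ncpoly_eval p X; set Q := ncpoly_eval q X.
have -> : (f * g) n X hX - P * Q =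
    f n X hX * (g n X hX - Q) + (f n X hX - P) * Q.
  by rewrite mulrBr mulrBl addrA subrK.
have Qn : mxnorm Q <= `|N| + 1.
  rewrite -[Q](subrK (g n X hX)) addrC.
  apply: (le_trans (mxnormD _ _)); apply: lerD.
    by rewrite (le_trans (gN _ _ _)) ?ler_norm.
  rewrite -opprB -scaleN1r; apply: (le_trans (mxnormZ _ _)).
  by rewrite normrN1 mul1r (le_trans (gq _ _ _)) // ge_min lexx.
apply: (le_trans (mxnormD _ _)); rewrite [leRHS]splitr; apply: lerD.
  apply: (le_trans (mxnormM _ _)).
  apply: (@le_trans _ _ (`|M| * (e / 2 / (`|M| + 1)))).
    apply: ler_pM; rewrite ?mxnorm_ge0 //.
      by rewrite (le_trans (fM _ _ _)) ?ler_norm.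
    by rewrite (le_trans (gq _ _ _)) // ge_min lexx orbT.
  by rewrite mulrCA ler_piMr ?(ltW e2) // ler_pdivrMr // mul1r lerDl ler01.
apply: (le_trans (mxnormM _ _)).
apply: (le_trans (ler_pM (mxnorm_ge0 _) (mxnorm_ge0 _) (fp _ _ hX) Qn)).
by rewrite divfK // gt_eqF.
Qed.

Lemma in_algebra1 k : in_algebra k (1 : gfun W).
Proof. by case: k; [exact: in_Acont1 | exact: in_Hinf1]. Qed.
Lemma in_algebraB k c f g :
  in_algebra k f -> in_algebra k g -> in_algebra k (c *: f + g).
Proof. by case: k; [exact: in_AcontB | exact: in_HinfB]. Qed.
Lemma in_algebraM k f g :
  in_algebra k f -> in_algebra k g -> in_algebra k (f * g).
Proof. by case: k; [exact: in_AcontM | exact: in_HinfM]. Qed.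

Definition algebra_pred k : {pred gfun W} := fun f => `[< in_algebra k f >].

Fact algebra_subring k : subring_closed (algebra_pred k).
Proof.
split=> [|f g /asboolP hf /asboolP hg|f g /asboolP hf /asboolP hg];
  apply/asboolP.
- exact: in_algebra1.
- by rewrite addrC -scaleN1r; exact: in_algebraB.
- exact: in_algebraM.
Qed.

Fact algebra_scale k (c : C) : {in algebra_pred k, forall f, c *: f \in algebra_pred k}.
Proof.
move=> f /asboolP hf; apply/asboolP; rewrite -[c *: f]addr0 -(subrr 1).
have := in_algebraB (-1) (in_algebra1 k) (in_algebra1 k).
rewrite scaleN1r addrC; exact: in_algebraB.
Qed.

HB.instance Definition _ k :=
  GRing.isSubringClosed.Build (gfun W) (algebra_pred k) (algebra_subring k).
HB.instance Definition _ k :=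
  GRing.isScaleClosed.Build C (gfun W) (algebra_pred k) (@algebra_scale k).

End algebra_closed.

Record ncalg (k : alg_kind) W := NcAlg {
  ncalg_val :> gfun W;
  _ : ncalg_val \in @algebra_pred W k }.

Section ncalg_structure.
Variables (k : alg_kind) (W : ncdom R d).
Arguments W : clear implicits.

HB.instance Definition _ := [isSub for @ncalg_val k W].
HB.instance Definition _ := [Choice of ncalg k W by <:].
HB.instance Definition _ := GRing.SubChoice_isSubPzRing.Build (gfun W)
  (@algebra_pred W k) (ncalg k W) (@algebra_subring W k).
HB.instance Definition _ := [SubZmodule_isSubLmodule of ncalg k W by <:].

Lemma ncalgP (F : ncalg k W) : in_algebra k (F : gfun W).
Proof. by apply/asboolP; exact: (valP F). Qed.

Lemma ncalg_scalerAl (c : C) (F G : ncalg k W) : c *: (F * G) = (c *: F) * G.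
Proof. by apply/val_inj/gfunP => n X hX; exact: scalerAl. Qed.

Lemma ncalg_scalerAr (c : C) (F G : ncalg k W) : c *: (F * G) = F * (c *: G).
Proof. by apply/val_inj/gfunP => n X hX; exact: scalerAr. Qed.

(* The norm of M_N(H^oo(W)); [F_jk(X)] acts on the direct sum of N copies of
   C^n.+1. The set below is bounded for F in M_N(ncalg k W), and sup set0 = 0
   takes care of W empty. *)
Definition algnorm (N : nat) (F : 'M[ncalg k W]_N) : R :=
  sup [set r | exists n (X : mtuple R d n) (hX : W n X),
         r = mxnorm (\mxblock_(j < N, l < N) (F j l : gfun W) n X hX)].

End ncalg_structure.

Section Restriction.
Variables (k : alg_kind) (V W : ncdom R d).
Arguments V : clear implicits.
Arguments W : clear implicits.
Hypothesis VW : ncsub V W.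

Definition gfun_restr (f : gfun W) : gfun V := fun n X hX => f n X (VW hX).

Lemma in_algebra_restr (f : gfun W) :
  in_algebra k f -> in_algebra k (gfun_restr f).
Proof.
have inH : in_Hinf f -> in_Hinf (gfun_restr f).
  move=> [[f1 f2] [M fM]]; split; [split|].
  - by move=> n m X Y hX hY hXY; exact: f1.
  - by move=> n X S hX hSX; exact: f2.
  - by exists M => n X hX; exact: fM.
case: k => //= -[hf af]; split; first exact: inH.
move=> e e0; have [p fp] := af e e0.
by exists p => n X hX; exact: fp.
Qed.

Definition restr (F : ncalg k W) : ncalg k V :=
  NcAlg (asboolT (in_algebra_restr (ncalgP F))).

Fact restr_linear : linear restr.
Proof. by move=> c F G; apply/val_inj/gfunP. Qed.

Fact restr_monoid_morphism : monoid_morphism restr.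
Proof. by split=> [|F G]; apply/val_inj/gfunP. Qed.

HB.instance Definition _ := GRing.isLinear.Build C (ncalg k W) (ncalg k V) _
  restr restr_linear.
HB.instance Definition _ := GRing.isMonoidMorphism.Build
  (ncalg k W) (ncalg k V) restr restr_monoid_morphism.

End Restriction.

Section Quotient.
Variables (k : alg_kind) (W V : ncdom R d).
Arguments V : clear implicits.
Arguments W : clear implicits.

(* I(V), as an ideal of the algebra on W. *)
Definition vanishing : {pred ncalg k W} := fun F =>
  `[< forall n X (hX : W n X), V n X -> (F : gfun W) n X hX = 0 >].

Fact vanishing_zmod : zmod_closed vanishing.
Proof.
split=> [|F G /asboolP F0 /asboolP G0]; apply/asboolP => n X hX vX //.
by rewrite -[LHS]/((F : gfun W) n X hX - (G : gfun W) n X hX) F0 // G0 // subrr.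
Qed.

HB.instance Definition _ :=
  GRing.isZmodClosed.Build (ncalg k W) vanishing vanishing_zmod.

Lemma vanishingMl F G : G \in vanishing -> F * G \in vanishing.
Proof.
move=> /asboolP G0; apply/asboolP => n X hX vX.
by rewrite -[LHS]/((F : gfun W) n X hX * (G : gfun W) n X hX) G0 // mulr0.
Qed.

Lemma vanishingMr F G : F \in vanishing -> F * G \in vanishing.
Proof.
move=> /asboolP F0; apply/asboolP => n X hX vX.
by rewrite -[LHS]/((F : gfun W) n X hX * (G : gfun W) n X hX) F0 // mul0r.
Qed.

Lemma vanishingZ (c : C) F : F \in vanishing -> c *: F \in vanishing.
Proof.
move=> /asboolP F0; apply/asboolP => n X hX vX.
by rewrite -[LHS]/(c *: (F : gfun W) n X hX) F0 // scaler0.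
Qed.

(* The library equips the quotient with its additive structure only, since
   the ring structure provided there is for commutative rings. *)
Definition quotalg := Quotient.quot vanishing.

HB.instance Definition _ := GRing.Zmodule.on quotalg.
HB.instance Definition _ :=
  ZmodQuotient.on quotalg.

Local Notation pi := (\pi_quotalg).

Lemma quotalg_eqP F G : reflect (pi F = pi G) (F - G \in vanishing).
Proof. by rewrite Quotient.idealrBE; exact: eqP. Qed.

Definition quotalg_mul (q r : quotalg) : quotalg := pi (repr q * repr r).
Definition quotalg_scale (c : C) (q : quotalg) : quotalg := pi (c *: repr q).

Lemma repr_piB F : repr (pi F) - F \in vanishing.
Proof. by apply/quotalg_eqP; rewrite reprK. Qed.

Lemma pi_mulq F G : pi (F * G) = quotalg_mul (pi F) (pi G).
Proof.
apply/esym/quotalg_eqP; set f := repr _; set g := repr _.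
have -> : f * g - F * G = f * (g - G) + (f - F) * G.
  by rewrite mulrBr mulrBl addrA subrK.
apply: rpredD; first by rewrite vanishingMl ?repr_piB.
by rewrite vanishingMr ?repr_piB.
Qed.

Lemma pi_scaleq c F : pi (c *: F) = quotalg_scale c (pi F).
Proof.
by apply/esym/quotalg_eqP; rewrite -scalerBr vanishingZ ?repr_piB.
Qed.

Lemma pi_addq F G : pi (F + G) = pi F + pi G.
Proof. exact: raddfD. Qed.

Lemma quotalgW (P : quotalg -> Prop) : (forall F, P (pi F)) -> forall q, P q.
Proof. by move=> PF q; rewrite -[q]reprK. Qed.

Fact quotalg_mulA : associative quotalg_mul.
Proof.
by elim/quotalgW=> F; elim/quotalgW=> G; elim/quotalgW=> H;
  rewrite -!pi_mulq mulrA.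
Qed.
Fact quotalg_mul1l : left_id (pi 1) quotalg_mul.
Proof. by elim/quotalgW=> F; rewrite -pi_mulq mul1r. Qed.
Fact quotalg_mul1r : right_id (pi 1) quotalg_mul.
Proof. by elim/quotalgW=> F; rewrite -pi_mulq mulr1. Qed.
Fact quotalg_mulDl : left_distributive quotalg_mul +%R.
Proof.
by elim/quotalgW=> F; elim/quotalgW=> G; elim/quotalgW=> H;
  rewrite -pi_addq -!pi_mulq -pi_addq mulrDl.
Qed.
Fact quotalg_mulDr : right_distributive quotalg_mul +%R.
Proof.
by elim/quotalgW=> F; elim/quotalgW=> G; elim/quotalgW=> H;
  rewrite -pi_addq -!pi_mulq -pi_addq mulrDr.
Qed.

HB.instance Definition _ := GRing.Zmodule_isPzRing.Build quotalg
  quotalg_mulA quotalg_mul1l quotalg_mul1r quotalg_mulDl quotalg_mulDr.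

Fact quotalg_scaleA a b q :
  quotalg_scale a (quotalg_scale b q) = quotalg_scale (a * b) q.
Proof. by elim/quotalgW: q => F; rewrite -!pi_scaleq scalerA. Qed.
Fact quotalg_scale1 : left_id 1 quotalg_scale.
Proof. by elim/quotalgW=> F; rewrite -pi_scaleq scale1r. Qed.
Fact quotalg_scaleDr : right_distributive quotalg_scale +%R.
Proof.
by move=> c; elim/quotalgW=> F; elim/quotalgW=> G;
  rewrite -pi_addq -!pi_scaleq -pi_addq scalerDr.
Qed.
Fact quotalg_scaleDl q : {morph quotalg_scale^~ q : a b / a + b}.
Proof.
by move=> a b; elim/quotalgW: q => F; rewrite -!pi_scaleq -pi_addq scalerDl.
Qed.

HB.instance Definition _ := GRing.Zmodule_isLmodule.Build C quotalg
  quotalg_scaleA quotalg_scale1 quotalg_scaleDr quotalg_scaleDl.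

(* Quotient norm of M_N(A)/M_N(I), identified with M_N(A/I) entrywise. *)
Definition quotnorm (N : nat) (M : 'M[quotalg]_N) : R :=
  inf [set algnorm F | F in [set F : 'M[ncalg k W]_N | map_mx pi F = M]].

(* The map induced on the quotient by restriction to V; it does not depend on
   the representative, see restr_quot_pi. *)
Definition restr_quot (VW : ncsub V W) (q : quotalg) : ncalg k V :=
  restr VW (repr q).

Lemma restr_quot_pi (VW : ncsub V W) F : restr_quot VW (pi F) = restr VW F.
Proof.
apply/val_inj/gfunP => n X hX; apply/eqP; rewrite -subr_eq0; apply/eqP.
by have /asboolP/(_ n X (VW _ _ hX) hX) := repr_piB F.
Qed.

End Quotient.

End NcFunctions.

Arguments algnorm {R d} k W N F.
Arguments restr {R d} k {V W} VW F.
Arguments vanishing {R d k W} V F.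
Arguments quotnorm {R d} k W V N M.
Arguments restr_quot {R d} k {W V} VW q.

Section OperatorBall.
Variables (R : realType) (d : nat) (HR HS : completeNormedModType R[i]).
Variable Q : 'I_d -> {linear HR -> HS}.
Local Notation C := R[i].

Definition lin_indep : Prop :=
  forall c : 'I_d -> C,
    (forall x, \sum_j c j *: Q j x = 0) -> forall j, c j = 0.

(* Q(X) = \sum_j Q_j (x) X_j, as a map from n.+1 copies of HR to n.+1 copies
   of HS. *)
Definition Qop n (X : mtuple R d n) (u : 'I_n.+1 -> HR) (i : 'I_n.+1) : HS :=
  \sum_j \sum_l X j i l *: Q j (u l).

Definition ncball : ncdom R d := fun n => [set X | opnorm (Qop X) < 1].

Variable k : alg_kind.

Definition zero_set (S : set (ncalg k ncball)) : ncdom R d := fun n =>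
  [set X | exists hX : ncball X,
     forall F, S F -> (F : gfun ncball) n X hX = 0].

Definition subvariety (V : ncdom R d) : Prop :=
  exists S : set (ncalg k ncball), V = zero_set S.

Lemma subvariety_sub V : subvariety V -> ncsub V ncball.
Proof. by move=> [S ->] n X []. Qed.

End OperatorBall.

Arguments ncball {R d HR HS} Q n X.
Arguments subvariety {R d HR HS} Q k V.

(* nA and nB are families of matrix norms: nA N is the norm of M_N(A). *)
Section CompleteMaps.
Variables (R : realType) (A B : Type).
Variables (nA : forall N, 'M[A]_N -> R) (nB : forall N, 'M[B]_N -> R).

Definition complete_contraction (f : A -> B) : Prop :=
  forall N (M : 'M[A]_N), nB (map_mx f M) <= nA M.

Definition complete_isometry (f : A -> B) : Prop :=
  forall N (M : 'M[A]_N), nB (map_mx f M) = nA M.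

End CompleteMaps.

(* Main.v *)
Require Import Defs.
From mathcomp Require Import all_boot all_order all_algebra.
From mathcomp Require Import complex.
From mathcomp Require Import all_classical all_reals all_analysis.
From mathcomp Require Import ring lra.

(* Let f be a nc function on V with block norm at most 1. A cone separation argument
   shows that, at a point X of V, the defect 1 - f f^* of f lies, up to
   eps, in the cone generated by the positive matrices and the defects
   s^2 u u^* - (Q(X)u)(Q(X)u)^*: a functional separating them is, up to a small
   multiple of the trace, of the form T^* T with T invertible, and the similar
   point T X T^-1, which is again in V, would contradict |f| <= 1. Such a
   decomposition yields a contractive realization by the lurking isometry
   argument, and the Cesaro means of its Neumann series are nc polynomials that
   are contractive on the ball of radius s and close to f at X. A limit of
   these polynomials along an ultrafilter extends f to the whole of D_Q with
   the same norm; it is the sum of its limit Taylor series, uniformly on each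
   smaller ball. This settles H^oo. For A(D_Q) and homogeneous V, if G extends
   the restriction of F then G(rX) + F(X) - F(rX) is an element of A(D_Q) with
   the same restriction to V as F, and almost the norm of G. *)

Set Implicit Arguments.
Unset Strict Implicit.
Unset Printing Implicit Defensive.

Import Order.TTheory GRing.Theory Num.Theory.
Import numFieldNormedType.Exports.

Local Open Scope classical_set_scope.
Local Open Scope ring_scope.
Local Open Scope complex_scope.

(** * Separation from a convex cone *)

(** Two obstacles shape the proof: the cone of defects is not shown to be closed, and the two
    Hilbert spaces may be infinite-dimensional. The error [eps] answers both. It makes an elementary
    separation in a finite-dimensional matrix space sufficient, and it enters the Gram matrix of the
    lurking isometry as a multiple of the identity, which makes it invertible; the contraction is
    then computed in coordinates, by matrices of size [M.+1], from finitely many vectors. For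
    complete isometry the polynomials must be contractive, and close to f, on all of C^(n.+1) (x)
    C^N, so the basis vectors of this space are interpolated together: they are packed into one
    vector over a direct sum of copies of the point. The extension obtained is only in H^oo.
    Surjectivity onto A(V) therefore comes from lifting differences of polynomials with control of
    the norm and summing the lifts in the complete algebra A(D_Q). Linear independence of the Q_j
    bounds the coordinates X_j on D_Q, hence every nc polynomial; this puts polynomials in A(D_Q)
    and makes dilations converge there. *)

Section ConeSeparation.
Variables (R : realType) (W : lmodType R).

Definition convex_cone (C : set W) : Prop :=
  (forall x y, C x -> C y -> C (x + y)) /\
  (forall (t : R) x, 0 <= t -> C x -> C (t *: x)).

(* A positive functional on a subspace, given by its graph. *)
Definition pos_graph (C : set W) (G : W -> R -> Prop) : Prop :=
  (forall (c : R) x a y b, G x a -> G y b -> G (c *: x + y) (c * a + b)) /\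
  (forall x a, G x a -> C x -> 0 <= a).

Variables (C : set W) (e : W).
Hypothesis Ccone : convex_cone C.
Hypothesis e_unit : forall x, exists t : R, C (t *: e + x).

(** One step of the M. Riesz extension: the value at [x] is the infimum of the values of [G] at
    points dominating [x]. It is the largest admissible value, and the last clause records this
    because the separation needs a value of at least [eps]. The order unit [e] makes the infimum run
    over a nonempty set that is bounded below. *)
Lemma pos_graph_extend (G : W -> R -> Prop) (x : W) :
  pos_graph C G -> G 0 0 -> G e 1 ->
  exists l, pos_graph C (fun y b => exists c a, G (y - c *: x) a /\ b = a + c * l)
    /\ forall m, (forall y a, G y a -> C (y - x) -> m <= a) -> m <= l.
Proof.
move=> [Glin Gpos] G0 Ge; have [CD CZ] := Ccone.
have GZ c y a : G y a -> G (c *: y) (c * a).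
  by move=> Gy; have := Glin c _ _ _ _ Gy G0; rewrite !addr0.
have GD y a z b : G y a -> G z b -> G (y + z) (a + b).
  by move=> Gy Gz; have := Glin 1 _ _ _ _ Gy Gz; rewrite scale1r mul1r.
pose S := [set a | exists2 y, G y a & C (y - x)].
have S0 : S !=set0.
  have [t Ct] := e_unit (- x); exists t; exists (t *: e) => //.
  by have := GZ t _ _ Ge; rewrite mulr1.
have [t' Ct'] := e_unit x.
have Gte : G (t' *: e) t' by have := GZ t' _ _ Ge; rewrite mulr1.
have Slb : lbound S (- t').
  move=> a [y Gy Cy]; rewrite lerNl -subr_ge0 opprK addrC.
  apply: (Gpos _ _ (GD _ _ _ _ Gy Gte)).
  by have := CD _ _ Cy Ct'; rewrite addrACA addNr addr0.
exists (inf S); split; last first.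
  by move=> m mS; apply: lb_le_inf => // a [y Gy Cy]; exact: mS Gy Cy.
have infS a y : G y a -> C (y - x) -> inf S <= a.
  by move=> Gy Cy; apply: ge_inf; [exists (- t') | exists y].
split=> [c y _ z _ [c1 [a1 [G1 ->]]] [c2 [a2 [G2 ->]]]|y _ [c [a [Gy ->]]] Cy].
  exists (c * c1 + c2), (c * a1 + a2); split; last by ring.
  rewrite (_ : _ - _ = c *: (y - c1 *: x) + (z - c2 *: x)); first exact: Glin.
  by rewrite scalerBr scalerA scalerDl opprD addrACA.
(* Write y = g + c x with g in the old domain. For c > 0 the point -g/c lies below [x], so its value
   is a lower bound of [S]; for c < 0 the point -g/c dominates [x], so its value belongs to [S]. *)
have [c0|c0|c0] := ltgtP c 0; last first.
- by rewrite c0 mul0r addr0; apply: (Gpos y) => //; rewrite c0 scale0r subr0 in Gy.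
- have ci : 0 <= c^-1 by rewrite invr_ge0 ltW.
  have Gy' := GZ c^-1 _ _ Gy.
  have := CZ _ _ ci Cy.
  rewrite (_ : c^-1 *: y = c^-1 *: (y - c *: x) + x); last first.
    by rewrite scalerBr scalerA mulVf ?gt_eqF // scale1r subrK.
  move=> Cy'; rewrite -(pmulr_rge0 _ (_ : 0 < c^-1)) ?invr_gt0 //.
  rewrite mulrDr mulrA mulVf ?gt_eqF // mul1r -lerBlDl sub0r.
  apply: lb_le_inf => // b [z Gz Cz].
  rewrite -subr_ge0 opprK; apply: (Gpos _ _ (GD _ _ _ _ Gz Gy')).
  by have := CD _ _ Cz Cy'; rewrite addrACA addNr addr0.
- have ci : 0 <= (- c)^-1 by rewrite invr_ge0 oppr_ge0 ltW.
  have Gy' := GZ (- c)^-1 _ _ Gy.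
  have := CZ _ _ ci Cy.
  rewrite (_ : (- c)^-1 *: y = (- c)^-1 *: (y - c *: x) - x); last first.
    rewrite scalerBr scalerA invrN mulNr mulVf ?lt_eqF //.
    by rewrite scaleN1r opprK addrK.
  move=> Cy'; have := infS _ _ Gy' Cy'.
  rewrite mulrC ler_pdivlMr ?oppr_gt0 // => h.
  by rewrite (_ : a + _ = a - inf S * - c) ?subr_ge0 //; ring.
Qed.

(** A finite list replaces Zorn's lemma: it will consist of the matrix units, which span. *)
Lemma pos_graph_extend_seq (s : seq W) (G : W -> R -> Prop) :
  pos_graph C G -> G 0 0 -> G e 1 ->
  exists G', [/\ pos_graph C G', (forall x a, G x a -> G' x a) &
    forall x, x \in s -> exists a, G' x a].
Proof.
elim: s G => [|x s IH] G Gp G0 Ge; first by exists G; split.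
have [l [Gp' _]] := pos_graph_extend x Gp G0 Ge.
set G1 := (fun _ _ => _) in Gp'.
have sub1 y a : G y a -> G1 y a.
  by exists 0, a; rewrite scale0r subr0 mul0r addr0.
have [G2 [Gp2 s2 d2]] := IH G1 Gp' (sub1 _ _ G0) (sub1 _ _ Ge).
exists G2; split => //; first by move=> y a /sub1/s2.
move=> y; rewrite inE => /orP[/eqP->|/d2 //].
exists l; apply: s2; exists 1, 0; rewrite scale1r subrr mul1r add0r.
by split.
Qed.

End ConeSeparation.

Lemma cone_separation (R : realType) (m n : nat) (C : set 'M[R]_(m, n))
    (e h : 'M[R]_(m, n)) (eps : R) :
  convex_cone C -> C 0 -> C e -> (forall x, exists t : R, C (t *: e + x)) ->
  0 < eps -> ~ C (h + eps *: e) ->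
  exists l : 'M[R]_(m, n),
    let L x := \sum_i \sum_j l i j * x i j in
    [/\ (forall x, C x -> 0 <= L x), L e = 1 & L h < 0].
Proof.
move=> Ccone C0 Ce e_unit eps0 hC; have [CD CZ] := Ccone.
have up a : a <= eps -> ~ C (h + a *: e).
  move=> ae Ca; apply: hC; have := CD _ _ Ca (CZ (eps - a) _ _ Ce).
  by rewrite -addrA -scalerDl (addrC a) subrK; apply; rewrite subr_ge0.
pose G1 (x : 'M[R]_(m, n)) a := x = a *: e.
have G1p : pos_graph C G1.
  split=> [c x a y b -> ->|x a -> Ca]; first by rewrite /G1 scalerDl scalerA.
  rewrite leNgt; apply/negP => a0.
  have [t Ct] := e_unit h; have [te|te] := leP t eps.
    by apply: (up _ te); rewrite addrC.
  (* A negative multiple of [e] in the cone could be added to [h + t *: e] until the coefficient of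
     [e] drops to [eps]. *)
  have te0 : 0 <= (t - eps) / - a by rewrite divr_ge0 ?subr_ge0 1?ltW ?oppr_gt0.
  apply: hC; have := CD _ _ Ct (CZ _ _ te0 Ca).
  rewrite scalerA invrN mulrN mulNr divfK ?lt_eqF // addrAC -scalerDl.
  by rewrite addrC opprB (addrC t) subrK.
have G10 : G1 0 0 by rewrite /G1 scale0r.
have G1e : G1 e 1 by rewrite /G1 scale1r.
(* The first vector to be added is [- h]: the largest admissible value there is at least [eps],
   which forces a negative value at [h]. *)
have [l0 [G2p l0ge]] := pos_graph_extend Ccone e_unit (- h) G1p G10 G1e.
set G2 := (fun _ _ => _) in G2p.
have sub2 y a : G1 y a -> G2 y a.
  by exists 0, a; rewrite scale0r subr0 mul0r addr0.
have el0 : eps <= l0.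
  apply: l0ge => y a ->; rewrite opprK => Ca; rewrite leNgt; apply/negP => ae.
  by apply: (up _ (ltW ae)); rewrite addrC.
have G2h : G2 (- h) l0.
  by exists 1, 0; rewrite scale1r subrr mul1r add0r; split.
pose s : seq 'M[R]_(m, n) :=
  [seq delta_mx p.1 p.2 | p <- enum {: 'I_m * 'I_n}].
have [G [[Glin Gpos] sub3 Gs]] := pos_graph_extend_seq Ccone e_unit s G2p
  (sub2 _ _ G10) (sub2 _ _ G1e).
have G0 : G 0 0 by apply/sub3/sub2.
have Gd i j : exists a, G (delta_mx i j) a.
  by apply: Gs; apply/mapP; exists (i, j); rewrite ?mem_enum.
exists (\matrix_(i, j) sval (cid (Gd i j))) => L.
have GD y a z b : G y a -> G z b -> G (y + z) (a + b).
  by move=> Gy Gz; have := Glin 1 _ _ _ _ Gy Gz; rewrite scale1r mul1r.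
have GL x : G x (L x).
  rewrite {1}(matrix_sum_delta x) /L.
  elim/big_ind2: _ => [|y a z b|i _]; [exact: G0|exact: GD|].
  elim/big_ind2: _ => [|y a z b|j _]; [exact: G0|exact: GD|].
  rewrite mxE; case: cid => a /= Ga; rewrite mulrC.
  by have := Glin (x i j) _ _ _ _ Ga G0; rewrite !addr0.
(* Two values at one point differ by a value at 0, and 0 is in the cone, so both differences are
   nonnegative. *)
have Guniq x a b : G x a -> G x b -> a = b.
  have Gle y c d : G y c -> G y d -> c <= d.
    move=> Gc Gd'; rewrite -subr_ge0; apply: (Gpos 0) => //.
    by have := Glin (-1) _ _ _ _ Gc Gd'; rewrite scaleN1r mulN1r addNr addrC.
  by move=> Ga Gb; apply/eqP; rewrite eq_le (Gle x) // (Gle x).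
split=> [x Cx||]; first exact: Gpos (GL x) Cx.
  by apply: Guniq (GL e) _; apply/sub3/sub2.
have Gh : G h (- l0).
  have := Glin (-1) _ _ _ _ (sub3 _ _ G2h) G0.
  by rewrite scaleN1r opprK mulN1r !addr0.
by rewrite (Guniq _ _ _ (GL h) Gh) oppr_lt0 (lt_le_trans eps0).
Qed.

(** * Complex matrices and semi-inner products *)

Section ComplexMatrices.
Variable R : realType.
Local Notation C := R[i].
Local Notation Re := complex.Re.

Definition ctr m n (A : 'M[C]_(m, n)) : 'M[C]_(n, m) := map_mx Num.conj A^T.

Definition sqnorm (H : normedZmodType C) (x : H) : R := Re `|x| ^+ 2.

Lemma sqnorm_ge0 (H : normedZmodType C) (x : H) : 0 <= sqnorm x.
Proof. exact: sqr_ge0. Qed.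

Lemma sqnormC (z : C) : (sqnorm z)%:C = z * z^*%R.
Proof. by rewrite -normCK Re_norm_real rmorphXn. Qed.

Lemma sqnormE (z : C) : sqnorm z = Re z ^+ 2 + complex.Im z ^+ 2.
Proof.
apply: complexI; rewrite sqnormC; case: z => a b.
by apply/eqP; rewrite eq_complex /=; apply/andP; split; apply/eqP; ring.
Qed.

Lemma ge0_ReE (z : C) : 0 <= z -> z = (Re z)%:C.
Proof. by rewrite lecE => /andP[/eqP]; case: z => a b /= ->. Qed.

Lemma Re_ge0 (z : C) : 0 <= z -> 0 <= Re z.
Proof. by rewrite lecE => /andP[]. Qed.

Lemma realC_ge0 (a : R) : (0 <= a%:C) = (0 <= a).
Proof. by rewrite lecE /= eqxx. Qed.

Lemma ReD (x y : C) : Re (x + y) = Re x + Re y.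
Proof. by case: x y => [a b] [c e]. Qed.

Lemma ReZ (a : R) (x : C) : Re (a%:C * x) = a * Re x.
Proof. by case: x => [c e] /=; rewrite mul0r subr0. Qed.

Lemma Re_sum (I : Type) (s : seq I) (P : pred I) (F : I -> C) :
  Re (\sum_(i <- s | P i) F i) = \sum_(i <- s | P i) Re (F i).
Proof. by elim/big_rec2: _ => // i x y _ <-; rewrite ReD. Qed.

Lemma ctrK m n (A : 'M[C]_(m, n)) : ctr (ctr A) = A.
Proof. by apply/matrixP => i j; rewrite !mxE conjCK. Qed.

Lemma ctrD m n (A B : 'M[C]_(m, n)) : ctr (A + B) = ctr A + ctr B.
Proof. by apply/matrixP => i j; rewrite !mxE rmorphD. Qed.

Lemma ctrM m n p (A : 'M[C]_(m, n)) (B : 'M[C]_(n, p)) :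
  ctr (A *m B) = ctr B *m ctr A.
Proof. by rewrite /ctr trmx_mul map_mxM. Qed.

Lemma ctrZ m n (c : C) (A : 'M[C]_(m, n)) : ctr (c *: A) = c^*%R *: ctr A.
Proof. by apply/matrixP => i j; rewrite !mxE rmorphM. Qed.

Lemma ctr1 n : ctr (1%:M : 'M[C]_n) = 1%:M.
Proof. by rewrite /ctr trmx1 map_mx1. Qed.

Lemma ctr0 m n : ctr (0 : 'M[C]_(m, n)) = 0.
Proof. by rewrite /ctr trmx0 map_mx0. Qed.

Lemma ctr_sum (I : Type) (s : seq I) m n (F : I -> 'M[C]_(m, n)) :
  ctr (\sum_(i <- s) F i) = \sum_(i <- s) ctr (F i).
Proof. exact: (big_morph (@ctr m n) (@ctrD m n) (ctr0 m n)). Qed.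

(** The squared Hilbert-Schmidt norm; squares make the energy balances of the realization
    additive. *)
Definition fro m n (A : 'M[C]_(m, n)) : R := \sum_i \sum_j sqnorm (A i j).

Lemma fro_ge0 m n (A : 'M[C]_(m, n)) : 0 <= fro A.
Proof. by apply: sumr_ge0 => i _; apply: sumr_ge0 => j _; exact: sqnorm_ge0. Qed.

Lemma froE m n (A : 'M[C]_(m, n)) : (fro A)%:C = \tr (A *m ctr A).
Proof.
rewrite /fro rmorph_sum; apply: eq_bigr => i _; rewrite mxE rmorph_sum.
by apply: eq_bigr => j _; rewrite !mxE -sqnormC.
Qed.

Definition psd n (A : 'M[C]_n) : Prop :=
  ctr A = A /\ forall z : 'rV[C]_n, 0 <= (z *m A *m ctr z) 0 0.

Lemma psd0 n : psd (0 : 'M[C]_n).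
Proof. by split=> [|z]; rewrite ?ctr0 // mulmx0 mul0mx mxE. Qed.

Lemma psdD n (A B : 'M[C]_n) : psd A -> psd B -> psd (A + B).
Proof.
move=> [hA pA] [hB pB]; split; first by rewrite ctrD hA hB.
by move=> z; rewrite mulmxDr mulmxDl mxE addr_ge0.
Qed.

Lemma conjC_real (a : R) : (a%:C)^*%R = a%:C :> C.
Proof. by apply/eqP; rewrite eq_complex /= oppr0 !eqxx. Qed.

Lemma psdZ n (t : R) (A : 'M[C]_n) : 0 <= t -> psd A -> psd (t%:C *: A).
Proof.
move=> t0 [hA pA]; split; first by rewrite ctrZ hA conjC_real.
by move=> z; rewrite -scalemxAr -scalemxAl mxE mulr_ge0 ?realC_ge0.
Qed.

Lemma psd_mul n p (A : 'M[C]_(n, p)) : psd (A *m ctr A).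
Proof.
split=> [|z]; first by rewrite ctrM ctrK.
rewrite mulmxA -mulmxA -ctrM.
have := froE (z *m A); rewrite /mxtrace big_ord1 => <-.
by rewrite realC_ge0 fro_ge0.
Qed.

Lemma psd1 n : psd (1%:M : 'M[C]_n).
Proof. by have := psd_mul (1%:M : 'M[C]_n); rewrite ctr1 mulmx1. Qed.

(** The spectral theorem diagonalizes A + t by a unitary U with a diagonal D > 0, and T = D^(1/2) U.
    The shift by [t] is what makes [T] invertible. *)
Lemma psd_factor n (A : 'M[C]_n) (t : R) : psd A -> 0 < t ->
  exists T : 'M[C]_n, T \in unitmx /\ ctr T *m T = A + (t%:C)%:M.
Proof.
move=> [hA pA] t0; set B := A + _.
have hB : B \is hermsymmx.
  have cB : ctr B = B by rewrite /B ctrD hA -scalemx1 ctrZ ctr1 conjC_real.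
  by apply/is_hermitianmxP; rewrite expr0 scale1r; exact: esym cB.
have /orthomx_spectralP BE := hermitian_normalmx hB.
set U := spectralmx B in BE; set D := spectral_diag B in BE.
have uU : U \is unitarymx by exact: spectral_unitarymx.
have UU : U *m ctr U = 1%:M by apply/unitarymxP.
have UU' : ctr U *m U = 1%:M by rewrite mulmx1C.
have iU : invmx U = ctr U by exact: invmx_unitary.
have DE : diag_mx D = U *m B *m ctr U.
  rewrite BE iU !mulmxA UU mul1mx -!mulmxA.
  by rewrite UU mulmx1.
have Dpos i : 0 < D 0 i.
  have Dii (M : 'M[C]_n) : (U *m M *m ctr U) i i =
      (row i U *m M *m ctr (row i U)) 0 0.
    rewrite !mxE; apply: eq_bigr => k _; rewrite -row_mul !mxE.
    by congr (_ * _); rewrite !mxE.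
  have -> : D 0 i = (row i U *m B *m ctr (row i U)) 0 0.
    by rewrite -Dii -DE mxE eqxx mulr1n.
  rewrite mulmxDr mulmxDl mxE; apply: ltr_wpDl; first exact: pA.
  rewrite -Dii mul_mx_scalar -scalemxAl UU !mxE eqxx mulr1.
  by rewrite ltcE /= eqxx.
pose S : 'rV[C]_n := \row_i sqrtC (D 0 i).
exists (diag_mx S *m U); split.
  rewrite unitmx_mul unitmxE det_diag unitfE; apply/andP; split.
    apply/prodf_neq0 => i _; rewrite mxE sqrtC_eq0; exact: lt0r_neq0.
  exact: unitarymx_unit.
have cS : ctr (diag_mx S) = diag_mx S.
  apply/matrixP => i j; rewrite !mxE eq_sym.
  case: eqP => [->|]; last by rewrite !mulr0n rmorph0.
  by rewrite !mulr1n; apply/conj_Creal/ger0_real; rewrite sqrtC_ge0 ltW.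
rewrite ctrM cS !mulmxA -[ctr U *m _ *m _]mulmxA mulmx_diag.
rewrite (_ : \row_i _ = D); last first.
  by apply/matrixP => a i; rewrite !mxE ord1 -expr2 sqrtCK.
by rewrite [RHS]BE iU.
Qed.

End ComplexMatrices.

Section SemiInner.
Variable R : realType.
Local Notation C := R[i].
Local Notation Re := complex.Re.

Definition semi_inner (E : lmodType C) (b : E -> E -> C) : Prop :=
  [/\ forall c x y z, b (c *: x + y) z = c * b x z + b y z,
      forall x y, b y x = (b x y)^*%R & forall x, 0 <= b x x].

Definition gram (E : lmodType C) (b : E -> E -> C) M (u : 'I_M -> E) : 'M[C]_M :=
  \matrix_(i, j) b (u i) (u j).

(** The operator T (x) 1 on C^n (x) E. *)
Definition mixv (E : lmodType C) m n (T : 'M[C]_(m, n)) (u : 'I_n -> E) :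
  'I_m -> E := fun i => \sum_a T i a *: u a.

Lemma is_hilbert_inner (H : completeNormedModType C) : is_hilbert H ->
  exists b : H -> H -> C, semi_inner b /\ forall x, b x x = (sqnorm x)%:C.
Proof.
move=> [ip ipE]; exists ip; split; last first.
  by move=> x; rewrite -ipE rmorphXn /= -Re_norm_real.
split.
- by move=> c x y z; rewrite linearPl.
- by move=> x y; rewrite hermC /= expr0 mul1r.
- by move=> x; rewrite -ipE exprn_ge0.
Qed.

Section Theory.
Variables (E : lmodType C) (b : E -> E -> C).
Hypothesis hb : semi_inner b.

Lemma innerDl x y z : b (x + y) z = b x z + b y z.
Proof. by case: hb => h _ _; rewrite -[x]scale1r h scale1r mul1r. Qed.
Lemma inner0l z : b 0 z = 0.
Proof. by apply: (addrI (b 0 z)); rewrite -innerDl !addr0. Qed.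
Lemma innerZl c x z : b (c *: x) z = c * b x z.
Proof. by case: hb => h _ _; rewrite -[_ *: x]addr0 h inner0l addr0. Qed.
Lemma innerJ x y : b y x = (b x y)^*%R. Proof. by case: hb. Qed.
Lemma innerDr x y z : b z (x + y) = b z x + b z y.
Proof. by rewrite innerJ innerDl rmorphD [b z x]innerJ [b z y]innerJ. Qed.
Lemma innerZr c x z : b z (c *: x) = c^*%R * b z x.
Proof. by rewrite innerJ innerZl rmorphM [b z x]innerJ. Qed.
Lemma inner0r z : b z 0 = 0.
Proof. by rewrite innerJ inner0l rmorph0. Qed.
Lemma inner_suml (I : Type) (s : seq I) (F : I -> E) z :
  b (\sum_(i <- s) F i) z = \sum_(i <- s) b (F i) z.
Proof.
exact: (big_morph (fun x => b x z) (fun x y => innerDl x y z) (inner0l z)).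
Qed.
Lemma inner_sumr (I : Type) (s : seq I) (F : I -> E) z :
  b z (\sum_(i <- s) F i) = \sum_(i <- s) b z (F i).
Proof. exact: (big_morph (b z) (fun x y => innerDr x y z) (inner0r z)). Qed.

Lemma gram_mixv m n (T : 'M[C]_(m, n)) (u : 'I_n -> E) :
  gram b (mixv T u) = T *m gram b u *m ctr T.
Proof.
apply/matrixP => i j; rewrite !mxE /mixv inner_sumr; apply: eq_bigr => a _.
rewrite innerZr inner_suml !mxE mulrC; congr (_ * _).
by apply: eq_bigr => c _; rewrite innerZl !mxE.
Qed.

Lemma ctr_gram M (u : 'I_M -> E) : ctr (gram b u) = gram b u.
Proof. by apply/matrixP => i j; rewrite !mxE -innerJ. Qed.

Lemma mixv_row n (z : 'rV[C]_n) (u : 'I_n -> E) :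
  b (mixv z u 0) (mixv z u 0) = (z *m gram b u *m ctr z) 0 0.
Proof. by rewrite -gram_mixv mxE. Qed.

Lemma psd_gram M (u : 'I_M -> E) : psd (gram b u).
Proof.
split=> [|z]; first exact: ctr_gram.
by rewrite -mixv_row; case: hb.
Qed.

(* Bessel's inequality for the oblique basis al, with y the coordinates of
   the orthogonal projection of x. *)
Lemma bessel M (al : 'I_M -> E) (x : E) (y : 'rV[C]_M) :
  (\row_a b x (al a)) = y *m gram b al ->
  (y *m gram b al *m ctr y) 0 0 <= b x x.
Proof.
move=> tE; have [_ _ /(_ (x - mixv y al 0))] := hb.
have nE v z : b (x - v) z = b x z - b v z.
  by rewrite innerDl -scaleN1r innerZl mulN1r.
have nE' v z : b z (x - v) = b z x - b z v.
  by rewrite innerJ nE rmorphB [b z x]innerJ [b z v]innerJ.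
have xy : b x (mixv y al 0) = (y *m gram b al *m ctr y) 0 0.
  rewrite -tE /mixv inner_sumr mxE; apply: eq_bigr => a _.
  by rewrite innerZr !mxE mulrC.
rewrite nE !nE' mixv_row -xy [b (mixv _ _ _) x]innerJ.
have -> : (b x (mixv y al 0))^*%R = b x (mixv y al 0).
  by rewrite xy -mixv_row -innerJ.
by rewrite subrr subr0 subr_ge0.
Qed.

End Theory.

Lemma mixvM (E : lmodType C) m n p (S : 'M[C]_(m, n)) (T : 'M[C]_(n, p))
  (u : 'I_p -> E) i : mixv S (mixv T u) i = mixv (S *m T) u i.
Proof.
rewrite /mixv; under eq_bigr do rewrite scaler_sumr.
rewrite exchange_big; apply: eq_bigr => k _ /=; rewrite mxE scaler_suml.
by apply: eq_bigr => j _; rewrite scalerA.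
Qed.

End SemiInner.

(** * Real coordinates for Hermitian matrices *)

Section RealEncoding.
Variable R : realType.
Local Notation C := R[i].
Local Notation Re := complex.Re.
Local Notation Im := complex.Im.

(* A Hermitian matrix is determined by the sum of its (symmetric) real part
   and its (skew-symmetric) imaginary part. *)
Definition hermenc n (G : 'M[C]_n) : 'M[R]_n :=
  \matrix_(i, j) (Re (G i j) + Im (G i j)).

Lemma hermencD n (G H : 'M[C]_n) : hermenc (G + H) = hermenc G + hermenc H.
Proof.
apply/matrixP => i j; rewrite !mxE; case: (G i j) (H i j) => [a b] [c e] /=.
by rewrite addrACA.
Qed.

Lemma hermencZ n (t : R) (G : 'M[C]_n) : hermenc (t%:C *: G) = t *: hermenc G.
Proof.
apply/matrixP => i j; rewrite !mxE; case: (G i j) => [a b] /=.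
by rewrite !mul0r subr0 addr0 mulrDr.
Qed.

Lemma hermenc0 n : hermenc (0 : 'M[C]_n) = 0.
Proof. by apply/matrixP => i j; rewrite !mxE addr0. Qed.

Lemma hermenc_inj n (G H : 'M[C]_n) :
  ctr G = G -> ctr H = H -> hermenc G = hermenc H -> G = H.
Proof.
move=> hG hH E; apply/matrixP => i j.
have := congr1 (fun A => fun_of_matrix A i j) E; rewrite !mxE.
have := congr1 (fun A => fun_of_matrix A j i) E; rewrite !mxE.
have -> : G j i = (G i j)^*%R by rewrite -[in LHS]hG !mxE.
have -> : H j i = (H i j)^*%R by rewrite -[in LHS]hH !mxE.
case: (G i j) (H i j) => [a b] [c e] /= e1 e2.
by congr Complex; lra.
Qed.

Lemma hermenc_surj n (x : 'M[R]_n) :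
  exists G : 'M[C]_n, ctr G = G /\ hermenc G = x.
Proof.
exists (\matrix_(i, j) Complex ((x i j + x j i) / 2) ((x i j - x j i) / 2)).
split; apply/matrixP => i j; rewrite !mxE /=; last by lra.
by congr Complex; lra.
Qed.

Lemma fro_mul_le n (z : 'rV[C]_n) (G : 'M[C]_n) :
  fro (z *m G) <= mxnorm G^T ^+ 2 * fro z.
Proof.
have E m (w : 'rV[C]_m) : fro w = l2norm (fun i => w 0 i) ^+ 2.
  by rewrite l2norm_sqr /fro big_ord1.
rewrite !E -exprMn ler_pXn2r ?nnegrE ?mulr_ge0 ?l2norm_ge0 ?mxnorm_ge0 //.
apply: le_trans (mxact_le _ _); rewrite le_eqVlt; apply/orP; left; apply/eqP.
congr l2norm; apply/funext => i; rewrite !mxE /mxact.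
by apply: eq_bigr => j _; rewrite !mxE mulrC.
Qed.

(** Expanding |zG + tz|^2 gives 2t z(t + G)z^* = |zG + tz|^2 + t^2 |z|^2 - |zG|^2, nonnegative once
    t exceeds the norm of [G^T]. This makes the identity an order unit for the separation. *)
Lemma herm_psd_shift n (G : 'M[C]_n) : ctr G = G ->
  exists t : R, psd (t%:C *: 1%:M + G).
Proof.
move=> hG; pose t := mxnorm G^T + 1.
have t0 : 0 < t by rewrite ltr_wpDl ?mxnorm_ge0.
exists t; split; first by rewrite ctrD ctrZ ctr1 conjC_real hG.
move=> z; set q := (z *m G *m ctr z) 0 0.
have trq (w : 'rV[C]_n) : (w *m ctr w) 0 0 = (fro w)%:C.
  by rewrite froE /mxtrace big_ord1.
have E : (fro (z *m G + t%:C *: z))%:C =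
    (fro (z *m G))%:C + 2 * t%:C * q + (t ^+ 2 * fro z)%:C.
  rewrite rmorphM /= rmorphXn /= -!trq ctrD ctrM hG ctrZ conjC_real.
  rewrite mulmxDl !mulmxDr -!scalemxAl -!scalemxAr !mulmxA.
  rewrite /q !mxE.
  ring.
have -> : (z *m (t%:C *: 1%:M + G) *m ctr z) 0 0 = t%:C * (fro z)%:C + q.
  by rewrite mulmxDr mulmxDl mxE -scalemxAr mulmx1 -scalemxAl mxE trq.
have tC : 0 < 2 * t%:C :> C by rewrite mulr_gt0 ?ltr0n // ltcE /= eqxx.
rewrite -(pmulr_rge0 _ tC) mulrDr.
have -> : 2 * t%:C * q = (fro (z *m G + t%:C *: z) - fro (z *m G) -
   t ^+ 2 * fro z)%:C by rewrite !rmorphB /= E; ring.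
have -> : 2 * t%:C * (t%:C * (fro z)%:C) = (2 * t ^+ 2 * fro z)%:C.
  by rewrite !rmorphM /= ; ring.
rewrite -rmorphD realC_ge0 /=.
have := fro_mul_le z G.
have : mxnorm G^T ^+ 2 * fro z <= t ^+ 2 * fro z.
  rewrite ler_wpM2r ?fro_ge0 // ler_pXn2r ?nnegrE ?mxnorm_ge0 ?(ltW t0) //.
  by rewrite lerDl.
have := fro_ge0 (z *m G + t%:C *: z).
lra.
Qed.

End RealEncoding.

(** * The cone of defects *)

Section ConeRepresentation.
Variables (R : realType) (d : nat) (HR HS : completeNormedModType R[i]).
Variable Q : 'I_d -> {linear HR -> HS}.
Local Notation C := R[i].
Local Notation Re := complex.Re.

Definition hsq (H : normedZmodType C) n (u : 'I_n -> H) : R :=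
  \sum_i sqnorm (u i).

Lemma hsq_ge0 (H : normedZmodType C) n (u : 'I_n -> H) : 0 <= hsq u.
Proof. by apply: sumr_ge0 => i _; exact: sqnorm_ge0. Qed.

Lemma QopE n (X : mtuple R d n) (u : 'I_n.+1 -> HR) i :
  Qop Q X u i = \sum_j mixv (X j) (Q j \o u) i.
Proof. by []. Qed.

(** T (x) 1 commutes with Q_j (x) 1, so only the relation between the X_j and [T] matters. It serves
    both for similarities and for coordinate projections of direct sums. *)
Lemma Qop_mixv n m (X : mtuple R d n) (X' : mtuple R d m)
    (T : 'M[C]_(m.+1, n.+1)) (u : 'I_n.+1 -> HR) :
  (forall j, T *m X j = X' j *m T) ->
  Qop Q X' (mixv T u) = mixv T (Qop Q X u).
Proof.
move=> TX; apply/funext => i; rewrite QopE.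
rewrite [RHS]/mixv; under [RHS]eq_bigr do rewrite QopE scaler_sumr.
rewrite [RHS]exchange_big /=; apply: eq_bigr => j _.
have -> : Q j \o mixv T u = mixv T (Q j \o u).
  apply/funext => a; rewrite /mixv /= linear_sum.
  by apply: eq_bigr => c _; rewrite linearZ.
by rewrite mixvM -TX -mixvM.
Qed.

Lemma QopZ n (X : mtuple R d n) (c : C) (u : 'I_n.+1 -> HR) :
  Qop Q X (fun i => c *: u i) = fun i => c *: Qop Q X u i.
Proof.
apply/funext => i; rewrite /Qop scaler_sumr; apply: eq_bigr => j _.
rewrite scaler_sumr; apply: eq_bigr => l _.
by rewrite linearZ /= !scalerA mulrC.
Qed.

Variables (bR : HR -> HR -> C) (bS : HS -> HS -> C).
Hypotheses (hbR : semi_inner bR) (hbS : semi_inner bS).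
Hypotheses (bRE : forall x, bR x x = (sqnorm x)%:C).
Hypotheses (bSE : forall x, bS x x = (sqnorm x)%:C).

Lemma hsq_gram (H : normedModType C) (b : H -> H -> C) n (u : 'I_n -> H) :
  (forall x, b x x = (sqnorm x)%:C) -> (hsq u)%:C = \tr (gram b u).
Proof.
by move=> bE; rewrite /hsq rmorph_sum; apply: eq_bigr => i _; rewrite mxE bE.
Qed.

Lemma hsq_mixv (H : normedModType C) (b : H -> H -> C) m n
    (T : 'M[C]_(m, n)) (u : 'I_n -> H) :
  semi_inner b -> (forall x, b x x = (sqnorm x)%:C) ->
  (hsq (mixv T u))%:C = \tr (ctr T *m T *m gram b u).
Proof.
by move=> hb bE; rewrite (hsq_gram _ bE) gram_mixv // mxtrace_mulC mulmxA.
Qed.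

Variables (n N : nat) (X : mtuple R d n) (s : R).
Hypothesis Xs : forall u, hsq (Qop Q X u) <= s ^+ 2 * hsq u.

(** A defect need not be a positive matrix; only its trace, s^2 |u|^2 - |Q(X)u|^2, is nonnegative by
    [Xs]. *)
Let defect (u : 'I_n.+1 -> HR) : 'M[C]_n.+1 :=
  (s ^+ 2)%:C *: gram bR u - gram bS (Qop Q X u).

Definition defect_cone (x : 'M[C]_n.+1) : Prop :=
  exists K (u : 'I_K -> 'I_n.+1 -> HR) Psi, psd Psi /\
    x = \sum_k defect (u k) + Psi.

Lemma ctr_defect u : ctr (defect u) = defect u.
Proof.
rewrite /defect ctrD ctrZ conjC_real ctr_gram // -scaleN1r ctrZ ctr_gram //.
by rewrite rmorphN rmorph1 scaleN1r.
Qed.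

Lemma ctr_defect_cone x : defect_cone x -> ctr x = x.
Proof.
move=> [K [u [Psi [[hP _] ->]]]]; rewrite ctrD hP ctr_sum; congr (_ + _).
by apply: eq_bigr => k _; exact: ctr_defect.
Qed.

Lemma defectZ (t : R) u : 0 <= t ->
  defect (fun i => (Num.sqrt t)%:C *: u i) = t%:C *: defect u.
Proof.
move=> t0; have ss : (Num.sqrt t)%:C * (Num.sqrt t)%:C = t%:C :> C.
  by rewrite -rmorphM /= -expr2 sqr_sqrtr.
have gZ (H : lmodType C) (b : H -> H -> C) (v : 'I_n.+1 -> H) : semi_inner b ->
    gram b (fun i => (Num.sqrt t)%:C *: v i) = t%:C *: gram b v.
  move=> hb; apply/matrixP => i j; rewrite !mxE innerZl // innerZr //.
  by rewrite conjC_real mulrA ss.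
rewrite /defect QopZ !gZ // scalerBr !scalerA; congr (_ *: _ - _).
by rewrite mulrC.
Qed.

Lemma defect_coneD x y : defect_cone x -> defect_cone y -> defect_cone (x + y).
Proof.
move=> [K [u [P [pP ->]]]] [K' [u' [P' [pP' ->]]]].
exists (K + K')%N, (fun k =>
  match fintype.split k with inl i => u i | inr i => u' i end).
exists (P + P'); split; first exact: psdD.
rewrite big_split_ord /= addrACA; congr (_ + _ + _).
  by apply: eq_bigr => i _; rewrite (unsplitK (inl i)).
by apply: eq_bigr => i _; rewrite (unsplitK (inr i)).
Qed.

Lemma defect_coneZ (t : R) x : 0 <= t -> defect_cone x -> defect_cone (t%:C *: x).
Proof.
move=> t0 [K [u [P [pP ->]]]].
exists K, (fun k i => (Num.sqrt t)%:C *: u k i), (t%:C *: P).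
split; first exact: psdZ.
by rewrite scalerDr scaler_sumr; congr (_ + _); apply: eq_bigr => k _; rewrite defectZ.
Qed.

Lemma defect_cone_psd P : psd P -> defect_cone P.
Proof.
by move=> pP; exists 0, (fun _ _ => 0), P; split; rewrite // big_ord0 add0r.
Qed.

Lemma defect_cone_defect u : defect_cone (defect u).
Proof.
exists 1, (fun _ => u), 0; split; first exact: psd0.
by rewrite big_ord1 addr0.
Qed.

(* If the conclusion fails, a functional separating from defect_cone is, up to
   a small multiple of the trace, T^* T with T invertible; the conjugate of X
   by T is then bounded by s, but it increases the norm of xi. *)
Lemma defect_cone_mem (xi r : 'M[C]_(n.+1, N)) (eps : R) : 0 < eps ->
  (forall T : 'M[C]_n.+1, T \in unitmx ->
     (forall u, hsq (Qop Q (conjmt T^-1 X) u) <= s ^+ 2 * hsq u) ->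
     fro (T *m r) <= fro (T *m xi)) ->
  defect_cone (xi *m ctr xi - r *m ctr r + (eps%:C)%:M).
Proof.
move=> eps0 H; set H0 := _ - _; apply: contrapT => hC.
pose CC : set 'M[R]_n.+1 := [set x | exists2 y, defect_cone y & x = hermenc y].
have CCc : convex_cone CC.
  split=> [x y [x' Cx ->] [y' Cy ->]|t x t0 [x' Cx ->]].
    by exists (x' + y'); [exact: defect_coneD | rewrite hermencD].
  by exists (t%:C *: x'); [exact: defect_coneZ | rewrite hermencZ].
have CCpsd P : psd P -> CC (hermenc P) by exists P => //; exact: defect_cone_psd.
have hH0 : ctr H0 = H0.
  by rewrite /H0 ctrD -scaleN1r ctrZ !ctrM !ctrK rmorphN rmorph1 scaleN1r.
have [|||||l [Lpos L1 LH0]] :=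
  @cone_separation R _ _ CC (hermenc 1%:M) (hermenc H0) eps CCc.
- by rewrite -(@hermenc0 R); apply/CCpsd/psd0.
- exact/CCpsd/psd1.
- move=> x; have [G [hG <-]] := hermenc_surj x.
  have [t pt] := herm_psd_shift hG; exists t.
  by rewrite -hermencZ -hermencD; exact: CCpsd.
- by [].
- rewrite -hermencZ -hermencD => -[y Cy E]; apply: hC.
  rewrite -scalemx1; rewrite (_ : _ + _ = y) //; apply: hermenc_inj => //.
    by rewrite ctrD ctrZ ctr1 conjC_real hH0.
  exact: ctr_defect_cone.
pose L (x : 'M[R]_n.+1) := \sum_i \sum_j l i j * x i j.
(* Since Re((1 - i)(x + iy)) = x + y, this matrix turns the pairing of [l] with [hermenc] into the
   real part of a trace; its Hermitian part [La] gives the same values on Hermitian arguments. *)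
pose La0 : 'M[C]_n.+1 := \matrix_(b, a) ((l a b)%:C * Complex 1 (-1)).
have La0E G : L (hermenc G) = Re (\tr (La0 *m G)).
  rewrite /L exchange_big /mxtrace Re_sum /=; apply: eq_bigr => b _.
  rewrite !mxE Re_sum; apply: eq_bigr => a _; rewrite !mxE -mulrA ReZ.
  by case: (G a b) => [x y] /=; congr (_ * _); ring.
pose La := (2^-1)%:C *: (La0 + ctr La0).
have hLa : ctr La = La by rewrite /La ctrZ conjC_real ctrD ctrK addrC.
have trctr (A : 'M[C]_n.+1) : Re (\tr (ctr A)) = Re (\tr A).
  rewrite /mxtrace !Re_sum; apply: eq_bigr => i _.
  by rewrite !mxE; case: (A i i).
have LaE G : ctr G = G -> Re (\tr (La *m G)) = L (hermenc G).
  move=> hG; rewrite /La -scalemxAl mxtraceZ ReZ mulmxDl linearD ReD La0E /=.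
  have -> : Re (\tr (ctr La0 *m G)) = Re (\tr (La0 *m G)).
    by rewrite -trctr ctrM ctrK hG mxtrace_mulC.
  by lra.
have LpsdE (z : 'rV[C]_n.+1) : (z *m La *m ctr z) 0 0 =
    \tr (La *m (ctr z *m z)).
  by rewrite mulmxA mxtrace_mulC mulmxA /mxtrace big_ord1.
have pLa : psd La.
  split=> // z; have E : ctr (z *m La *m ctr z) = z *m La *m ctr z.
    by rewrite !ctrM ctrK hLa mulmxA.
  have := congr1 (fun A => fun_of_matrix A 0 0) E; rewrite mxE mxE => Er.
  have Re0 : 0 <= Re ((z *m La *m ctr z) 0 0).
    rewrite LpsdE LaE; last by rewrite ctrM ctrK.
    by apply: Lpos; apply: CCpsd; rewrite -{2}(ctrK z); exact: psd_mul.
  move: Er Re0; case: (_ 0 0) => [a b] [eb] a0.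
  by rewrite lecE /= a0 andbT; apply/eqP; lra.
have LH0' : Re (\tr (La *m H0)) < 0 by rewrite LaE.
pose c := Re (\tr H0).
(* Chosen so that adding [t] times the trace uses up at most half of the negative value at [H0]. *)
pose t := - Re (\tr (La *m H0)) / (2 * (`|c| + 1)).
have c0 : 0 < `|c| + 1 by rewrite ltr_wpDl.
have t0 : 0 < t by rewrite /t divr_gt0 ?oppr_gt0 ?mulr_gt0.
have tc : Re (\tr (La *m H0)) + t * c < 0.
  have : t * c <= t * (`|c| + 1).
    rewrite ler_wpM2l ?(ltW t0) //; have := ler_norm c; lra.
  have -> : t * (`|c| + 1) = - Re (\tr (La *m H0)) / 2.
    by rewrite /t; field; rewrite gt_eqF.
  by lra.
have [T [uT TT]] := psd_factor pLa t0.
have trT G : Re (\tr (ctr T *m T *m G)) = Re (\tr (La *m G)) + t * Re (\tr G).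
  by rewrite TT mulmxDl linearD ReD mul_scalar_mx linearZ /= ReZ.
have hsqT (Hs : normedModType C) (b : Hs -> Hs -> C) (v : 'I_n.+1 -> Hs) :
    semi_inner b -> (forall x, b x x = (sqnorm x)%:C) ->
    hsq (mixv T v) = Re (\tr (La *m gram b v)) + t * hsq v.
  move=> hb bE; rewrite -[hsq (mixv _ _)]/(Re (hsq (mixv T v))%:C).
  by rewrite (hsq_mixv _ _ hb bE) trT -(hsq_gram _ bE).
have froT (A : 'M[C]_(n.+1, N)) :
    fro (T *m A) = Re (\tr (ctr T *m T *m (A *m ctr A))).
  rewrite -[fro _]/(Re (fro (T *m A))%:C) froE ctrM mulmxA mxtrace_mulC.
  by rewrite !mulmxA.
have := H T uT; rewrite !froT; suff h : forall u,
    hsq (Qop Q (conjmt T^-1 X) u) <= s ^+ 2 * hsq u.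
  move/(_ h); rewrite leNgt => /negP; apply.
  have : Re (\tr (ctr T *m T *m H0)) < 0 by rewrite trT.
  rewrite /H0 mulmxBr linearB /= -[in X in X < _]scaleN1r ReD.
  by case: (\tr (_ *m (r *m _))) => a b /=; lra.
(* As Q(T X T^-1) T w = T Q(X) w, the bound at the conjugated point is the sum of two: positivity of
   the functional on [defect w], and [t] times the bound [Xs] at X. *)
move=> u; pose w := mixv (invmx T) u.
have uE : u = mixv T w.
  apply/funext => i; rewrite /w mixvM mulmxV // /mixv (bigD1 i) //= mxE eqxx.
  rewrite scale1r big1 ?addr0 // => a /negPf ai.
  by rewrite mxE eq_sym ai scale0r.
rewrite uE (@Qop_mixv _ _ X); last first.
  move=> j; rewrite ffunE invrK -[RHS]mulmxA mulVmx ?mulmx1 //.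
rewrite (hsqT _ bS) // (hsqT _ bR) // mulrDr.
have -> : s ^+ 2 * (t * hsq w) = t * (s ^+ 2 * hsq w) by ring.
apply: lerD; last by rewrite ler_wpM2l ?(ltW t0).
have : 0 <= Re (\tr (La *m defect w)).
  rewrite LaE ?ctr_defect //; apply: Lpos; exists (defect w) => //.
  exact: defect_cone_defect.
rewrite /defect mulmxBr linearB /= -scalemxAr linearZ /=.
by rewrite -scaleN1r ReD; case: (\tr (_ *m gram bS _)) => a b /=; rewrite ReZ; lra.
Qed.

End ConeRepresentation.

(** * Noncommutative matrix polynomials *)

Section Words.
Variables (R : realType) (d : nat).
Local Notation C := R[i].

Fixpoint words k : seq (seq 'I_d) :=
  if k is k'.+1 then [seq j :: w | j <- enum 'I_d, w <- words k'] else [:: [::]].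

Lemma size_words k w : w \in words k -> size w = k.
Proof.
elim: k w => [|k IH] w; first by rewrite inE => /eqP->.
by move=> /allpairsP[[j w'] /= [_ /IH <- ->]].
Qed.

Definition wordmx n (X : mtuple R d n) (w : seq 'I_d) : 'M[C]_n.+1 :=
  \prod_(j <- w) X j.

(* The coefficients c w of a matrix polynomial act on the right of v, whose N
   columns are the components of a vector of C^(n.+1) (x) C^N. *)
Definition homog N (c : seq 'I_d -> 'M[C]_N) k n (X : mtuple R d n)
    (v : 'M[C]_(n.+1, N)) : 'M[C]_(n.+1, N) :=
  \sum_(w <- words k) wordmx X w *m v *m c w.

Definition mxpoly N (c : seq 'I_d -> 'M[C]_N) K n (X : mtuple R d n)
    (v : 'M[C]_(n.+1, N)) : 'M[C]_(n.+1, N) :=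
  \sum_(k < K) homog c k X v.

(** The block matrix (F_ij) acting on C^m (x) C^N, with one column of [v] per copy of C^m. In this
    form an intertwiner acts by plain left multiplication. *)
Definition blkapp m N (F : 'I_N -> 'I_N -> 'M[C]_m) (v : 'M[C]_(m, N)) :=
  \sum_i \sum_j F i j *m v *m delta_mx j i.

Lemma blkapp_intertwine m m' N (F : 'I_N -> 'I_N -> 'M[C]_m)
    (F' : 'I_N -> 'I_N -> 'M[C]_m') (P : 'M[C]_(m', m)) v :
  (forall i j, P *m F i j = F' i j *m P) ->
  P *m blkapp F v = blkapp F' (P *m v).
Proof.
move=> PF; rewrite /blkapp mulmx_sumr; apply: eq_bigr => i _.
by rewrite mulmx_sumr; apply: eq_bigr => j _; rewrite !mulmxA PF.
Qed.

Lemma conjmtE n (S : 'M[C]_n.+1) (X : mtuple R d n) j :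
  S \is a GRing.unit -> S *m conjmt S X j = X j *m S.
Proof. by move=> uS; rewrite ffunE !mulmxA [S *m _]mulrV // mul1mx. Qed.

Lemma row_blockl n m (A : 'M[C]_n) (B : 'M[C]_m) :
  row_mx 1%:M 0 *m block_mx A 0 0 B = A *m row_mx 1%:M (0 : 'M[C]_(n, m)).
Proof.
by rewrite mul_row_block mul_mx_row !mulmx0 !mul0mx !addr0 mul1mx mulmx1.
Qed.

Lemma row_blockr p n m (A : 'M[C]_n) (B : 'M[C]_m) (S : 'M[C]_(p, m))
    (A' : 'M[C]_p) : S *m B = A' *m S ->
  row_mx 0 S *m block_mx A 0 0 B = A' *m row_mx (0 : 'M[C]_(p, n)) S.
Proof.
by move=> SB; rewrite mul_row_block mul_mx_row !mulmx0 !mul0mx !add0r SB.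
Qed.

Lemma row_mul_ctr p q n m (A : 'M[C]_(p, n)) (B : 'M[C]_(p, m))
    (A' : 'M[C]_(q, n)) (B' : 'M[C]_(q, m)) :
  row_mx A B *m ctr (row_mx A' B') = A *m ctr A' + B *m ctr B'.
Proof. by rewrite /ctr tr_row_mx map_col_mx mul_row_col. Qed.

(** [X] is the direct sum of p + 1 copies of [Z], and [P k], for k <= p, is the projection on the
    k-th copy. Several vectors over [Z] thus become components of one vector over [X], and a nc
    function acts on each component as it does at [Z]. *)
Lemma ampliation (W : ncdom R d) n (Z : mtuple R d n) p :
  (forall n m (X : mtuple R d n) (Y : mtuple R d m), W n X -> W m Y ->
     W (n + m.+1)%N (dsum X Y)) -> W n Z ->
  exists M (X : mtuple R d M) (P : nat -> 'M[C]_(n.+1, M.+1)),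
   [/\ W M X, forall k j, P k *m X j = Z j *m P k,
       forall k l, (k <= p)%N -> (l <= p)%N ->
         P k *m ctr (P l) = if k == l then 1%:M else 0 &
       forall (f : gfun W) hX hZ, is_ncfun f ->
         forall k, P k *m f M X hX = f n Z hZ *m P k].
Proof.
move=> Wd hZ0; elim: p => [|p [M [X [P [hX PX PP Pf]]]]].
  exists n, Z, (fun _ => 1%:M); split => //.
  - by move=> k j; rewrite mul1mx mulmx1.
  - by move=> [|k] [|l] //; rewrite ctr1 mulmx1.
  - by move=> f hX hZ _ k; rewrite mul1mx mulmx1 (Prop_irrelevance hX hZ).
exists (n + M.+1)%N, (dsum Z X).
pose P' k : 'M[C]_(n.+1, n.+1 + M.+1) :=
  if k is k'.+1 then row_mx 0 (P k') else row_mx 1%:M 0.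
exists P'; split; first exact: Wd.
- move=> [|k] j; rewrite ffunE; first exact: (@row_blockl n.+1 M.+1).
  by apply: (@row_blockr n.+1 n.+1 M.+1); exact: PX.
- move=> [|k] [|l] kp lp;
    rewrite [LHS](@row_mul_ctr n.+1 n.+1 n.+1 M.+1) !ctr0 ?ctr1 ?mulmx0 ?mul0mx.
  + by rewrite mulmx1 addr0.
  + by rewrite addr0.
  + by rewrite addr0.
  + by rewrite add0r PP.
- move=> f hX' hZ fnc k; have [fD _] := fnc; rewrite (fD _ _ _ _ hZ hX).
  case: k => [|k]; first exact: (@row_blockl n.+1 M.+1).
  by apply: (@row_blockr n.+1 n.+1 M.+1); exact: Pf.
Qed.

Lemma froZ m n (c : C) (A : 'M[C]_(m, n)) : fro (c *: A) = sqnorm c * fro A.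
Proof.
rewrite /fro mulr_sumr; apply: eq_bigr => i _; rewrite mulr_sumr.
by apply: eq_bigr => j _; rewrite mxE /sqnorm Re_normM exprMn.
Qed.

Lemma sqnorm_real (a : R) : sqnorm (a%:C : C) = a ^+ 2.
Proof. by apply: complexI; rewrite sqnormC conjC_real rmorphXn expr2. Qed.

Lemma fro0 m n : fro (0 : 'M[C]_(m, n)) = 0.
Proof.
have := froZ 0 (0 : 'M[C]_(m, n)).
by rewrite scale0r /sqnorm normr0 expr0n /= mul0r.
Qed.

Lemma fro_delta m n (a : 'I_m) (b : 'I_n) : fro (delta_mx a b : 'M[C]_(m, n)) = 1.
Proof.
have z0 : sqnorm (0 : C) = 0 by rewrite /sqnorm normr0 expr0n.
rewrite /fro (bigD1 a) //= (bigD1 b) //= mxE !eqxx /= /sqnorm normr1 expr1n.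
rewrite !big1 ?addr0 // => [i /negPf ia|j /negPf jb].
  by rewrite big1 // => j _; rewrite mxE ia normr0 expr0n.
by rewrite mxE jb andbF normr0 expr0n.
Qed.

(** Convexity of the square, from the nonnegativity of the double sum of (x_k - x_l)^2, applied to
    real and imaginary parts of each entry. *)
Lemma fro_mean m n K (A : 'I_K -> 'M[C]_(m, n)) : (0 < K)%N ->
  K%:R * fro ((K%:R^-1 : R)%:C *: \sum_k A k) <= \sum_k fro (A k).
Proof.
move=> K0; have Kp : (0 : R) < K%:R by rewrite ltr0n.
have key (x : 'I_K -> R) : (\sum_k x k) ^+ 2 <= K%:R * \sum_k x k ^+ 2.
  have : 0 <= \sum_k \sum_l (x k - x l) ^+ 2.
    by apply: sumr_ge0 => k _; apply: sumr_ge0 => l _; exact: sqr_ge0.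
  have -> : \sum_k \sum_l (x k - x l) ^+ 2 =
      2 * (K%:R * \sum_k x k ^+ 2) - 2 * (\sum_k x k) ^+ 2.
    under eq_bigr => k _.
      rewrite (eq_bigr (fun l => x k ^+ 2 + (x l ^+ 2 - 2 * x k * x l))); last first.
        by move=> l _; ring.
      rewrite big_split /= sumr_const card_ord big_split /= sumrN -mulr_sumr.
      over.
    rewrite !big_split /= sumr_const card_ord !sumrMnl sumrN -mulr_suml -mulr_sumr.
    by ring.
  by lra.
rewrite froZ sqnorm_real mulrA expr2 mulrA divff ?gt_eqF // mul1r.
rewrite ler_pdivrMl // /fro [X in _ <= _ * X]exchange_big /= mulr_sumr.
apply: ler_sum => i _.
rewrite [X in _ <= _ * X]exchange_big /= mulr_sumr; apply: ler_sum => j _.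
rewrite summxE sqnormE.
have -> : complex.Re (\sum_k A k i j) = \sum_k complex.Re (A k i j).
  exact: Re_sum.
have -> : complex.Im (\sum_k A k i j) = \sum_k complex.Im (A k i j).
  by elim/big_rec2: _ => // k x y _ <-; case: (A k i j) y => [? ?] [].
under [in leRHS]eq_bigr do rewrite sqnormE.
by rewrite big_split mulrDr; apply: lerD; exact: key.
Qed.

End Words.

(** * Realization and interpolation *)

Section Realization.
Variables (R : realType) (d : nat) (HR HS : completeNormedModType R[i]).
Variable Q : 'I_d -> {linear HR -> HS}.
Local Notation C := R[i].
Local Notation Re := complex.Re.
Variables (bR : HR -> HR -> C) (bS : HS -> HS -> C).
Hypotheses (hbR : semi_inner bR) (hbS : semi_inner bS).
Hypotheses (bRE : forall x, bR x x = (sqnorm x)%:C).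
Hypotheses (bSE : forall x, bS x x = (sqnorm x)%:C).

Variables (M N K : nat) (X0 : mtuple R d M) (u : 'I_K -> 'I_M.+1 -> HR).
Variables (xi r : 'M[C]_(M.+1, N)) (eps s : R) (Psi : 'M[C]_M.+1).
Hypotheses (eps0 : 0 < eps) (pPsi : psd Psi).
Hypothesis idP : xi *m ctr xi - r *m ctr r + (eps%:C)%:M =
  \sum_k ((s ^+ 2)%:C *: gram bR (u k) - gram bS (Qop Q X0 (u k))) + Psi.

Let q k := Qop Q X0 (u k).
(** The Gram matrix of the vectors [al] below. By [idP] it exceeds the Gram matrix of the vectors
    (r_a, s u_a) by the positive matrix [Psi], so sending [al a] to (r_a, s u_a) is a contraction:
    this is the lurking isometry. *)
Let G : 'M[C]_M.+1 := xi *m ctr xi + (eps%:C)%:M + \sum_k gram bS (q k).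
Let seps : C := (Num.sqrt eps)%:C.

Lemma realization_gramE :
  G = r *m ctr r + (s ^+ 2)%:C *: (\sum_k gram bR (u k)) + Psi.
Proof.
have aux (W : zmodType) (a b e s1 s2 p : W) :
    a - b + e = s1 - s2 + p -> a + e + s2 = b + s1 + p.
  move=> h; have -> : a = s1 - s2 + p - e + b by rewrite -h addrK subrK.
  rewrite (addrAC _ b e) subrK (addrAC _ b s2) (addrAC _ p s2) subrK.
  by rewrite addrC addrA.
rewrite scaler_sumr; apply: aux; rewrite idP.
by rewrite [in LHS]big_split /= sumrN.
Qed.

Lemma realization_gram_unit : G \in unitmx.
Proof.
have pG : psd (xi *m ctr xi + \sum_k gram bS (q k)).
  apply: psdD; first exact: psd_mul.
  elim/big_ind: _ => [|A B|k _]; [exact: psd0|exact: psdD|exact: psd_gram].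
have [T [uT TT]] := psd_factor pG eps0.
rewrite /G addrAC -TT unitmx_mul uT andbT.
by rewrite unitmxE /ctr det_map_mx det_tr rmorph_unit.
Qed.

(* The space C^N (+) C^(M.+1) (+) HS^K containing the vectors al. *)
Let E : lmodType C := ('rV[C]_N * 'rV[C]_M.+1 * {ffun 'I_K -> HS})%type.
Let b (x y : E) : C := (x.1.1 *m ctr y.1.1) 0 0 + (x.1.2 *m ctr y.1.2) 0 0 +
  \sum_k bS (x.2 k) (y.2 k).
Let al a : E := (row a xi, seps *: row a 1%:M, [ffun k => q k a]).

Lemma realization_inner : semi_inner b.
Proof.
split.
- move=> c x y z; rewrite /b /= !mulmxDl -!scalemxAl !mxE !mulrDr.
  rewrite (eq_bigr (fun k => c * bS (x.2 k) (z.2 k) + bS (y.2 k) (z.2 k))).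
    by rewrite big_split /= -mulr_sumr; ring.
  by move=> k _; rewrite !ffunE; case: hbS.
- move=> x y; rewrite /b !rmorphD rmorph_sum; congr (_ + _ + _).
  + by rewrite -{1}(ctrK y.1.1) -ctrM !mxE.
  + by rewrite -{1}(ctrK y.1.2) -ctrM !mxE.
  + by apply: eq_bigr => k _; exact: innerJ.
- move=> x; rewrite !addr_ge0 //.
  + by have := froE x.1.1; rewrite /mxtrace big_ord1 => <-; rewrite realC_ge0 fro_ge0.
  + by have := froE x.1.2; rewrite /mxtrace big_ord1 => <-; rewrite realC_ge0 fro_ge0.
  + by apply: sumr_ge0 => k _; case: hbS.
Qed.

Lemma realization_gram_al : gram b al = G.
Proof.
apply/matrixP => i j; rewrite !mxE summxE /b /=; congr (_ + _ + _).
- by rewrite mxE; apply: eq_bigr => k _; rewrite !mxE.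
- rewrite ctrZ -scalemxAl -scalemxAr !mxE mulrA conjC_real -rmorphM /= -expr2.
  rewrite sqr_sqrtr ?ltW //; under eq_bigr do rewrite !mxE.
  rewrite (bigD1 j) //= eqxx rmorph1 mulr1 big1 ?addr0.
    by rewrite mulr_natr.
  by move=> k kj; rewrite [j == k]eq_sym (negPf kj) rmorph0 mulr0.
- by apply: eq_bigr => k _; rewrite !ffunE mxE.
Qed.

Let T j : 'M[C]_M.+1 := \matrix_(a, c) \sum_k bS (Q j (u k a)) (q k c).

(** Row i holds the coordinates, in the basis [al] of its span, of the orthogonal projection of the
    vector (v_i, z_i, (Q(X) Y u)_i). The three summands are the inner products with the [al a], and
    the inverse of [G] turns them into coordinates. The matrix [Y] encodes the state [mixv Y (u k)],
    and [Y *m r] is the output; [v] is the input, and [z] an auxiliary input that accounts for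
    [eps]. *)
Definition rstep m (X : mtuple R d m) (v : 'M[C]_(m.+1, N))
    (z Y : 'M[C]_(m.+1, M.+1)) : 'M[C]_(m.+1, M.+1) :=
  (v *m ctr xi + seps *: z + \sum_j X j *m Y *m T j) *m invmx G.

Definition hmass m (Y : 'M[C]_(m.+1, M.+1)) : R := \sum_k hsq (mixv Y (u k)).

Lemma hmass_ge0 m (Y : 'M[C]_(m.+1, M.+1)) : 0 <= hmass Y.
Proof. by apply: sumr_ge0 => k _; exact: hsq_ge0. Qed.

Lemma Qop_pairing m (X : mtuple R d m) (Y : 'M[C]_(m.+1, M.+1)) i a :
  (\sum_j X j *m Y *m T j) i a =
  \sum_k bS (Qop Q X (mixv Y (u k)) i) (q k a).
Proof.
transitivity (\sum_k \sum_j \sum_c (X j *m Y) i c * bS (Q j (u k c)) (q k a)).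
  rewrite summxE [RHS]exchange_big; apply: eq_bigr => j _ /=; rewrite mxE.
  rewrite [RHS]exchange_big; apply: eq_bigr => c _ /=.
  by rewrite [T j c a]mxE mulr_sumr.
apply: eq_bigr => k _; rewrite QopE inner_suml //; apply: eq_bigr => j _.
have -> : Q j \o mixv Y (u k) = mixv Y (Q j \o u k).
  apply/funext => l; rewrite /mixv /= linear_sum.
  by apply: eq_bigr => c _; rewrite linearZ.
rewrite mixvM /mixv inner_suml //; apply: eq_bigr => c _.
by rewrite innerZl.
Qed.

(** Bessel's inequality row by row bounds the projection by the input vector. By [realization_gramE]
    its squared norm is that of the output, plus [s ^+ 2] times that of the new state, plus a
    nonnegative term from [Psi]. *)
Lemma rstep_le m (X : mtuple R d m) v z (Y : 'M[C]_(m.+1, M.+1)) :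
  fro (rstep X v z Y *m r) + s ^+ 2 * hmass (rstep X v z Y) <=
  fro v + fro z + \sum_k hsq (Qop Q X (mixv Y (u k))).
Proof.
set Y' := rstep X v z Y.
pose x i : E := (row i v, row i z, [ffun k => Qop Q X (mixv Y (u k)) i]).
have fr a c (A : 'M[C]_(a, c)) : (fro A)%:C = \sum_i (row i A *m ctr (row i A)) 0 0.
  by rewrite froE; apply: eq_bigr => i _; rewrite !mxE; apply: eq_bigr => j _;
    rewrite !mxE.
suff h : \sum_i (row i Y' *m G *m ctr (row i Y')) 0 0 <= \sum_i b (x i) (x i).
  have rhsE : \sum_i b (x i) (x i) =
      (fro v + fro z + \sum_k hsq (Qop Q X (mixv Y (u k))))%:C.
    rewrite !rmorphD /= !fr rmorph_sum /= !big_split /=; congr (_ + _).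
    rewrite exchange_big; apply: eq_bigr => k _; rewrite rmorph_sum.
    by apply: eq_bigr => i _; rewrite ffunE bSE.
  have lhsE : \sum_i (row i Y' *m G *m ctr (row i Y')) 0 0 =
      (fro (Y' *m r) + s ^+ 2 * hmass Y')%:C +
      \sum_i (row i Y' *m Psi *m ctr (row i Y')) 0 0.
    rewrite realization_gramE rmorphD /= !fr.
    under eq_bigr => i _ do rewrite !mulmxDr !mulmxDl mxE [X in X + _]mxE.
    rewrite !big_split /=; congr (_ + _ + _).
      by apply: eq_bigr => i _; rewrite [row i (Y' *m r)]row_mul ctrM !mulmxA.
    have -> : (s ^+ 2 * hmass Y')%:C = (s ^+ 2)%:C *
        \sum_k \sum_i (sqnorm (mixv Y' (u k) i))%:C.
      rewrite [LHS]rmorphM; congr (_ * _); rewrite [LHS]rmorph_sum.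
      by apply: eq_bigr => k _; rewrite [LHS]rmorph_sum.
    under eq_bigr => i _ do rewrite -scalemxAr -scalemxAl mxE mulmx_sumr
      mulmx_suml summxE.
    rewrite -mulr_sumr exchange_big; congr (_ * _); apply: eq_bigr => k _ /=.
    apply: eq_bigr => i _; rewrite -bRE -mixv_row //.
    by rewrite /mixv; under eq_bigr do rewrite mxE.
  rewrite rhsE lhsE in h; rewrite -lecR; apply: le_trans h.
  by rewrite lerDl; apply: sumr_ge0 => i _; case: pPsi => _; apply.
apply: ler_sum => i _; rewrite -realization_gram_al.
apply: bessel; first exact: realization_inner.
rewrite realization_gram_al -row_mul /Y' /rstep mulmxKV ?realization_gram_unit //.
rewrite !raddfD; apply/matrixP => o a; rewrite ord1 mxE [RHS]mxE.
rewrite [X in _ = X + _]mxE [X in _ = _ + X]mxE Qop_pairing /b /=.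
congr (_ + _ + _).
- by rewrite !mxE; apply: eq_bigr => k _; rewrite !mxE.
- rewrite ctrZ conjC_real -scalemxAr mxE [RHS]mxE mxE [RHS]mxE; congr (_ * _).
  rewrite (bigD1 a) //= !mxE eqxx rmorph1 mulr1 big1 ?addr0 // => k ka.
  by rewrite !mxE [a == k]eq_sym (negPf ka) rmorph0 mulr0.
- by apply: eq_bigr => k _; rewrite !ffunE.
Qed.

(** With these inputs the vectors to be projected are combinations of the [al a] with the rows of
    [P] as coefficients. So [P] is a stationary state at [Z], with output [P *m r], provided that
    the auxiliary channel receives [seps *: P]. *)
Lemma rstep_fix n (Z : mtuple R d n) (P : 'M[C]_(n.+1, M.+1)) :
  (forall j, P *m X0 j = Z j *m P) -> rstep Z (P *m xi) (seps *: P) P = P.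
Proof.
move=> PX; rewrite /rstep scalerA /seps -rmorphM /= -expr2 sqr_sqrtr ?ltW //.
rewrite (_ : _ + _ = P *m G) ?mulmxK ?realization_gram_unit //.
rewrite /G !mulmxDr mulmxA mul_mx_scalar; congr (_ + _ + _).
apply/matrixP => i a; rewrite Qop_pairing mulmx_sumr summxE.
apply: eq_bigr => k _; rewrite (Qop_mixv _ _ PX) mxE /mixv inner_suml //.
by apply: eq_bigr => c _; rewrite innerZl // mxE.
Qed.

Lemma rstepD m (X : mtuple R d m) v z Y v' z' Y' :
  rstep X (v + v') (z + z') (Y + Y') = rstep X v z Y + rstep X v' z' Y'.
Proof.
rewrite /rstep -mulmxDl; congr (_ *m _); rewrite mulmxDl scalerDr.
have aux (W : zmodType) (a1 b1 c1 a2 b2 c2 : W) :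
    a1 + a2 + (b1 + b2) + (c1 + c2) = a1 + b1 + c1 + (a2 + b2 + c2).
  by rewrite (addrACA a1) (addrACA (a1 + b1)).
rewrite (_ : \sum_j X j *m (Y + Y') *m T j =
  \sum_j X j *m Y *m T j + \sum_j X j *m Y' *m T j); first exact: aux.
by rewrite -big_split; apply: eq_bigr => j _; rewrite mulmxDr mulmxDl.
Qed.

(** Each step puts X_j on the left and T_j G^-1 on the right, so the factors come in the order
    opposite to the letters of [w]. *)
Definition rcoef (w : seq 'I_d) : 'M[C]_M.+1 :=
  foldr (fun j A => A *m (T j *m invmx G)) 1%:M w.

(** The part of degree k in [X] of the Neumann series: the input enters once and then runs k times
    through the state. *)
Definition rhom m (X : mtuple R d m) (v : 'M[C]_(m.+1, N)) k :
    'M[C]_(m.+1, M.+1) :=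
  iter k (rstep X 0 0) (rstep X v 0 0).

Lemma rhomE m (X : mtuple R d m) v k :
  rhom X v k = \sum_(w <- words d k) wordmx X w *m v *m
    (ctr xi *m invmx G *m rcoef w).
Proof.
elim: k => [|k IH].
  rewrite /rhom /= big_seq1 /wordmx big_nil mul1mx /rcoef /= mulmx1.
  rewrite /rstep scaler0 addr0 big1 ?addr0 ?mulmxA // => j _.
  by rewrite mulmx0 mul0mx.
rewrite /rhom iterS -/(rhom X v k) IH /= big_allpairs_dep /=.
rewrite /rstep mul0mx scaler0 !add0r mulmx_suml big_enum /=.
apply: eq_bigr => j _; rewrite mulmx_sumr !mulmx_suml.
by apply: eq_bigr => w _; rewrite /wordmx big_cons !mulmxA.
Qed.

Definition rpartial m (X : mtuple R d m) (v : 'M[C]_(m.+1, N)) k :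
    'M[C]_(m.+1, M.+1) := iter k (rstep X v 0) 0.

Lemma rpartialE m (X : mtuple R d m) v k :
  rpartial X v k = \sum_(l < k) rhom X v l.
Proof.
elim: k => [|k IH]; first by rewrite big_ord0.
have aux Y : rstep X v 0 Y = rstep X v 0 0 + rstep X 0 0 Y.
  by rewrite -rstepD !addr0 add0r.
have r0 : rstep X 0 0 0 = 0.
  by apply: (addrI (rstep X 0 0 0)); rewrite -rstepD !addr0.
rewrite /rpartial iterS -/(rpartial X v k) IH aux big_ord_recl.
congr (_ + _); rewrite (big_morph (rstep X 0 0) (id1 := 0) (op1 := +%R)) //.
by move=> Y Y'; rewrite -rstepD !addr0.
Qed.

End Realization.

Section Interpolation.
Variables (R : realType) (d : nat) (HR HS : completeNormedModType R[i]).
Variable Q : 'I_d -> {linear HR -> HS}.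
Local Notation C := R[i].
Local Notation Re := complex.Re.

Definition Qbound n (s : R) (X : mtuple R d n) : Prop :=
  forall u, hsq (Qop Q X u) <= s ^+ 2 * hsq u.

Lemma Qbound_dsum n m s (X : mtuple R d n) (Y : mtuple R d m) :
  Qbound s X -> Qbound s Y -> Qbound s (dsum X Y).
Proof.
move=> hX hY u; pose uX i := u (@lshift n.+1 m.+1 i).
pose uY i := u (@rshift n.+1 m.+1 i).
have EX i : Qop Q (dsum X Y) u (@lshift n.+1 m.+1 i) = Qop Q X uX i.
  apply: eq_bigr => j _; rewrite ffunE (@big_split_ord _ _ _ n.+1 m.+1) /=.
  rewrite [X in _ + X]big1 ?addr0 => [|l _]; last first.
    by rewrite (@block_mxEur _ n.+1 m.+1 n.+1 m.+1) mxE scale0r.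
  by apply: eq_bigr => l _; rewrite (@block_mxEul _ n.+1 m.+1 n.+1 m.+1).
have EY i : Qop Q (dsum X Y) u (@rshift n.+1 m.+1 i) = Qop Q Y uY i.
  apply: eq_bigr => j _; rewrite ffunE (@big_split_ord _ _ _ n.+1 m.+1) /=.
  rewrite [X in X + _]big1 ?add0r => [|l _]; last first.
    by rewrite (@block_mxEdl _ n.+1 m.+1 n.+1 m.+1) mxE scale0r.
  by apply: eq_bigr => l _; rewrite (@block_mxEdr _ n.+1 m.+1 n.+1 m.+1).
rewrite /hsq !(@big_split_ord _ _ _ n.+1 m.+1) /= mulrDr.
apply: lerD; [under eq_bigr do rewrite EX|under eq_bigr do rewrite EY].
  exact: hX.
exact: hY.
Qed.

Variables (bR : HR -> HR -> C) (bS : HS -> HS -> C).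
Hypotheses (hbR : semi_inner bR) (hbS : semi_inner bS).
Hypotheses (bRE : forall x, bR x x = (sqnorm x)%:C).
Hypotheses (bSE : forall x, bS x x = (sqnorm x)%:C).
Variable k0 : R.
Hypothesis k0_ge0 : 0 <= k0.
Hypothesis Qk0 : forall j x, sqnorm (Q j x) <= k0 * sqnorm x.

Variables (V : ncdom R d) (s : R).
Hypothesis Vdsum : forall n m (X : mtuple R d n) (Y : mtuple R d m),
  V X -> V Y -> V (dsum X Y).
Hypothesis Vsim : forall n (X : mtuple R d n) (S : 'M[C]_n.+1),
  V X -> S \is a GRing.unit -> Qbound s (conjmt S X) -> V (conjmt S X).
Hypothesis s0 : 0 < s.

Variables (N : nat) (f : 'I_N -> 'I_N -> gfun V).
Hypothesis fnc : forall i j, is_ncfun (f i j).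
Hypothesis fle : forall n (X : mtuple R d n) (hX : V X) (v : 'M[C]_(n.+1, N)),
  fro (blkapp (fun i j => f i j hX) v) <= fro v.

Lemma sum_partial_sums (W : zmodType) (a : nat -> W) K :
  \sum_(k < K) \sum_(l < k.+1) a l = \sum_(l < K) a l *+ (K - l).
Proof.
elim: K => [|K IH]; first by rewrite !big_ord0.
rewrite big_ord_recr /= IH [in LHS]big_ord_recr [in RHS]big_ord_recr /=.
rewrite subSnn addrA; congr (_ + _); rewrite -big_split; apply: eq_bigr => l _.
by rewrite /= -mulrSr subSn // ltnW.
Qed.

(** The vectors [v k] are packed into [xi] over an ampliation of [Z], so that a single realization
    serves them all. The test of [defect_cone_mem] is passed because f(T X T^-1) T xi = T f(X) xi,
    while T X T^-1 is again in [V], where f is contractive. *)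
Lemma defect_representation n (Z : mtuple R d n) (hZ : V Z) p
    (v : 'I_p -> 'M[C]_(n.+1, N)) (eps : R) : 0 < eps -> Qbound s Z ->
  exists M (X : mtuple R d M) (P : nat -> 'M[C]_(n.+1, M.+1))
      (xi r : 'M[C]_(M.+1, N)),
    [/\ forall k j, P k *m X j = Z j *m P k,
        forall k : 'I_p, P k *m ctr (P k) = 1%:M,
        forall k : 'I_p, P k *m xi = v k,
        forall k : 'I_p, P k *m r = blkapp (fun i j => f i j hZ) (v k) &
        defect_cone Q bR bS X s (xi *m ctr xi - r *m ctr r + (eps%:C)%:M)].
Proof.
move=> eps0 Zs; pose W : ncdom R d := fun n => [set X | V X /\ Qbound s X].
have [||M [X [P [[hX Xs] PX PP Pf]]]] := @ampliation R d W n Z p.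
- by move=> n1 n2 X Y [hX Xs] [hY Ys]; split; [exact: Vdsum|exact: Qbound_dsum].
- by [].
pose xi : 'M[C]_(M.+1, N) := \sum_(k < p) ctr (P k) *m v k.
pose r := blkapp (fun i j => f i j hX) xi.
have Pxi (k : 'I_p) : P k *m xi = v k.
  rewrite /xi mulmx_sumr (bigD1 k) //= mulmxA PP ?(ltnW (ltn_ord _)) // eqxx.
  rewrite mul1mx big1 ?addr0 // => l lk.
  rewrite mulmxA PP ?(ltnW (ltn_ord _)) //.
  by rewrite -[_ == _ :> nat]/(k == l) eq_sym (negPf lk) mul0mx.
have Pf' i j k : P k *m f i j hX = f i j hZ *m P k.
  pose g : gfun W := fun n X hX => f i j (proj1 hX).
  have gnc : is_ncfun g.
    split=> [n1 n2 X1 Y1 h1 h2 h3|n1 X1 S h1 h2 uS].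
      exact: (proj1 (fnc i j)).
    exact: (proj2 (fnc i j)).
  have := Pf g (conj hX Xs) (conj hZ Zs) gnc k.
  by rewrite /g (Prop_irrelevance (proj1 _) hX) (Prop_irrelevance (proj1 _) hZ).
exists M, X, P, xi, r; split => //.
- by move=> k; rewrite PP ?eqxx // ltnW.
- by move=> k; rewrite -Pxi; apply: blkapp_intertwine => i j; exact: Pf'.
- apply: defect_cone_mem => // T uT Ts.
  have hX' : V (conjmt T^-1 X) by apply: Vsim => //; rewrite unitrV.
  have -> : T *m r = blkapp (fun i j => f i j hX') (T *m xi).
    apply: blkapp_intertwine => i j.
    rewrite (proj2 (fnc i j) _ _ _ hX) ?unitrV // invrK -[RHS]mulmxA.
    by rewrite [T^-1 *m T]mulVr // mulmx1.
  exact: fle.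
Qed.

Lemma hsq_letter m j (w : 'I_m -> HR) : hsq (Q j \o w) <= k0 * hsq w.
Proof. by rewrite /hsq mulr_sumr; apply: ler_sum => i _; exact: Qk0. Qed.

Lemma le_fro m n (A : 'M[C]_(m, n)) i j : sqnorm (A i j) <= fro A.
Proof.
have s0' k l : 0 <= sqnorm (A k l) by exact: sqnorm_ge0.
rewrite /fro (bigD1 i) //= (bigD1 j) //= -addrA lerDl.
by rewrite addr_ge0 ?sumr_ge0 // => k _; rewrite sumr_ge0.
Qed.

(* The Cesaro means of the Neumann series of the realization attached to a
   point Z are exactly contractive, by telescoping; no truncation error enters. *)
Lemma mxpoly_interpolation n (Z : mtuple R d n) (hZ : V Z) (eps : R) :
  0 < eps -> Qbound s Z ->
  exists (c : seq 'I_d -> 'M[C]_N) K,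
    [/\ forall w i j, sqnorm (c w i j) <= (k0 / s ^+ 2) ^+ size w,
        forall w, (K <= size w)%N -> c w = 0,
        forall m (X : mtuple R d m) v, Qbound s X ->
          fro (mxpoly c K X v) <= fro v,
        forall k m (X : mtuple R d m) v, Qbound s X ->
          fro (homog c k X v) <= fro v &
        forall a j, let v := delta_mx a j in
          fro (mxpoly c K Z v - blkapp (fun i j => f i j hZ) v) <= eps].
Proof.
(* [fro (P k)] is n + 1, so the auxiliary channel contributes e (n + 1) = eps / 2 per step. The
   other half of [eps] absorbs the initial term of the telescoping sum, which is at most [t] and is
   divided by [K]. *)
move=> eps0 Zs; pose e := eps / (2 * n.+1%:R).
have e0 : 0 < e by rewrite divr_gt0 // mulr_gt0 // ltr0n.
pose v0 (k : 'I_#|{: 'I_n.+1 * 'I_N}|) : 'M[C]_(n.+1, N) :=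
  delta_mx (enum_val k).1 (enum_val k).2.
have [M [X0 [P [xi [r [PX PP Pxi Pr [K0 [u [Psi [pPsi idP]]]]]]]]]] :=
  defect_representation hZ v0 e0 Zs.
pose St m (X : mtuple R d m) := rstep Q bS X0 u xi e X.
pose h m (Y : 'M[C]_(m.+1, M.+1)) := hmass u Y.
have h0 m (Y : 'M[C]_(m.+1, M.+1)) : 0 <= s ^+ 2 * h m Y.
  by rewrite mulr_ge0 ?sqr_ge0 ?hmass_ge0.
have step m (X : mtuple R d m) v z Y : fro (St m X v z Y *m r) +
    s ^+ 2 * h _ (St m X v z Y) <=
    fro v + fro z + \sum_k hsq (Qop Q X (mixv Y (u k))).
  exact: (rstep_le hbR hbS bRE bSE e0 pPsi idP).
have stepX m (X : mtuple R d m) v z Y : Qbound s X ->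
    fro (St m X v z Y *m r) + s ^+ 2 * h _ (St m X v z Y) <=
    fro v + fro z + s ^+ 2 * h _ Y.
  move=> Xs; apply: le_trans (step _ _ _ _ _) _; rewrite lerD2l /h /hmass.
  by rewrite mulr_sumr; apply: ler_sum => k _; exact: Xs.
pose t := \sum_(k < #|{: 'I_n.+1 * 'I_N}|) s ^+ 2 * h n (P k).
pose K := (Num.Def.archi_bound (2 * t / eps)).+1.
pose B := ctr xi *m invmx (xi *m ctr xi + (e%:C)%:M +
  \sum_k gram bS (Qop Q X0 (u k))).
(* The truncated subtraction makes the Cesaro weight vanish on words of length at least [K]. *)
pose c w : 'M[C]_N := (((K - size w)%N%:R / K%:R : R)%:C) *:
  (B *m rcoef Q bS X0 u xi e w *m r).
have Kp : (0 : R) < K%:R by rewrite ltr0n.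
have homE m (X : mtuple R d m) v k : homog c k X v =
    ((K - k)%N%:R / K%:R : R)%:C *: (rhom Q bS X0 u xi e X v k *m r).
  rewrite rhomE /homog mulmx_suml scaler_sumr big_seq [RHS]big_seq.
  apply: eq_bigr => w /size_words <-; rewrite /c -scalemxAr; congr (_ *: _).
  by rewrite !mulmxA.
have polE m (X : mtuple R d m) v : mxpoly c K X v =
    (K%:R^-1 : R)%:C *: \sum_(k < K) (rpartial Q bS X0 u xi e X v k.+1 *m r).
  rewrite /mxpoly; under eq_bigr do rewrite homE.
  transitivity ((K%:R^-1 : R)%:C *:
      \sum_(k < K) ((rhom Q bS X0 u xi e X v k *m r) *+ (K - k))).
    rewrite scaler_sumr; apply: eq_bigr => k _.
    by rewrite -[(_ *m r) *+ _]scaler_nat scalerA mulrC rmorphM /= rmorph_nat.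
  rewrite -(sum_partial_sums (fun k => rhom Q bS X0 u xi e X v k *m r)).
  by congr (_ *: _); apply: eq_bigr => k _; rewrite rpartialE mulmx_suml.
have homle m (X : mtuple R d m) v k : Qbound s X ->
    fro (rhom Q bS X0 u xi e X v k *m r) + s ^+ 2 * h _ (rhom Q bS X0 u xi e X v k)
    <= fro v.
  move=> Xs; elim: k => [|k IH].
    apply: le_trans (stepX _ X v 0 0 Xs) _.
    rewrite fro0 /h /hmass big1 ?mulr0 ?addr0 //.
    move=> k _; rewrite /hsq big1 // => i _; rewrite /mixv big1 => [|a _].
      by rewrite /sqnorm normr0 expr0n.
    by rewrite mxE scale0r.
  apply: le_trans (stepX _ X 0 0 _ Xs) _; rewrite !fro0 !add0r.
  by apply: le_trans IH; rewrite lerDr fro_ge0.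
have telescope m (X : mtuple R d m) (a : R) (Y : nat -> 'M[C]_(m.+1, M.+1)) L :
    (forall k, fro (Y k.+1 *m r) + s ^+ 2 * h _ (Y k.+1) <= a + s ^+ 2 * h _ (Y k)) ->
    \sum_(k < L) fro (Y k.+1 *m r) <= L%:R * a + s ^+ 2 * h _ (Y 0%N).
  move=> H; suff : \sum_(k < L) fro (Y k.+1 *m r) + s ^+ 2 * h _ (Y L) <=
     L%:R * a + s ^+ 2 * h _ (Y 0%N).
    by apply: le_trans; rewrite lerDl.
  elim: L => [|L IH]; first by rewrite big_ord0 mul0r.
  rewrite big_ord_recr /= -natr1; have := H L; lra.
exists c, K; split.
(* Row i of a coefficient is the output of the state reached from the i-th basis vector through
   points of size 1 having one coordinate 1 and the others 0, one such point per letter. These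
   points may lie outside the ball of radius [s]; there [step] still applies, and each letter costs
   a factor k0 / s^2. *)
- move=> w i j; pose y w : 'M[C]_(0.+1, M.+1) :=
    delta_mx 0 i *m (B *m rcoef Q bS X0 u xi e w).
  have yle : fro (y w *m r) + s ^+ 2 * h _ (y w) <= (k0 / s ^+ 2) ^+ size w.
    elim: w => [|l w IH].
      have -> : y [::] = St _ ([ffun => 0] : mtuple R d 0) (delta_mx 0 i) 0 0.
        rewrite /St /rstep scaler0 addr0 big1 ?addr0 => [|l _].
          by rewrite /y /rcoef /= mulmx1 /B !mulmxA.
        by rewrite mulmx0 mul0mx.
      apply: le_trans (step _ _ _ _ _) _; rewrite fro0 fro_delta big1 ?addr0 ?expr0 //.
      move=> k _; rewrite /hsq big1 // => o _; rewrite /Qop big1 => [|l _].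
        by rewrite /sqnorm normr0 expr0n.
      by rewrite big1 // => o' _; rewrite ffunE mxE scale0r.
    pose X : mtuple R d 0 := [ffun l' => if l' == l then 1%:M else 0].
    have -> : y (l :: w) = St _ X 0 0 (y w).
      rewrite /St /rstep mul0mx scaler0 !add0r (bigD1 l) //= ffunE eqxx mul1mx.
      rewrite big1 ?addr0 => [|l' /negPf ll]; last by rewrite ffunE ll !mul0mx.
      by rewrite /y /= !mulmxA.
    apply: le_trans (step _ _ _ _ _) _; rewrite !fro0 !add0r /= [leRHS]exprS.
    apply: (@le_trans _ _ (k0 / s ^+ 2 * (s ^+ 2 * h _ (y w)))).
      rewrite mulrA divfK ?sqrf_eq0 ?gt_eqF // /h /hmass mulr_sumr.
      apply: ler_sum => k _.
      have -> : Qop Q X (mixv (y w) (u k)) = Q l \o mixv (y w) (u k).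
        apply/funext => o; rewrite /Qop (bigD1 l) //= big_ord1 ffunE eqxx.
        rewrite !ord1 mxE eqxx scale1r big1 ?addr0 // => l' /negPf ll.
        by rewrite big1 // => o' _; rewrite ffunE ll mxE scale0r.
      exact: hsq_letter.
    apply: ler_wpM2l; first by rewrite divr_ge0 ?sqr_ge0.
    by apply: le_trans IH; rewrite lerDr fro_ge0.
  have cE : c w i j = ((K - size w)%N%:R / K%:R : R)%:C * (y w *m r) 0 j.
    rewrite mxE; congr (_ * _).
    by rewrite /y -!mulmxA -rowE [RHS]mxE.
  rewrite cE /sqnorm Re_normM exprMn -/(sqnorm _) -/(sqnorm _) sqnorm_real.
  apply: le_trans yle; apply: (@le_trans _ _ (fro (y w *m r))); last by rewrite lerDl.
  apply: le_trans (le_fro _ 0 j); apply: ler_piMl; first exact: sqnorm_ge0.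
  rewrite exprn_ile1 ?divr_ge0 ?ler0n // ler_pdivrMr // mul1r ler_nat.
  exact: leq_subr.
- by move=> w /eqP Kw; rewrite /c Kw mul0r scale0r.
- move=> m X v Xs; rewrite polE -(ler_pM2l Kp).
  apply: le_trans (fro_mean _ _) _ => //.
  have := @telescope _ X (fro v) (rpartial Q bS X0 u xi e X v) K.
  rewrite [h _ (rpartial _ _ _ _ _ _ _ _ 0)](_ : _ = 0); last first.
    rewrite /h /hmass big1 // => k _; rewrite /hsq big1 // => i _.
    rewrite /mixv big1 => [|a _]; first by rewrite /sqnorm normr0 expr0n.
    by rewrite mxE scale0r.
  rewrite mulr0 addr0; apply => k.
  by have := stepX _ X v 0 (rpartial Q bS X0 u xi e X v k) Xs; rewrite fro0 addr0.
- move=> k m X v Xs; rewrite homE froZ sqnorm_real.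
  have hr : fro (rhom Q bS X0 u xi e X v k *m r) <= fro v.
    by apply: le_trans (homle _ X v k Xs); rewrite lerDl.
  apply: le_trans hr; apply: ler_piMl; first exact: fro_ge0.
  rewrite exprn_ile1 ?divr_ge0 ?ler0n // ler_pdivrMr // mul1r ler_nat.
  exact: leq_subr.
- move=> a j /=; set v := delta_mx a j; pose k := enum_rank (a, j).
  have vE : v0 k = v by rewrite /v0 /k enum_rankK.
  rewrite -vE -(Pr k) polE.
  set Y := rpartial _ _ _ _ _ _ _ _.
  have -> : (K%:R^-1 : R)%:C *: (\sum_(k < K) (Y k.+1 *m r)) - P k *m r =
     - ((K%:R^-1 : R)%:C *: \sum_(l < K) ((P k - Y l.+1) *m r)).
    rewrite -scalerN -sumrN.
    have {1}-> : P k *m r = (K%:R^-1 : R)%:C *: \sum_(l < K) (P k *m r).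
      rewrite sumr_const card_ord -[(_ *m r) *+ K]scaler_nat scalerA.
      have -> : (K%:R : C) = (K%:R : R)%:C by rewrite rmorph_nat.
      by rewrite -rmorphM /= mulVf ?gt_eqF // scale1r.
    rewrite -scalerBr -sumrB; congr (_ *: _); apply: eq_bigr => l _.
    by rewrite mulmxBl opprB.
  have froN a' b' (A : 'M[C]_(a', b')) : fro (- A) = fro A.
    by rewrite -scaleN1r froZ /sqnorm normrN1 expr1n mul1r.
  rewrite froN -(ler_pM2l Kp); apply: le_trans (fro_mean _ _) _ => //.
  (* The distance to the stationary state follows the same recursion with zero main input, so
     [telescope] sums its outputs. *)
  pose D l := P k - Y l.
  have DE l : D l.+1 = St _ Z 0 ((Num.sqrt e)%:C *: P k) (D l).
    apply: (addIr (rstep Q bS X0 u xi e Z (v0 k) 0 (Y l))); rewrite /D subrK.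
    rewrite /St -rstepD // add0r addr0 subrK -Pxi.
    by rewrite rstep_fix.
  have froP : fro (P k) = n.+1%:R.
    apply: complexI; rewrite froE PP mxtrace1 rmorph_nat //.
  have := @telescope _ Z (e * n.+1%:R) D K.
  move=> /(_ _)/le_trans; apply.
    move=> l; rewrite DE; apply: le_trans (stepX _ Z _ _ _ Zs) _.
    rewrite fro0 add0r froZ sqnorm_real sqr_sqrtr ?(ltW e0) // froP //.
  have -> : D 0%N = P k by rewrite /D /Y subr0.
  have tk : s ^+ 2 * h n (P k) <= t.
    by rewrite /t (bigD1 k) //= lerDl sumr_ge0.
  have -> : e * n.+1%:R = eps / 2 by rewrite /e; field; rewrite gt_eqF // ltr0n.
  have Kt : t <= K%:R * (eps / 2).
    have tp : 0 <= t by apply: sumr_ge0.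
    have : 2 * t / eps < K%:R.
      apply: lt_trans (archi_boundP _) _.
        by rewrite divr_ge0 ?mulr_ge0 ?(ltW eps0).
      by rewrite ltr_nat.
    rewrite ltr_pdivrMr //; lra.
  lra.
Qed.

End Interpolation.

(** * Ultralimits *)

Section Ultralimits.
Variables (R : realType) (I : Type) (U : set_system I).
Context {UU : UltraFilter U}.
Local Notation C := R[i].
Local Notation Re := complex.Re.
Local Notation Im := complex.Im.

Lemma ultra_bounded_cvg (g : I -> R) (M : R) :
  U [set i | `|g i| <= M] -> exists l : R, g @ U --> l.
Proof.
move=> gM.
have : (g @ U) `[- M, M]%classic.
  rewrite /= /fmap /=; apply: filterS gM => i /=.
  by rewrite in_itv /= ler_norml.
move=> /(@segment_compact _ (- M) M) [l [_ cl]]; exists l => A Al.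
have [//|nA] := in_ultra_setVsetC (g @^-1` A) UU.
have := cl (~` A) A; case => // x [nAx Ax]. by case: nAx.
Qed.

(** Convergence is tested on real and imaginary parts so that facts on limits of real functions
    apply. *)
Definition ucvg (g : I -> C) (z : C) : Prop :=
  (fun i => Re (g i)) @ U --> Re z /\ (fun i => Im (g i)) @ U --> Im z.

Lemma ucvg_exists (g : I -> C) (M : R) :
  U [set i | sqnorm (g i) <= M] -> exists z, ucvg g z.
Proof.
move=> gM; have bd (x : R) : x ^+ 2 <= M -> `|x| <= M + 1.
  move=> xM; have := sqr_ge0 (`|x| - 1); have := real_normK (num_real x).
  have := normr_ge0 x; nra.
have [a ga] : exists a : R, (fun i => Re (g i)) @ U --> a.
  apply: (@ultra_bounded_cvg _ (M + 1)); apply: filterS gM => i /=.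
  by rewrite sqnormE => h; apply: bd; apply: le_trans h; rewrite lerDl sqr_ge0.
have [b gb] : exists a : R, (fun i => Im (g i)) @ U --> a.
  apply: (@ultra_bounded_cvg _ (M + 1)); apply: filterS gM => i /=.
  by rewrite sqnormE => h; apply: bd; apply: le_trans h; rewrite lerDr sqr_ge0.
by exists (Complex a b).
Qed.

Lemma ucvg_unique (g : I -> C) y z : ucvg g y -> ucvg g z -> y = z.
Proof.
move=> [ya yb] [za zb]; apply/eqP; rewrite eq_complex; apply/andP.
by split; apply/eqP;
  [exact: (cvg_unique (@norm_hausdorff _ R) ya za)|
   exact: (cvg_unique (@norm_hausdorff _ R) yb zb)].
Qed.

Lemma ucvg_cst z : ucvg (fun _ => z) z.
Proof. by split; apply: cvg_cst. Qed.

Lemma ucvgD (g h : I -> C) y z : ucvg g y -> ucvg h z ->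
  ucvg (fun i => g i + h i) (y + z).
Proof.
have ReDE (a b : C) : Re (a + b) = Re a + Re b by case: a b => [? ?] [].
have ImDE (a b : C) : Im (a + b) = Im a + Im b by case: a b => [? ?] [].
move=> [ya yb] [za zb]; split.
  by rewrite ReDE; under eq_fun do rewrite ReDE; exact: cvgD.
by rewrite ImDE; under eq_fun do rewrite ImDE; exact: cvgD.
Qed.

Lemma ucvgZ (c : C) (g : I -> C) z : ucvg g z -> ucvg (fun i => c * g i) (c * z).
Proof.
have ReE (a b : C) : Re (a * b) = Re a * Re b - Im a * Im b by case: a b => [? ?] [].
have ImE (a b : C) : Im (a * b) = Re a * Im b + Im a * Re b by case: a b => [? ?] [].
move=> [za zb]; split.
  by rewrite ReE; under eq_fun do rewrite ReE; apply: cvgB; apply: cvgMr.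
by rewrite ImE; under eq_fun do rewrite ImE; apply: cvgD; apply: cvgMr.
Qed.

Lemma ucvg_sum (T : Type) (s : seq T) (g : T -> I -> C) (z : T -> C) :
  (forall t, ucvg (g t) (z t)) ->
  ucvg (fun i => \sum_(t <- s) g t i) (\sum_(t <- s) z t).
Proof.
move=> gz; elim: s => [|t s IH].
  by rewrite big_nil; under eq_fun do rewrite big_nil; exact: ucvg_cst.
by rewrite big_cons; under eq_fun do rewrite big_cons; exact: ucvgD.
Qed.

Definition umx m n (g : I -> 'M[C]_(m, n)) (A : 'M[C]_(m, n)) : Prop :=
  forall a b, ucvg (fun i => g i a b) (A a b).

Lemma umx_exists m n (g : I -> 'M[C]_(m, n)) (M : R) :
  U [set i | fro (g i) <= M] -> exists A, umx g A.
Proof.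
move=> gM; have gab a b : exists z : C, ucvg (fun i => g i a b) z.
  apply: (@ucvg_exists _ M); apply: filterS gM => i /=; apply: le_trans.
  exact: le_fro.
exists (\matrix_(a, b) sval (cid (gab a b))) => a b; rewrite mxE.
by case: cid.
Qed.

Lemma umx_unique m n (g : I -> 'M[C]_(m, n)) A B : umx g A -> umx g B -> A = B.
Proof. by move=> gA gB; apply/matrixP => a b; apply: ucvg_unique (gA a b) (gB a b). Qed.

Lemma umx_cst m n (A : 'M[C]_(m, n)) : umx (fun _ => A) A.
Proof. by move=> a b; exact: ucvg_cst. Qed.

Lemma umxD m n (g h : I -> 'M[C]_(m, n)) A B : umx g A -> umx h B ->
  umx (fun i => g i + h i) (A + B).
Proof.
move=> gA hB a b; rewrite mxE; under eq_fun do rewrite mxE.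
exact: ucvgD.
Qed.

Lemma umx_sum m n (T : Type) (s : seq T) (g : T -> I -> 'M[C]_(m, n)) A :
  (forall t, umx (g t) (A t)) ->
  umx (fun i => \sum_(t <- s) g t i) (\sum_(t <- s) A t).
Proof.
move=> gA a b; rewrite summxE; under eq_fun do rewrite summxE.
by apply: ucvg_sum => t; exact: gA.
Qed.

Lemma umxMl m n p (P : 'M[C]_(p, m)) (g : I -> 'M[C]_(m, n)) A :
  umx g A -> umx (fun i => P *m g i) (P *m A).
Proof.
move=> gA a b; rewrite mxE; under eq_fun do rewrite mxE.
by apply: ucvg_sum => k; apply: ucvgZ; exact: gA.
Qed.

Lemma umxMr m n p (P : 'M[C]_(n, p)) (g : I -> 'M[C]_(m, n)) A :
  umx g A -> umx (fun i => g i *m P) (A *m P).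
Proof.
move=> gA a b; rewrite mxE; under eq_fun do rewrite mxE.
apply: ucvg_sum => k; rewrite mulrC; under eq_fun do rewrite mulrC.
by apply: ucvgZ; exact: gA.
Qed.

Lemma umx_fro_le m n (g : I -> 'M[C]_(m, n)) A (M : R) :
  umx g A -> U [set i | fro (g i) <= M] -> fro A <= M.
Proof.
move=> gA gM; suff h : (fun i => fro (g i)) @ U --> fro A.
  by apply: (cvgr_to_le h); exact: gM.
have cs (T : Type) (s : seq T) (h : T -> I -> R) (y : T -> R) :
    (forall t, h t @ U --> y t) ->
    (fun i => \sum_(t <- s) h t i) @ U --> \sum_(t <- s) y t.
  move=> hy; elim: s => [|t s IH].
    by rewrite big_nil; under eq_fun do rewrite big_nil; exact: cvg_cst.
  by rewrite big_cons; under eq_fun do rewrite big_cons; exact: cvgD.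
apply: (cs) => a; apply: (cs) => b; have [gr gi] := gA a b.
rewrite sqnormE; under eq_fun do rewrite sqnormE.
by apply: cvgD; rewrite !expr2; under eq_fun do rewrite expr2; exact: cvgM.
Qed.

(** For fixed X, Y and S both laws are linear in the values of the function, so they survive
    entrywise limits. *)
Lemma umx_ncfun d (W : ncdom R d) (g : I -> gfun W) (F : gfun W) :
  (forall i, is_ncfun (g i)) ->
  (forall n X hX, umx (fun i => g i n X hX) (F n X hX)) -> is_ncfun F.
Proof.
move=> gnc gF; split=> [n m X Y hX hY hXY|n X S hX hSX uS].
  apply: umx_unique (gF _ _ hXY) _ => a b.
  under eq_fun => i do rewrite (proj1 (gnc i) _ _ _ _ hX hY hXY).
  rewrite -[a](@splitK n.+1 m.+1 a) -[b](@splitK n.+1 m.+1 b).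
  case: (@fintype.split n.+1 m.+1 a) => a'; case: (@fintype.split n.+1 m.+1 b) => b' /=.
  - rewrite (@block_mxEul _ n.+1 m.+1 n.+1 m.+1).
    under eq_fun => i do rewrite (@block_mxEul _ n.+1 m.+1 n.+1 m.+1).
    exact: gF.
  - rewrite (@block_mxEur _ n.+1 m.+1 n.+1 m.+1) mxE.
    under eq_fun => i do rewrite (@block_mxEur _ n.+1 m.+1 n.+1 m.+1) mxE.
    exact: ucvg_cst.
  - rewrite (@block_mxEdl _ n.+1 m.+1 n.+1 m.+1) mxE.
    under eq_fun => i do rewrite (@block_mxEdl _ n.+1 m.+1 n.+1 m.+1) mxE.
    exact: ucvg_cst.
  - rewrite (@block_mxEdr _ n.+1 m.+1 n.+1 m.+1).
    under eq_fun => i do rewrite (@block_mxEdr _ n.+1 m.+1 n.+1 m.+1).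
    exact: gF.
apply: umx_unique (gF _ _ hSX) _.
under eq_fun => i do rewrite (proj2 (gnc i) _ _ _ hX hSX uS).
by apply: umxMr; apply: umxMl; exact: gF.
Qed.

End Ultralimits.

(** * Frobenius norm, block action, and matrix polynomials as nc functions *)

Section FrobeniusNorm.
Variable R : realType.
Local Notation C := R[i].

Definition frn m n (A : 'M[C]_(m, n)) : R := Num.sqrt (fro A).

Lemma frnE m n (A : 'M[C]_(m, n)) : frn A = l2norm (mxvec A 0).
Proof.
rewrite /frn /l2norm /fro pair_bigA (reindex _ (curry_mxvec_bij m n)) /=.
by congr Num.sqrt; apply: eq_bigr => -[i j] _ /=; rewrite mxvecE.
Qed.

Lemma frnD m n (A B : 'M[C]_(m, n)) : frn (A + B) <= frn A + frn B.
Proof.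
rewrite !frnE; apply: le_trans (l2normD _ _).
by rewrite le_eqVlt; apply/orP; left; apply/eqP; congr l2norm; apply/funext => i;
  rewrite linearD mxE.
Qed.

Lemma frn_ge0 m n (A : 'M[C]_(m, n)) : 0 <= frn A.
Proof. exact: sqrtr_ge0. Qed.

Lemma sqr_frn m n (A : 'M[C]_(m, n)) : frn A ^+ 2 = fro A.
Proof. by rewrite sqr_sqrtr ?fro_ge0. Qed.

Lemma frnZ m n (c : C) (A : 'M[C]_(m, n)) : frn (c *: A) = complex.Re `|c| * frn A.
Proof.
by rewrite /frn froZ sqrtrM ?sqnorm_ge0 // sqrtr_sqr ger0_norm ?Re_norm_ge0.
Qed.

Lemma frn_le m n m' n' (A : 'M[C]_(m, n)) (B : 'M[C]_(m', n')) (c : R) : 0 <= c ->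
  (frn A <= c * frn B) = (fro A <= c ^+ 2 * fro B).
Proof.
move=> c0; rewrite -!sqr_frn -exprMn ler_pXn2r ?nnegrE ?mulr_ge0 ?frn_ge0 //.
Qed.

Lemma frn0 m n : frn (0 : 'M[C]_(m, n)) = 0.
Proof. by rewrite /frn fro0 sqrtr0. Qed.

Lemma fro_eq0 m n (A : 'M[C]_(m, n)) : fro A <= 0 -> A = 0.
Proof.
move=> A0; apply/matrixP => i j; rewrite mxE; apply/eqP; rewrite -normr_eq0.
have := le_trans (le_fro A i j) A0.
rewrite Re_norm_real /sqnorm => h.
have /eqP : complex.Re `|A i j| ^+ 2 = 0 by apply/eqP; rewrite eq_le h sqr_ge0.
by rewrite sqrf_eq0 => /eqP->.
Qed.

Lemma frn_sum (T : Type) (s : seq T) m n (A : T -> 'M[C]_(m, n)) :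
  frn (\sum_(t <- s) A t) <= \sum_(t <- s) frn (A t).
Proof.
elim: s => [|t s IH]; first by rewrite !big_nil frn0.
by rewrite !big_cons; apply: le_trans (frnD _ _) _; rewrite lerD2l.
Qed.

Lemma blkapp_delta m N (F : 'I_N -> 'I_N -> 'M[C]_m) b j a i :
  blkapp F (delta_mx b j) a i = F i j a b.
Proof.
rewrite /blkapp summxE (bigD1 i) //= summxE (bigD1 j) //=.
have E i' j' : (F i' j' *m delta_mx b j *m delta_mx j' i') a i =
    (j == j')%:R * (i == i')%:R * F i' j' a b.
  rewrite -mulmxA mul_delta_mx_cond; case: (j == j'); last first.
    by rewrite mulr0n mulmx0 mxE !mul0r.
  rewrite mulr1n mxE (bigD1 b) //= big1 => [|l /negPf lb].
    by rewrite mxE eqxx addr0 mul1r mulrC.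
  by rewrite mxE lb mulr0.
rewrite E !eqxx !mul1r !big1 ?addr0 // => [i' ii|j' jj].
  rewrite summxE big1 // => j' _; rewrite E [i == i']eq_sym (negPf ii).
  by rewrite mulr0 mul0r.
by rewrite E [j == j']eq_sym (negPf jj) !mul0r.
Qed.

Lemma blkappB m N (F G : 'I_N -> 'I_N -> 'M[C]_m) v :
  blkapp F v - blkapp G v = blkapp (fun i j => F i j - G i j) v.
Proof.
rewrite /blkapp -sumrB; apply: eq_bigr => i _; rewrite -sumrB.
by apply: eq_bigr => j _; rewrite !mulmxBl.
Qed.

End FrobeniusNorm.

Section PolynomialBlocks.
Variables (R : realType) (d N : nat).
Local Notation C := R[i].

(** The indices in [c w j i] are swapped because coefficients act from the right. *)
Definition polyblk (c : seq 'I_d -> 'M[C]_N) K n (X : mtuple R d n) i j : 'M[C]_n.+1 :=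
  \sum_(k < K) \sum_(w <- words d k) c w j i *: wordmx X w.

Lemma mxpoly_blk c K n (X : mtuple R d n) v :
  mxpoly c K X v = blkapp (polyblk c K X) v.
Proof.
have mxE' (A : 'M[C]_N) : A = \sum_i \sum_j A j i *: delta_mx j i.
  by rewrite exchange_big {1}(matrix_sum_delta A).
rewrite /blkapp /polyblk /mxpoly /homog.
under [RHS]eq_bigr => i _.
  under eq_bigr => j _ do rewrite !mulmx_suml.
  rewrite exchange_big /=; over.
rewrite [RHS]exchange_big; apply: eq_bigr => k _ /=.
under [RHS]eq_bigr => i _.
  under eq_bigr => j _ do rewrite !mulmx_suml.
  rewrite exchange_big /=; over.
rewrite [RHS]exchange_big; apply: eq_bigr => w _ /=.
rewrite {1}(mxE' (c w)) mulmx_sumr; apply: eq_bigr => i _; rewrite mulmx_sumr.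
by apply: eq_bigr => j _; rewrite -scalemxAr -!scalemxAl.
Qed.

Lemma wordmx_intertwine n m (X : mtuple R d n) (Y : mtuple R d m)
    (P : 'M[C]_(m.+1, n.+1)) w :
  (forall j, P *m X j = Y j *m P) -> P *m wordmx X w = wordmx Y w *m P.
Proof.
move=> PX; elim: w => [|j w IH]; first by rewrite /wordmx !big_nil mulmx1 mul1mx.
by rewrite /wordmx !big_cons -/(wordmx X w) -/(wordmx Y w) mulmxA PX -!mulmxA IH.
Qed.

Lemma polyblk_intertwine c K n m (X : mtuple R d n) (Y : mtuple R d m)
    (P : 'M[C]_(m.+1, n.+1)) i j :
  (forall l, P *m X l = Y l *m P) -> P *m polyblk c K X i j = polyblk c K Y i j *m P.
Proof.
move=> PX; rewrite /polyblk mulmx_sumr mulmx_suml; apply: eq_bigr => k _.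
rewrite mulmx_sumr mulmx_suml; apply: eq_bigr => w _.
by rewrite -scalemxAr -scalemxAl (wordmx_intertwine _ PX).
Qed.

(** Both laws are instances of intertwining: the rows [1 0] and [0 1] intertwine a direct sum with
    its summands, and S intertwines S^-1 X S with X. *)
Lemma intertwine_ncfun (W : ncdom R d) (g : gfun W) :
  (forall n m (X : mtuple R d n) (Y : mtuple R d m) hX hY (P : 'M[C]_(m.+1, n.+1)),
     (forall l, P *m X l = Y l *m P) -> P *m g n X hX = g m Y hY *m P) ->
  is_ncfun g.
Proof.
move=> H; split=> [n m X Y hX hY hXY|n X S hX hSX uS].
  pose G : 'M[C]_(n.+1 + m.+1) := g _ _ hXY; rewrite -[LHS]/G.
  have [] : (row_mx 1%:M 0 *m G = g n X hX *m row_mx 1%:M (0 : 'M[C]_(n.+1, m.+1))) /\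
     (row_mx 0 1%:M *m G = g m Y hY *m row_mx (0 : 'M[C]_(m.+1, n.+1)) 1%:M).
    split; apply: H => l; rewrite ffunE.
      exact: (@row_blockl _ n.+1 m.+1).
    by apply: (@row_blockr _ m.+1 n.+1 m.+1); rewrite mul1mx mulmx1.
  rewrite -[G](@submxK _ n.+1 m.+1 n.+1 m.+1).
  rewrite !(@mul_row_block _ n.+1 n.+1 m.+1 n.+1 m.+1).
  rewrite !(@mul_row_block _ m.+1 n.+1 m.+1 n.+1 m.+1).
  rewrite !mul1mx !mul0mx !addr0 !add0r !mul_mx_row !mulmx1 !mulmx0.
  by move=> /eq_row_mx [-> ->] /eq_row_mx [-> ->].
have /= := H _ _ _ _ hSX hX S (fun l => conjmtE X l uS).
by move=> E; rewrite -mulrA -[_ * S]E mulrA mulVr // mul1r.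
Qed.

End PolynomialBlocks.

(** * Extension to the operator ball *)

Section Scaling.
Variables (R : realType) (d : nat) (HR HS : completeNormedModType R[i]).
Variable Q : 'I_d -> {linear HR -> HS}.
Local Notation C := R[i].

Lemma Qbound_le n (s s' : R) (X : mtuple R d n) :
  0 <= s -> s <= s' -> Qbound Q s X -> Qbound Q s' X.
Proof.
move=> s0 ss h u; apply: le_trans (h u) _; apply: ler_wpM2r; first exact: hsq_ge0.
by rewrite ler_pXn2r ?nnegrE // (le_trans s0).
Qed.

Lemma QboundZ n (s : R) (c : C) (X : mtuple R d n) :
  Qbound Q s X -> Qbound Q (complex.Re `|c| * s) (c *: X).
Proof.
move=> h u; have -> : Qop Q (c *: X) u = fun i => c *: Qop Q X u i.
  apply/funext => i; rewrite /Qop scaler_sumr; apply: eq_bigr => j _.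
  rewrite scaler_sumr; apply: eq_bigr => l _.
  by rewrite ffunE mxE scalerA.
have -> : hsq (fun i => c *: Qop Q X u i) = complex.Re `|c| ^+ 2 * hsq (Qop Q X u).
  rewrite /hsq mulr_sumr; apply: eq_bigr => i _; rewrite /sqnorm normrZ -exprMn.
  by rewrite (Re_norm_real c) (Re_norm_real (Qop _ _ _ _)) /= mul0r subr0.
by rewrite exprMn -[leRHS]mulrA ler_wpM2l ?sqr_ge0.
Qed.

Lemma wordmxZ n (c : C) (X : mtuple R d n) w :
  wordmx (c *: X) w = c ^+ size w *: wordmx X w.
Proof.
elim: w => [|j w IH]; first by rewrite /wordmx !big_nil scale1r.
rewrite /wordmx !big_cons -!/(wordmx _ w) IH ffunE exprS.
by rewrite -scalerAl -scalerAr scalerA.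
Qed.

Lemma homogZ N (a : seq 'I_d -> 'M[C]_N) k n (c : C) (X : mtuple R d n) v :
  homog a k (c *: X) v = c ^+ k *: homog a k X v.
Proof.
rewrite /homog scaler_sumr big_seq [RHS]big_seq; apply: eq_bigr => w.
by move=> /size_words <-; rewrite wordmxZ -!scalemxAl.
Qed.

(** A Schwarz lemma: [X] is rho / s times a point of the ball of radius [s], and homogeneity
    extracts the k-th power of this factor. *)
Lemma homog_decay N (a : seq 'I_d -> 'M[C]_N) k n (X : mtuple R d n) v (rho s : R) :
  0 < rho -> 0 < s ->
  (forall (Y : mtuple R d n) v, Qbound Q s Y -> fro (homog a k Y v) <= fro v) ->
  Qbound Q rho X -> frn (homog a k X v) <= (rho / s) ^+ k * frn v.
Proof.
move=> rho0 s0 H Xrho; have q0 : 0 < rho / s by rewrite divr_gt0.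
rewrite frn_le ?exprn_ge0 ?(ltW q0) //.
have XE : X = (rho / s)%:C *: ((s / rho)%:C *: X).
  rewrite scalerA -rmorphM /= mulrA divfK ?gt_eqF // divff ?gt_eqF //.
  by rewrite scale1r.
rewrite {1}XE homogZ froZ.
have -> : sqnorm ((rho / s)%:C ^+ k : C) = ((rho / s) ^+ k) ^+ 2.
  by rewrite -rmorphXn /= sqnorm_real.
rewrite ler_wpM2l ?sqr_ge0 //; apply: H.
have := QboundZ (s / rho)%:C Xrho.
have -> // : complex.Re `|(s / rho)%:C : C| * rho = s.
have -> : `|(s / rho)%:C : C| = (s / rho)%:C.
  by rewrite ger0_norm // realC_ge0 divr_ge0 ?ltW.
by rewrite /= divfK ?gt_eqF.
Qed.

Lemma geometric_tail (q : R) (a : nat -> R) (K L : nat) : 0 <= q -> q < 1 ->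
  (forall k, a k <= q ^+ k) -> \sum_(K <= k < L) a k <= q ^+ K / (1 - q).
Proof.
move=> q0 q1 aq; apply: (@le_trans _ _ (\sum_(K <= k < L) q ^+ k)).
  by apply: ler_sum => k _.
rewrite ler_pdivlMr ?subr_gt0 //.
have [KL|LK] := leqP K L; last first.
  by rewrite big_geq 1?ltnW // mul0r exprn_ge0.
suff -> : (\sum_(K <= k < L) q ^+ k) * (1 - q) = q ^+ K - q ^+ L.
  by rewrite lerBlDr lerDl exprn_ge0.
rewrite -(subnKC KL); elim: (L - K)%N => [|l IH].
  by rewrite addn0 big_geq // mul0r subrr.
rewrite addnS big_nat_recr ?leq_addr //= mulrDl IH exprS; ring.
Qed.

End Scaling.

Section Extension.
Variables (R : realType) (d : nat) (HR HS : completeNormedModType R[i]).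
Variable Q : 'I_d -> {linear HR -> HS}.
Local Notation C := R[i].
Local Notation Re := complex.Re.
Variables (bR : HR -> HR -> C) (bS : HS -> HS -> C).
Hypotheses (hbR : semi_inner bR) (hbS : semi_inner bS).
Hypotheses (bRE : forall x, bR x x = (sqnorm x)%:C).
Hypotheses (bSE : forall x, bS x x = (sqnorm x)%:C).
Variable k0 : R.
Hypothesis k0_ge0 : 0 <= k0.
Hypothesis Qk0 : forall j x, sqnorm (Q j x) <= k0 * sqnorm x.

Variables (W V : ncdom R d).
Hypothesis WE : forall n (X : mtuple R d n),
  W X <-> exists s, [/\ 0 < s, s < 1 & Qbound Q s X].
Hypothesis VW : ncsub V W.
Hypothesis Vdsum : forall n m (X : mtuple R d n) (Y : mtuple R d m),
  V X -> V Y -> V (dsum X Y).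
Hypothesis Vsim : forall n (X : mtuple R d n) (S : 'M[C]_n.+1),
  V X -> S \is a GRing.unit -> W (conjmt S X) -> V (conjmt S X).

Variables (N : nat) (f : 'I_N -> 'I_N -> gfun V).
Hypothesis fnc : forall i j, is_ncfun (f i j).
Hypothesis fle : forall n (X : mtuple R d n) (hX : V X) (v : 'M[C]_(n.+1, N)),
  fro (blkapp (fun i j => f i j hX) v) <= fro v.
Variables (n0 : nat) (Z0 : mtuple R d n0).
Hypothesis hZ0 : V Z0.

(* The data of a matrix polynomial with coefficients p.1 and degree < p.2. *)
Let I : Type := ((seq 'I_d -> 'M[C]_N) * nat)%type.

Let index : Type := {n & {Z : mtuple R d n | V Z}} * R * R.

(** A radius of at least 1/2 bounds k0 / s^2 by 4 k0 uniformly, which is what gives the coefficients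
    ultralimits. *)
Let admissible (t : index) : Prop :=
  [/\ 2^-1 <= t.1.2, t.1.2 < 1, Qbound Q t.1.2 (sval (tagged t.1.1)) & 0 < t.2].

(* Polynomials contractive on the ball of radius s that interpolate f at Z up
   to e, for t = (Z, s, e). *)
Let good (t : index) : set I := [set p : I |
  [/\ forall w i j, sqnorm (p.1 w i j) <= (4 * k0) ^+ size w,
      forall w, (p.2 <= size w)%N -> p.1 w = 0,
      forall m (X : mtuple R d m) v, Qbound Q t.1.2 X ->
        fro (mxpoly p.1 p.2 X v) <= fro v,
      forall k m (X : mtuple R d m) v, Qbound Q t.1.2 X ->
        fro (homog p.1 k X v) <= fro v &
      forall h a j, fro (mxpoly p.1 p.2 (sval (tagged t.1.1)) (delta_mx a j) -
        blkapp (fun i j => f i j (h : V (sval (tagged t.1.1)))) (delta_mx a j)) <=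
      t.2]].

Lemma good_nonempty t : admissible t -> good t !=set0.
Proof.
case: t => -[[n [Z hZ]] s] e [/= s2 s1 Zs e0]; have s0 : 0 < s.
  by apply: lt_le_trans s2.
have [|c [K [c1 c0 c2 c3 c4]]] := mxpoly_interpolation hbR hbS bRE bSE k0_ge0 Qk0 Vdsum
  _ s0 fnc fle hZ e0 Zs.
  move=> n' X S hX uS Xs; apply: Vsim => //; apply/WE; exists s; split => //.
exists (c, K); split; last 4 first.
- exact: c0.
- exact: c2.
- exact: c3.
- by move=> h a j; rewrite (Prop_irrelevance h hZ); exact: c4.
move=> w i j; apply: le_trans (c1 w i j) _.
have e4 : k0 / s ^+ 2 <= 4 * k0.
  rewrite ler_pdivrMr ?exprn_gt0 // mulrAC -[leLHS]mul1r; apply: ler_wpM2r => //.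
  have : 0 <= s - 2^-1 by rewrite subr_ge0.
  by nra.
apply: lerXn2r => //; rewrite nnegrE; last by rewrite mulr_ge0.
by rewrite divr_ge0 ?sqr_ge0.
Qed.

(** Direct sums make the family directed: a polynomial that interpolates at the direct sum of Z1 and
    Z2, on the larger radius and with the smaller error, interpolates at each summand by
    compression. *)
Lemma good_filter : ProperFilter (filter_from admissible good).
Proof.
apply: filter_from_proper; last exact: good_nonempty.
apply: filter_from_filter.
  have [s [s0 s1 hs]] := proj1 (WE Z0) (VW hZ0).
  exists (existT _ n0 (exist _ Z0 hZ0), Num.max s 2^-1, 1); split => //=.
  - by rewrite le_max lexx orbT.
  - by rewrite gt_max s1 /=; lra.
  - by apply: Qbound_le hs; [exact: ltW|rewrite le_max lexx].
move=> [[[n1 [Z1 h1]] s1] e1] [[[n2 [Z2 h2]] s2] e2] /=.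
move=> [/= a1 b1 c1 d1] [/= a2 b2 c2 d2].
have p1 : 0 <= s1 by apply: le_trans a1.
have p2 : 0 <= s2 by apply: le_trans a2.
have h12 := Vdsum h1 h2.
exists (existT _ (n1 + n2.+1)%N (exist _ (dsum Z1 Z2) h12),
  Num.max s1 s2, Num.min e1 e2).
  split => /=.
  - by rewrite le_max a1.
  - by rewrite gt_max b1.
  - by apply: Qbound_dsum; [apply: Qbound_le c1|apply: Qbound_le c2];
      rewrite // le_max lexx ?orbT.
  - by rewrite lt_min d1.
move=> [c K] [/= g1 g0 g2 g3 g4].
have block n' (Z : mtuple R d n') (h : V Z)
    (P : 'M[C]_(n'.+1, (n1 + n2.+1).+1)) (E : 'I_n'.+1 -> 'I_(n1 + n2.+1).+1)
    (s e : R) :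
    (forall l, P *m dsum Z1 Z2 l = Z l *m P) ->
    (forall i j, P *m f i j h12 = f i j h *m P) ->
    (forall a j, P *m (delta_mx (E a) j : 'M[C]_(_, N)) = delta_mx a j) ->
    (forall A : 'M[C]_(_, N), fro (P *m A) <= fro A) ->
    0 <= s -> s <= Num.max s1 s2 -> Num.min e1 e2 <= e ->
    good (existT _ n' (exist _ Z h), s, e) (c, K).
  move=> PZ Pf PE Ple sp ss ee; split => //=.
  - by move=> m X v Xs; apply: g2; apply: Qbound_le Xs.
  - by move=> k m X v Xs; apply: g3; apply: Qbound_le Xs.
  - move=> h' a j; rewrite (Prop_irrelevance h' h).
    apply: le_trans ee; apply: le_trans (g4 h12 (E a) j).
    apply: le_trans (Ple _); rewrite mulmxBr !mxpoly_blk.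
    rewrite (blkapp_intertwine _ (F' := polyblk c K Z)); last first.
      by move=> i' j'; exact: polyblk_intertwine.
    rewrite (blkapp_intertwine (F := fun i j => f i j h12)
      (F' := fun i j => f i j h) (delta_mx (E a) j) Pf).
    by rewrite !PE; exact: lexx.
have frosplit p (A : 'M[C]_(n1.+1 + n2.+1, p)) :
    fro A = fro (usubmx A) + fro (dsubmx A).
  rewrite /fro big_split_ord /=; congr (_ + _); apply: eq_bigr => i _;
  by apply: eq_bigr => j _; rewrite mxE.
split.
- apply: (block _ _ h1 (row_mx 1%:M (0 : 'M[C]_(n1.+1, n2.+1)))
    (@lshift n1.+1 n2.+1)) => //.
  + by move=> l; rewrite ffunE; exact: (@row_blockl _ n1.+1 n2.+1).
  + move=> i j; rewrite (proj1 (fnc i j) _ _ _ _ h1 h2).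
    exact: (@row_blockl _ n1.+1 n2.+1).
  + move=> a j; apply/matrixP => i k.
    rewrite -[X in _ *m X](@vsubmxK _ n1.+1 n2.+1) (@mul_row_col _ n1.+1 n1.+1 n2.+1).
    rewrite mul1mx mul0mx addr0 !mxE; congr ((_ && _)%:R).
  + move=> A; rewrite -[X in _ *m X](@vsubmxK _ n1.+1 n2.+1)
      (@mul_row_col _ n1.+1 n1.+1 n2.+1).
    by rewrite mul1mx mul0mx addr0 [leRHS]frosplit lerDl fro_ge0.
  + by rewrite le_max lexx.
  + by rewrite ge_min lexx.
- apply: (block _ _ h2 (row_mx (0 : 'M[C]_(n2.+1, n1.+1)) 1%:M)
    (@rshift n1.+1 n2.+1)) => //.
  + move=> l; rewrite ffunE; apply: (@row_blockr _ n2.+1 n1.+1 n2.+1).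
    by rewrite mul1mx mulmx1.
  + move=> i j; rewrite (proj1 (fnc i j) _ _ _ _ h1 h2).
    by apply: (@row_blockr _ n2.+1 n1.+1 n2.+1); rewrite mul1mx mulmx1.
  + move=> a j; apply/matrixP => i k.
    rewrite -[X in _ *m X](@vsubmxK _ n1.+1 n2.+1) (@mul_row_col _ n2.+1 n1.+1 n2.+1).
    rewrite mul1mx mul0mx add0r !mxE; congr ((_ && _)%:R).
    by rewrite -val_eqE /= eqn_add2l.
  + move=> A; rewrite -[X in _ *m X](@vsubmxK _ n1.+1 n2.+1)
      (@mul_row_col _ n2.+1 n1.+1 n2.+1).
    by rewrite mul1mx mul0mx add0r [leRHS]frosplit lerDr fro_ge0.
  + by rewrite le_max lexx orbT.
  + by rewrite ge_min lexx orbT.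
Qed.

Lemma pow_small (q e : R) : 0 <= q -> q < 1 -> 0 < e -> exists K, q ^+ K <= e.
Proof.
move=> q0 q1 e0; have q1' : `|q| < 1 by rewrite ger0_norm.
have /cvgrPdist_le /(_ e e0) [K _ HK] := cvg_expr q1'.
by exists K; have := HK K (leqnn K); rewrite sub0r normrN ger0_norm ?exprn_ge0.
Qed.

Lemma admissible_exists n (Z : mtuple R d n) (hZ : V Z) (s e : R) :
  0 < s -> s < 1 -> 0 < e ->
  exists s', [/\ s <= s', s' < 1 & admissible (existT _ n (exist _ Z hZ), s', e)].
Proof.
move=> s0 s1 e0; have [r [r0 r1 hr]] := proj1 (WE Z) (VW hZ).
have m1 : Num.max (Num.max s r) 2^-1 < 1.
  by rewrite !gt_max s1 r1 /=; lra.
exists (Num.max (Num.max s r) 2^-1); split => //.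
  by rewrite !le_max lexx.
split => //=; first by rewrite le_max lexx orbT.
by apply: Qbound_le hr; [exact: ltW|rewrite !le_max lexx !orbT].
Qed.

Theorem ncfun_extension :
  exists (F : 'I_N -> 'I_N -> gfun W) (c : seq 'I_d -> 'M[C]_N),
  [/\ forall i j, is_ncfun (F i j),
      forall n (X : mtuple R d n) (hX : W X) (v : 'M[C]_(n.+1, N)),
        fro (blkapp (fun i j => F i j n X hX) v) <= fro v,
      forall i j n (X : mtuple R d n) (hX : W X) (hV : V X),
        F i j n X hX = f i j hV &
      forall rho e, 0 < rho -> rho < 1 -> 0 < e ->
        exists K, forall n (X : mtuple R d n) (hX : W X), Qbound Q rho X ->
          forall v, frn (blkapp (fun i j => F i j n X hX) v - mxpoly c K X v) <=
            e * frn v].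
Proof.
have [U [UU FU]] := ultraFilterLemma good_filter.
have Ugood t : admissible t -> U (good t) by move=> ht; apply: FU; exists t.
have Wgood n (X : mtuple R d n) : W X -> exists2 t, admissible t & Qbound Q t.1.2 X.
  move=> /WE [s [s0 s1 Xs]].
  have [s' [ss s1' ad]] := admissible_exists hZ0 s0 s1 ltr01.
  by eexists; [exact: ad|apply: Qbound_le Xs => //; exact: ltW].
have Fex i j n (X : mtuple R d n) (hX : W X) :
    exists A, umx U (fun p : I => polyblk p.1 p.2 X i j) A.
  have [t ad tX] := Wgood _ _ hX.
  (* Each entry of a block is an entry of the image of a basis vector, hence has modulus at most 1
     for contractive polynomials. *)
  apply: (@umx_exists _ _ _ _ _ _ _ (\sum_(a < n.+1) \sum_(b < n.+1) 1)).
  apply: filterS (Ugood _ ad) => p [_ _ g2 _ _] /=.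
  apply: ler_sum => a _; apply: ler_sum => b _.
  have := g2 _ X (delta_mx b j) tX; rewrite fro_delta; apply: le_trans.
  by rewrite mxpoly_blk -(blkapp_delta _ b j a i) le_fro.
have cex w : exists A, umx U (fun p : I => p.1 w) A.
  have [t ad _] := Wgood _ _ (VW hZ0).
  apply: (@umx_exists _ _ _ _ _ _ _ (\sum_(a < N) \sum_(b < N) (4 * k0) ^+ size w)).
  apply: filterS (Ugood _ ad) => p [g1 _ _ _ _] /=.
  by apply: ler_sum => a _; apply: ler_sum => b _.
pose F i j : gfun W := fun n X hX => sval (cid (Fex i j n X hX)).
have Fu i j n X hX : umx U (fun p : I => polyblk p.1 p.2 X i j) (F i j n X hX).
  by rewrite /F; case: cid.
pose c w := sval (cid (cex w)).
have cu w : umx U (fun p : I => p.1 w) (c w) by rewrite /c; case: cid.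
have Fv n (X : mtuple R d n) (hX : W X) v : umx U (fun p : I => mxpoly p.1 p.2 X v)
    (blkapp (fun i j => F i j n X hX) v).
  under eq_fun do rewrite mxpoly_blk.
  rewrite /blkapp; apply: umx_sum => i; apply: umx_sum => j.
  by apply: umxMr; apply: umxMr; exact: Fu.
exists F, c; split.
- move=> i j; apply: (umx_ncfun (U := U)
    (g := fun p : I => fun n X (_ : W X) => polyblk p.1 p.2 X i j)) => //.
  by move=> p; apply: intertwine_ncfun => n m X Y _ _ P; exact: polyblk_intertwine.
- move=> n X hX v; apply: umx_fro_le (Fv _ _ hX v) _.
  have [t ad tX] := Wgood _ _ hX.
  by apply: filterS (Ugood _ ad) => p [_ _ g2 _ _] /=; exact: g2.
- move=> i j n X hX hV; apply/matrixP => a b.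
  have h e : 0 < e -> fro (blkapp (fun i j => F i j n X hX) (delta_mx b j) -
      blkapp (fun i j => f i j hV) (delta_mx b j)) <= e.
    move=> e0; have half : (0 : R) < 2^-1 by rewrite invr_gt0.
    have half1 : (2^-1 : R) < 1 by lra.
    have [s' [_ _ ad]] := admissible_exists hV half half1 e0.
    apply: (umx_fro_le (U := U) (umxD (Fv _ _ hX (delta_mx b j)) (umx_cst _))).
    by apply: filterS (Ugood _ ad) => p [_ _ _ _ g4] /=; exact: g4.
  have /fro_eq0 /eqP : fro (blkapp (fun i j => F i j n X hX) (delta_mx b j) -
      blkapp (fun i j => f i j hV) (delta_mx b j)) <= 0.
    by apply/ler_addgt0Pr => e e0; rewrite add0r h.
  rewrite subr_eq0 => /eqP E.
  by rewrite -(blkapp_delta (fun i j => F i j n X hX)) E blkapp_delta.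
(* Polynomials contractive on a radius s' > rho have k-th parts of norm at most q^k with q = rho /
   s' < 1, whatever their degree. So [K] depends on [rho] and [e] but not on the polynomial, and the
   tail estimate passes to the ultralimit. *)
- move=> rho e rho0 rho1 e0; pose s := (1 + rho) / 2.
  have s0 : 0 < s by rewrite /s; lra.
  have s1 : s < 1 by rewrite /s; lra.
  have rs : rho < s by rewrite /s; lra.
  have [s' [ss s1' ad]] := admissible_exists hZ0 s0 s1 ltr01.
  pose q := rho / s'.
  have sp : 0 < s' by apply: lt_le_trans ss.
  have q0 : 0 <= q by rewrite divr_ge0 ?ltW.
  have q1 : q < 1 by rewrite ltr_pdivrMr // mul1r (lt_le_trans rs).
  have q1' : 0 < 1 - q by rewrite subr_gt0.
  have [K qK] := pow_small q0 q1 (mulr_gt0 e0 q1').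
  exists K => n X hX Xr v; rewrite frn_le ?(ltW e0) //.
  have hu k : umx U (fun p : I => homog p.1 k X v) (homog c k X v).
    by apply: umx_sum => w; apply: umxMl; exact: cu.
  have mu : umx U (fun p : I => - mxpoly p.1 K X v) (- mxpoly c K X v).
    have N1 (A : 'M[C]_(n.+1, N)) : - A = (- 1%:M) *m A by rewrite mulNmx mul1mx.
    rewrite N1; under eq_fun do rewrite N1.
    by apply: umxMl; apply: umx_sum => k; exact: hu.
  apply: umx_fro_le (umxD (Fv _ _ hX v) mu) _.
  apply: filterS (Ugood _ ad) => p [_ g0 _ g3 _] /=.
  rewrite -frn_le ?(ltW e0) //.
  have zero k : (p.2 <= k)%N -> homog p.1 k X v = 0.
    move=> kp; rewrite /homog big_seq big1 // => w /size_words wk.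
    by rewrite g0 ?wk // mulmx0.
  pose L := maxn K p.2.
  have -> : mxpoly p.1 p.2 X v = \sum_(0 <= k < L) homog p.1 k X v.
    rewrite /mxpoly -(big_mkord xpredT (fun k => homog p.1 k X v)).
    rewrite (@big_cat_nat _ _ _ p.2 0 L) ?leq_maxr //=.
    rewrite (_ : \sum_(p.2 <= k < L) _ = 0) ?addr0 // big_nat_cond.
    by apply: big1 => k /andP[/andP[pk _] _]; exact: zero.
  rewrite /mxpoly -(big_mkord xpredT (fun k => homog p.1 k X v)).
  rewrite (@big_cat_nat _ _ _ K 0 L) ?leq_maxl //= addrAC subrr add0r.
  apply: le_trans (frn_sum _ _) _.
  have dec k : frn (homog p.1 k X v) <= q ^+ k * frn v.
    apply: homog_decay Xr => // Y v'; exact: g3.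
  apply: le_trans (ler_sum _ (fun k _ => dec k)) _.
  rewrite -mulr_suml ler_wpM2r ?frn_ge0 //.
  apply: le_trans (geometric_tail K L q0 q1 (fun k => lexx _)) _.
  by rewrite ler_pdivrMr ?subr_gt0.
Qed.

End Extension.

(** * Operator norms of block matrices *)

Section BlockNorm.
Variable R : realType.
Local Notation C := R[i].
Local Notation Re := complex.Re.

Lemma fro_cols m n (A : 'M[C]_(m, n)) : fro A = \sum_j fro (col j A).
Proof.
rewrite /fro exchange_big; apply: eq_bigr => j _; apply: eq_bigr => i _.
by rewrite big_ord1 mxE.
Qed.

Lemma mxnorm_fro m n (A : 'M[C]_(m, n)) (c : R) : 0 <= c ->
  (mxnorm A <= c) <-> (forall w : 'cV[C]_n, fro (A *m w) <= c ^+ 2 * fro w).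
Proof.
move=> c0; have E k (w : 'cV[C]_k) : fro w = l2norm (fun i => w i 0) ^+ 2.
  by rewrite l2norm_sqr; apply: eq_bigr => i _; rewrite big_ord1.
have act (w : 'cV[C]_n) : (fun i => (A *m w) i 0) = mxact A (fun i => w i 0).
  by apply/funext => i; rewrite mxE.
split=> [Ac w|H].
  rewrite !E act -exprMn ler_pXn2r ?nnegrE ?mulr_ge0 ?l2norm_ge0 //.
  by apply: le_trans (mxact_le _ _) _; rewrite ler_wpM2r ?l2norm_ge0.
apply: mxnorm_le => // u.
have := H (\col_i u i); rewrite !E act -exprMn.
rewrite ler_pXn2r ?nnegrE ?mulr_ge0 ?l2norm_ge0 //.
by rewrite (_ : (fun i => (\col_i u i) i 0) = u) //; apply/funext => i; rewrite mxE.
Qed.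

Lemma mxnorm_fro_mul m n p (A : 'M[C]_(m, n)) (w : 'M[C]_(n, p)) :
  fro (A *m w) <= mxnorm A ^+ 2 * fro w.
Proof.
rewrite fro_cols [fro w]fro_cols mulr_sumr; apply: ler_sum => j _.
rewrite colE -mulmxA -colE.
by have [h _] := mxnorm_fro A (mxnorm_ge0 A); apply: h.
Qed.

Lemma col_blkapp m N (F : 'I_N -> 'I_N -> 'M[C]_m) v i :
  col i (blkapp F v) = \sum_j F i j *m col j v.
Proof.
rewrite colE /blkapp mulmx_suml (bigD1 i) //= mulmx_suml.
rewrite [X in _ + X]big1 ?addr0 => [|i' /negPf ii].
  apply: eq_bigr => j _; rewrite -mulmxA mul_delta_mx.
  by rewrite -mulmxA -colE.
rewrite mulmx_suml big1 // => j _.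
by rewrite -mulmxA mul_delta_mx_cond ii mulr0n mulmx0.
Qed.

(** The blocks stacked in one long column, on which [\mxblock] acts, are the columns of the matrix
    on which [blkapp] acts, and both arrangements have the same norm. *)
Lemma mxnorm_block m N (F : 'I_N -> 'I_N -> 'M[C]_m) (c : R) : 0 <= c ->
  (mxnorm (\mxblock_(i < N, j < N) F i j) <= c) <->
  (forall v, fro (blkapp F v) <= c ^+ 2 * fro v).
Proof.
move=> c0; rewrite mxnorm_fro //.
have fc (w : 'I_N -> 'cV[C]_m) : fro (\mxcol_i w i) = \sum_i fro (w i).
  rewrite /fro; under [LHS]eq_bigr do rewrite big_ord1.
  under [RHS]eq_bigr => i _ do under eq_bigr do rewrite big_ord1.
  rewrite [RHS]sig_big_dep [RHS](reindex _ tagnat.sig_bij_on) /=.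
  by apply: eq_bigr => i _; rewrite mxE.
split=> H.
  move=> v; have := H (\mxcol_i col i v); rewrite mul_mxblock_mxrow !fc.
  rewrite fro_cols [fro v]fro_cols.
  by under [in X in _ -> X]eq_bigr do rewrite col_blkapp.
move=> w; rewrite -(submxcolK w) mul_mxblock_mxrow !fc.
have := H (\matrix_(a, i) submxcol w i a 0).
have E i : col i (\matrix_(a, i) submxcol w i a 0) = submxcol w i.
  by apply/matrixP => a o; rewrite ord1 !mxE.
rewrite fro_cols [fro (\matrix_(_, _) _)]fro_cols.
under eq_bigr do rewrite col_blkapp.
under [in X in _ <= _ * X -> _]eq_bigr do rewrite E.
congr (_ <= _); apply: eq_bigr => i _; congr fro; apply: eq_bigr => j _.
by rewrite E.
Qed.

Lemma mxnorm_entry m N (F : 'I_N -> 'I_N -> 'M[C]_m) i j (c : R) : 0 <= c ->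
  (forall v, fro (blkapp F v) <= c ^+ 2 * fro v) -> mxnorm (F i j) <= c.
Proof.
move=> c0 H; apply/mxnorm_fro => // w.
pose v : 'M[C]_(m, N) := \matrix_(a, k) (w a 0 *+ (k == j)).
have ce k : col k v = w *+ (k == j).
  apply/matrixP => a o; rewrite ord1 !mxE.
  by case: (k == j); rewrite ?mulr0n ?mulr1n ?mxE.
have fv : fro v = fro w.
  rewrite fro_cols (bigD1 j) //= ce eqxx mulr1n big1 ?addr0 // => k /negPf kj.
  by rewrite ce kj mulr0n fro0.
have cb : col i (blkapp F v) = F i j *m w.
  rewrite col_blkapp (bigD1 j) //= ce eqxx mulr1n big1 ?addr0 // => k /negPf kj.
  by rewrite ce kj mulr0n mulmx0.
rewrite -fv -cb; apply: le_trans (H v); rewrite [leRHS]fro_cols (bigD1 i) //= lerDl.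
by apply: sumr_ge0 => k _; exact: fro_ge0.
Qed.

Lemma blkapp_le_sum m N (F : 'I_N -> 'I_N -> 'M[C]_m) v :
  frn (blkapp F v) <= (\sum_i \sum_j mxnorm (F i j)) * frn v.
Proof.
rewrite /blkapp mulr_suml; apply: le_trans (frn_sum _ _) _.
apply: ler_sum => i _; rewrite mulr_suml; apply: le_trans (frn_sum _ _) _.
apply: ler_sum => j _; rewrite frn_le ?mxnorm_ge0 // -mulmxA.
apply: le_trans (mxnorm_fro_mul _ _) _; rewrite ler_wpM2l ?sqr_ge0 //.
rewrite fro_cols (bigD1 i) //= big1 ?addr0 => [|k /negPf ki].
  rewrite [leRHS]fro_cols [leRHS](bigD1 j) //=.
  rewrite colE -mulmxA mul_delta_mx -colE lerDl.
  by apply: sumr_ge0 => l _; exact: fro_ge0.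
by rewrite colE -mulmxA mul_delta_mx_cond [i == k]eq_sym ki mulr0n mulmx0 fro0.
Qed.

End BlockNorm.

(** * Geometry of the operator ball and of its subvarieties *)

Section OperatorBallFacts.
Variables (R : realType) (d : nat) (HR HS : completeNormedModType R[i]).
Variable Q : 'I_d -> {linear HR -> HS}.
Local Notation C := R[i].
Local Notation Re := complex.Re.

Lemma hsq_l2norm (H : normedZmodType C) n (u : 'I_n -> H) : hsq u = l2norm u ^+ 2.
Proof. by rewrite l2norm_sqr. Qed.

Lemma Re_normZ (H : normedModType C) (c : C) (x : H) :
  Re `|c *: x| = Re `|c| * Re `|x|.
Proof. by rewrite normrZ (Re_norm_real c) (Re_norm_real x) /= mulr0 subr0. Qed.

Lemma continuous_sqnorm_bound : (forall j, continuous (Q j)) ->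
  exists2 k0 : R, 0 <= k0 & forall j x, sqnorm (Q j x) <= k0 * sqnorm x.
Proof.
move=> Qc.
have kj j : exists M : R, 0 <= M /\ forall x, Re `|Q j x| <= M * Re `|x|.
  have /linear_bounded_continuous/linear_boundedP := Qc j.
  move=> /pinfty_ex_gt0 [r r0 hr]; exists (Re r); split.
    by apply: Re_ge0; exact: ltW.
  move=> x; have := hr x; rewrite (ge0_ReE (ltW r0)) (Re_norm_real (Q j x)).
  by rewrite (Re_norm_real x) -rmorphM /= lecR.
pose M j := sval (cid (kj j)).
have M0 j : 0 <= M j by rewrite /M; case: cid => r /= [].
have MQ j x : Re `|Q j x| <= M j * Re `|x| by rewrite /M; case: cid => r /= [].
exists (\sum_j M j ^+ 2); first by apply: sumr_ge0 => j _; exact: sqr_ge0.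
move=> j x; apply: (@le_trans _ _ (M j ^+ 2 * sqnorm x)).
  rewrite /sqnorm -exprMn ler_pXn2r ?nnegrE ?Re_norm_ge0 ?MQ //.
  by rewrite mulr_ge0 ?Re_norm_ge0.
apply: ler_wpM2r; first exact: sqnorm_ge0.
by rewrite (bigD1 j) //= lerDl; apply: sumr_ge0 => l _; exact: sqr_ge0.
Qed.

Variable k0 : R.
Hypothesis k0_ge0 : 0 <= k0.
Hypothesis Qk0 : forall j x, sqnorm (Q j x) <= k0 * sqnorm x.

Lemma Re_norm_sum (H : normedZmodType C) (T : Type) (s : seq T) (F : T -> H) :
  Re `|\sum_(t <- s) F t| <= \sum_(t <- s) Re `|F t|.
Proof.
elim: s => [|t s IH]; first by rewrite !big_nil normr0.
by rewrite !big_cons; apply: le_trans (Re_normD _ _) _; rewrite lerD2l.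
Qed.

(** An unbounded set has supremum 0 here, so boundedness must be known before [opnorm] can majorize
    anything. *)
Lemma Qop_bounded n (X : mtuple R d n) :
  exists M : R, forall u, l2norm u <= 1 -> l2norm (Qop Q X u) <= M.
Proof.
pose m i := \sum_j \sum_l Re `|X j i l| * Num.sqrt k0.
exists (Num.sqrt (\sum_i m i ^+ 2)) => u u1; rewrite /l2norm ler_sqrt; last first.
  by apply: sumr_ge0 => i _; exact: sqr_ge0.
apply: ler_sum => i _; rewrite ler_pXn2r ?nnegrE ?Re_norm_ge0 //; last first.
  apply: sumr_ge0 => j _; apply: sumr_ge0 => l _.
  by rewrite mulr_ge0 ?Re_norm_ge0 ?sqrtr_ge0.
apply: le_trans (Re_norm_sum _ _) _; apply: ler_sum => j _.
apply: le_trans (Re_norm_sum _ _) _; apply: ler_sum => l _.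
rewrite Re_normZ; apply: ler_wpM2l; first exact: Re_norm_ge0.
rewrite -(@ler_pXn2r _ 2) ?nnegrE ?Re_norm_ge0 ?sqrtr_ge0 // sqr_sqrtr //.
apply: le_trans (Qk0 _ _) _; apply: ler_piMr => //.
by rewrite exprn_ile1 ?Re_norm_ge0 // (le_trans (le_l2norm u l)).
Qed.

Lemma l2norm_scale (H : normedModType C) n (c : C) (u : 'I_n -> H) :
  l2norm (fun i => c *: u i) = Re `|c| * l2norm u.
Proof.
rewrite -[in RHS](@ger0_norm _ (Re _)) ?Re_norm_ge0 // -sqrtr_sqr.
rewrite -sqrtrM ?sqr_ge0 // mulr_sumr; congr Num.sqrt.
by apply: eq_bigr => i _; rewrite Re_normZ exprMn.
Qed.

Lemma Qop_le_opnorm n (X : mtuple R d n) u :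
  l2norm (Qop Q X u) <= opnorm (Qop Q X) * l2norm u.
Proof.
have [M HM] := Qop_bounded X.
have sup_ub v : l2norm v <= 1 -> l2norm (Qop Q X v) <= opnorm (Qop Q X).
  move=> v1; apply: ub_le_sup; last by exists v.
  by exists M => _ [w /= w1 <-]; exact: HM.
have [u0|u0] := eqVneq (l2norm u) 0.
  have -> : Qop Q X u = fun _ => 0.
    rewrite (l2norm_eq0 u0); apply/funext => i; rewrite /Qop big1 // => j _.
    by rewrite big1 // => l _; rewrite linear0 scaler0.
  by rewrite l2norm0 u0 mulr0.
have {}u0 : 0 < l2norm u by rewrite lt_def u0 l2norm_ge0.
pose c : C := ((l2norm u)^-1)%:C.
have cE : Re `|c| = (l2norm u)^-1.
  by rewrite ger0_norm // realC_ge0 invr_ge0 l2norm_ge0.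
have := sup_ub (fun i => c *: u i); rewrite QopZ !l2norm_scale cE.
rewrite mulVf ?gt_eqF // => /(_ (lexx _)).
by rewrite mulrC ler_pdivrMr.
Qed.

Lemma ncball_Qbound n (X : mtuple R d n) :
  ncball Q n X <-> exists s, [/\ 0 < s, s < 1 & Qbound Q s X].
Proof.
split=> [X1|[s [s0 s1 hs]]].
  (* The maximum with 1/2 keeps the radius positive when Q(X) = 0. *)
  exists (Num.max (opnorm (Qop Q X)) 2^-1); split.
  - by rewrite lt_max invr_gt0 ltr0n orbT.
  - by rewrite gt_max X1 /=; lra.
  - move=> u; rewrite !hsq_l2norm -exprMn ler_pXn2r ?nnegrE ?l2norm_ge0 //; last first.
      by rewrite mulr_ge0 ?l2norm_ge0 // le_max invr_ge0 ler0n orbT.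
    apply: le_trans (Qop_le_opnorm _ _) _; rewrite ler_wpM2r ?l2norm_ge0 //.
    by rewrite le_max lexx.
apply: le_lt_trans s1; apply: ge_sup.
  by exists (l2norm (Qop Q X (fun _ => 0))), (fun _ => 0) => //=; rewrite l2norm0.
move=> _ [u /= u1 <-].
have := hs u; rewrite !hsq_l2norm -exprMn ler_pXn2r ?nnegrE ?l2norm_ge0
  ?mulr_ge0 ?(ltW s0) ?l2norm_ge0 //.
by move=> h; apply: le_trans h _; rewrite ler_piMr ?(ltW s0).
Qed.

Lemma ncballZ n (c : C) (X : mtuple R d n) : `|c| <= 1 -> ncball Q n X ->
  ncball Q _ (c *: X).
Proof.
move=> c1 /ncball_Qbound [s [s0 s1 hs]]; apply/ncball_Qbound; exists s; split => //.
apply: Qbound_le (QboundZ c hs).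
  by rewrite mulr_ge0 ?Re_norm_ge0 ?ltW.
rewrite ler_piMl ?(ltW s0) //.
by move: c1; rewrite (Re_norm_real c) -(rmorph1 (real_complex R)) lecR.
Qed.

Section ZeroSets.
Variables (k : alg_kind) (V : ncdom R d).
Hypothesis hV : subvariety Q k V.

Lemma ncalg_Hinf (W : ncdom R d) (F : ncalg k W) : in_Hinf (F : gfun W).
Proof. by have := ncalgP F; case: k F => F; [case | ]. Qed.

Lemma ncalg_ncfun (W : ncdom R d) (F : ncalg k W) : is_ncfun (F : gfun W).
Proof. by case: (ncalg_Hinf F). Qed.

Lemma subvariety_dsum n m (X : mtuple R d n) (Y : mtuple R d m) :
  V X -> V Y -> V (dsum X Y).
Proof.
case: hV => S -> [hX X0] [hY Y0].
have hXY : ncball Q _ (dsum X Y).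
  have [s [s0 s1 Xs]] := proj1 (ncball_Qbound X) hX.
  have [t [t0 t1 Yt]] := proj1 (ncball_Qbound Y) hY.
  apply/ncball_Qbound; exists (Num.max s t); split.
  - by rewrite lt_max s0.
  - by rewrite gt_max s1.
  - by apply: Qbound_dsum; [apply: Qbound_le (ltW s0) _ Xs|
        apply: Qbound_le (ltW t0) _ Yt];
      rewrite le_max lexx ?orbT.
exists hXY => F SF; rewrite (proj1 (ncalg_ncfun F) _ _ _ _ hX hY) X0 // Y0 //.
exact: (@block_mx0 _ n.+1 m.+1 n.+1 m.+1).
Qed.

Lemma subvariety_sim n (X : mtuple R d n) (S : 'M[C]_n.+1) :
  V X -> S \is a GRing.unit -> ncball Q _ (conjmt S X) -> V (conjmt S X).
Proof.
case: hV => S0 -> [hX X0] uS hSX; exists hSX => F SF.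
by rewrite (proj2 (ncalg_ncfun F) _ _ _ hX hSX uS) X0 // mulr0 mul0r.
Qed.

End ZeroSets.

Section Boundedness.
Variables (bR : HR -> HR -> C) (bS : HS -> HS -> C).
Hypotheses (hbR : semi_inner bR) (hbS : semi_inner bS).
Hypotheses (bRE : forall x, bR x x = (sqnorm x)%:C).
Hypotheses (bSE : forall x, bS x x = (sqnorm x)%:C).
Hypothesis Qindep : lin_indep Q.

Lemma inner_cauchy (x y : HS) : sqnorm (bS x y) <= sqnorm x * sqnorm y.
Proof.
have [y0|y0] := eqVneq (sqnorm y) 0.
  have -> : y = 0.
    apply/eqP; rewrite -normr_eq0 Re_norm_real; move/eqP: y0.
    by rewrite sqrf_eq0 => /eqP ->.
  by rewrite inner0r // {1}/sqnorm normr0 expr0n mulr_ge0 ?sqnorm_ge0.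
have {}y0 : 0 < sqnorm y by rewrite lt_def y0 sqnorm_ge0.
pose c : C := ((sqnorm y)^-1)%:C * bS x y.
have cy : c * (sqnorm y)%:C = bS x y.
  by rewrite /c mulrAC -rmorphM /= mulVf ?gt_eqF // rmorph1 mul1r.
have cc : c^*%R = ((sqnorm y)^-1)%:C * (bS x y)^*%R.
  rewrite [LHS]rmorphM; congr (_ * _); exact: conjC_real.
have := @bessel _ _ _ hbS 1 (fun _ => y) x (c%:M).
have G : gram bS (fun _ : 'I_1 => y) = ((sqnorm y)%:C)%:M.
  by apply/matrixP => i j; rewrite !ord1 !mxE eqxx mulr1n bSE.
have E : \row_(a < 1) bS x y = c%:M *m gram bS (fun _ : 'I_1 => y).
  by rewrite G -scalar_mxM cy; apply/matrixP => i j; rewrite !ord1 !mxE eqxx.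
move=> /(_ E); rewrite G -scalar_mxM cy mul_scalar_mx bSE !mxE eqxx mulr1n.
rewrite cc mulrCA -sqnormC -rmorphM /= lecR.
by rewrite mulrC ler_pdivrMr.
Qed.

(** Rows are chosen greedily. If the rows so far annihilate some nonzero c, independence of the Q_l
    gives x1 with y1 = sum_l c_l Q_l x1 nonzero, and the row of the pair (x1, y1) takes the value
    |y1|^2 at c. *)
Lemma pairing_rows k : (k <= d)%N -> exists (x : 'I_k -> HR) (y : 'I_k -> HS),
  row_free (\matrix_(i < k, l < d) bS (Q l (x i)) (y i)).
Proof.
elim: k => [|k IH] kd.
  by exists (fun _ => 0), (fun _ => 0); rewrite /row_free flatmx0 mxrank0.
have [x [y free]] := IH (ltnW kd); set A := (\matrix_(i, l) _) in free.
have [c cker cn0] : exists2 c : 'cV[C]_d, A *m c = 0 & c != 0.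
  have : cokermx A != 0.
    by rewrite -mxrank_eq0 mxrank_coker (eqP free) subn_eq0 -ltnNge.
  move=> /eqP co; have [j cj] : exists j, col j (cokermx A) != 0.
    apply/existsP; apply: contrapT => /negP; rewrite negb_exists => /forallP h.
    apply: co; apply/matrixP => a b; have := h b; rewrite negbK => /eqP E.
    by have := congr1 (fun B => fun_of_matrix B a 0) E; rewrite !mxE.
  by exists (col j (cokermx A)) => //; rewrite colE mulmxA mulmx_coker mul0mx.
have [x1 nx1] : exists x1, \sum_l c l 0 *: Q l x1 != 0.
  apply: contrapT => h; case/eqP: cn0; apply/matrixP => l o; rewrite ord1 mxE.
  apply: (Qindep (c := fun l => c l 0)) => z; apply: contrapT => /eqP hz.
  by apply: h; exists z.
pose y1 := \sum_l c l 0 *: Q l x1.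
pose t : 'rV[C]_d := \row_l bS (Q l x1) y1.
have tc : (t *m c) 0 0 != 0.
  have -> : (t *m c) 0 0 = bS y1 y1.
    rewrite {2}/y1 inner_suml // mxE; apply: eq_bigr => l _.
    by rewrite mxE innerZl // mulrC.
  rewrite bSE eq_complex /= eqxx andbT /sqnorm sqrf_eq0.
  apply: contra nx1 => /eqP y10; rewrite -normr_eq0 Re_norm_real.
  by rewrite y10.
rewrite -addn1.
exists (fun i => if fintype.split i is inl j then x j else x1).
exists (fun i => if fintype.split i is inl j then y j else y1).
set B := (\matrix_(i, l) _).
have -> : B = col_mx A t.
  by apply/matrixP => i l; rewrite !mxE; case: fintype.split => j; rewrite !mxE.
rewrite -kermx_eq0; apply/eqP/row_matrixP => i; rewrite row0.
set z := row i _.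
have : z *m col_mx A t = 0 by rewrite -row_mul mulmx_ker row0.
rewrite -[z]hsubmxK mul_row_col => zB.
have z2 : rsubmx z = 0.
  have : (lsubmx z *m A + rsubmx z *m t) *m c = 0 by rewrite zB mul0mx.
  rewrite mulmxDl -!mulmxA cker mulmx0 add0r => E.
  apply/matrixP => a b; rewrite !ord1 [RHS]mxE.
  have := congr1 (fun M => fun_of_matrix M 0 0) E; rewrite mxE big_ord1 [RHS]mxE.
  by move=> /eqP; rewrite mulf_eq0 (negPf tc) orbF => /eqP.
move: zB; rewrite z2 mul0mx addr0 => /eqP.
by rewrite mulmx_free_eq0 // => /eqP ->; rewrite row_mx0.
Qed.

(** Compressing Q(X) by the pair (x_i, y_i) yields the combination of the X_l with coefficients in
    row i of an invertible matrix, of norm at most |x_i| |y_i|. Inverting that matrix recovers each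
    X_j. *)
Lemma ncball_bounded : exists2 C0 : R, 0 <= C0 &
  forall n (X : mtuple R d n), ncball Q n X -> forall j p (v : 'M[C]_(n.+1, p)),
    frn (X j *m v) <= C0 * frn v.
Proof.
have [x [y free]] := pairing_rows (leqnn d).
set A := (\matrix_(i, l) _) in free.
have uA : A \in unitmx by rewrite -row_free_unit.
have key i n (X : mtuple R d n) p (v : 'M[C]_(n.+1, p)) : ncball Q n X ->
    frn ((\sum_l A i l *: X l) *m v) <= Re `|x i| * Re `|y i| * frn v.
  move=> /ncball_Qbound [s [s0 s1 hs]]; rewrite frn_le ?mulr_ge0 ?Re_norm_ge0 //.
  rewrite fro_cols [fro v]fro_cols mulr_sumr; apply: ler_sum => b _.
  rewrite colE -mulmxA -colE.
  pose u a := v a b *: x i.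
  have E a : ((\sum_l A i l *: X l) *m col b v) a 0 = bS (Qop Q X u a) (y i).
    rewrite mulmx_suml summxE /Qop inner_suml //; apply: eq_bigr => l _.
    rewrite -scalemxAl mxE [(X l *m _) a 0]mxE mulr_sumr inner_suml //.
    apply: eq_bigr => e _.
    by rewrite innerZl // linearZ innerZl // !mxE; ring.
  rewrite /fro; under eq_bigr => a _ do rewrite big_ord1 E.
  apply: (@le_trans _ _ (\sum_a sqnorm (Qop Q X u a) * sqnorm (y i))).
    by apply: ler_sum => a _; exact: inner_cauchy.
  rewrite -mulr_suml exprMn mulrAC.
  apply: ler_wpM2r; first exact: sqnorm_ge0.
  apply: (@le_trans _ _ (hsq u)).
    apply: le_trans (hs u) _; apply: ler_piMl; first exact: hsq_ge0.
    by rewrite exprn_ile1 ?ltW.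
  rewrite /hsq mulr_sumr; apply: ler_sum => a _.
  by rewrite big_ord1 !mxE /u /sqnorm Re_normZ exprMn mulrC.
pose C0 := \sum_j \sum_i Re `|invmx A j i| * (Re `|x i| * Re `|y i|).
have pos j i : 0 <= Re `|invmx A j i| * (Re `|x i| * Re `|y i|).
  by rewrite !mulr_ge0 ?Re_norm_ge0.
exists C0; first by apply: sumr_ge0 => j _; apply: sumr_ge0 => i _.
move=> n X hX j p v.
have XE : X j = \sum_i invmx A j i *: \sum_l A i l *: X l.
  under eq_bigr do rewrite scaler_sumr.
  rewrite exchange_big /= (bigD1 j) //=.
  have cE l : \sum_i invmx A j i *: (A i l *: X l) = (j == l)%:R *: X l.
    under eq_bigr do rewrite scalerA.
    rewrite -scaler_suml; congr (_ *: _).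
    by have := congr1 (fun M => fun_of_matrix M j l) (mulVmx uA); rewrite !mxE.
  rewrite cE eqxx scale1r big1 ?addr0 // => l lj.
  by rewrite cE eq_sym (negPf lj) scale0r.
apply: (@le_trans _ _ (\sum_i Re `|invmx A j i| * (Re `|x i| * Re `|y i|) * frn v)).
  rewrite {1}XE mulmx_suml; apply: le_trans (frn_sum _ _) _; apply: ler_sum => i _.
  rewrite -scalemxAl -mulrA frnZ.
  by apply: ler_wpM2l; [exact: Re_norm_ge0|exact: key].
rewrite -mulr_suml; apply: ler_wpM2r; first exact: frn_ge0.
rewrite /C0 [leRHS](bigD1 j) // lerDl.
by apply: sumr_ge0 => l _; apply: sumr_ge0 => i _; exact: pos.
Qed.

End Boundedness.
End OperatorBallFacts.

(** * Dilations *)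

Section AlgebraNorm.
Variables (R : realType) (d : nat) (k : alg_kind) (W : ncdom R d).
Local Notation C := R[i].

Definition evalblk N (F : 'M[ncalg k W]_N) n (X : mtuple R d n) (hX : W X) i j :
  'M[C]_n.+1 := (F i j : gfun W) n X hX.

Lemma ncalg_bounded (F : ncalg k W) : exists M : R, forall n X hX,
  mxnorm ((F : gfun W) n X hX) <= M.
Proof. by case: (ncalg_Hinf F). Qed.

Lemma evalblk_bounded N (F : 'M[ncalg k W]_N) : exists2 M : R, 0 <= M &
  forall n (X : mtuple R d n) (hX : W X),
    mxnorm (\mxblock_(i < N, j < N) evalblk F hX i j) <= M.
Proof.
pose M i j := sval (cid (ncalg_bounded (F i j))).
have MF i j n X hX : mxnorm ((F i j : gfun W) n X hX) <= M i j.
  by rewrite /M; case: cid.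
have M0 : 0 <= \sum_i \sum_j `|M i j| by apply: sumr_ge0 => i _; apply: sumr_ge0.
exists (\sum_i \sum_j `|M i j|) => // n X hX; apply/mxnorm_block => // v.
rewrite -frn_le //; apply: le_trans (blkapp_le_sum _ _) _.
rewrite ler_wpM2r ?frn_ge0 //; apply: ler_sum => i _; apply: ler_sum => j _.
exact: le_trans (MF _ _ _ _ _) (ler_norm _).
Qed.

Lemma le_algnorm N (F : 'M[ncalg k W]_N) n (X : mtuple R d n) (hX : W X) :
  mxnorm (\mxblock_(i < N, j < N) evalblk F hX i j) <= algnorm k W N F.
Proof.
have [M _ HM] := evalblk_bounded F; apply: ub_le_sup; last by exists n, X, hX.
by exists M => _ [m [Y [hY ->]]]; exact: HM.
Qed.

(** On an empty domain the supremum is 0, and [0 <= c] settles that case. *)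
Lemma algnorm_le N (F : 'M[ncalg k W]_N) (c : R) : 0 <= c ->
  (forall n (X : mtuple R d n) (hX : W X),
    mxnorm (\mxblock_(i < N, j < N) evalblk F hX i j) <= c) -> algnorm k W N F <= c.
Proof.
move=> c0 H; rewrite /algnorm; set A := [set r | _].
have [A0|/nonemptyPn A0] := pselect (A !=set0); last by rewrite A0 sup0.
by apply: ge_sup => // _ [n [X [hX ->]]]; exact: H.
Qed.

Lemma algnorm_ge0 N (F : 'M[ncalg k W]_N) : 0 <= algnorm k W N F.
Proof.
rewrite /algnorm; set A := [set r | _].
have [[r Ar]|/nonemptyPn A0] := pselect (A !=set0); last by rewrite A0 sup0.
have [n [X [hX _]]] := Ar.
exact: le_trans (mxnorm_ge0 _) (le_algnorm F hX).
Qed.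

Lemma evalblk_fro N (F : 'M[ncalg k W]_N) n (X : mtuple R d n) (hX : W X) v :
  frn (blkapp (evalblk F hX) v) <= algnorm k W N F * frn v.
Proof.
rewrite frn_le ?algnorm_ge0 //; apply: (iffLR (mxnorm_block _ (algnorm_ge0 F))).
exact: le_algnorm.
Qed.

Lemma algnorm_fro_le N (F : 'M[ncalg k W]_N) (c : R) : 0 <= c ->
  (forall n (X : mtuple R d n) (hX : W X) v,
    frn (blkapp (evalblk F hX) v) <= c * frn v) -> algnorm k W N F <= c.
Proof.
move=> c0 H; apply: algnorm_le => // n X hX; apply/mxnorm_block => // v.
by rewrite -frn_le //; exact: H.
Qed.

End AlgebraNorm.

Section Dilation.
Variables (R : realType) (d : nat) (HR HS : completeNormedModType R[i]).
Variable Q : 'I_d -> {linear HR -> HS}.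
Local Notation C := R[i].
Local Notation Re := complex.Re.
Local Notation B := (ncball Q).
Variable k0 : R.
Hypothesis k0_ge0 : 0 <= k0.
Hypothesis Qk0 : forall j x, sqnorm (Q j x) <= k0 * sqnorm x.
Variable C0 : R.
Hypothesis C0_ge0 : 0 <= C0.
Hypothesis Bbound : forall n (X : mtuple R d n), B n X ->
  forall j p (v : 'M[C]_(n.+1, p)), frn (X j *m v) <= C0 * frn v.

Lemma gfun_congr (W : ncdom R d) (g : gfun W) n (X Y : mtuple R d n) hX hY :
  X = Y -> g n X hX = g n Y hY.
Proof. by move=> E; subst Y; rewrite (Prop_irrelevance hX hY). Qed.

Lemma dsumZ n m (c : C) (X : mtuple R d n) (Y : mtuple R d m) :
  c *: dsum X Y = dsum (c *: X) (c *: Y).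
Proof.
apply/ffunP => j; rewrite !ffunE (@scale_block_mx _ n.+1 m.+1 n.+1 m.+1).
by rewrite !scaler0.
Qed.

Lemma conjmtZ n (c : C) (S : 'M[C]_n.+1) (X : mtuple R d n) :
  c *: conjmt S X = conjmt S (c *: X).
Proof. by apply/ffunP => j; rewrite !ffunE -scalerAr -scalerAl. Qed.

Lemma unit_interval_norm (r : R) : 0 <= r -> r <= 1 -> `|r%:C : C| <= 1.
Proof.
by move=> r0 r1; rewrite ger0_norm ?realC_ge0 // -(rmorph1 (real_complex R)) lecR.
Qed.

Section FixedRadius.
Variable r : R.
Hypotheses (r0 : 0 <= r) (r1 : r <= 1).

Lemma ncball_dil n (X : mtuple R d n) : B n X -> B n (r%:C *: X).
Proof. exact: (ncballZ k0_ge0 Qk0 (unit_interval_norm r0 r1)). Qed.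

Definition dil (g : gfun B) : gfun B := fun n X hX => g n _ (ncball_dil hX).

Lemma dil_Hinf g : in_Hinf g -> in_Hinf (dil g).
Proof.
move=> [[gD gS] [M gM]]; split; [split|].
- move=> n m X Y hX hY hXY; rewrite /dil.
  have hD : B _ (dsum (r%:C *: X) (r%:C *: Y)) by rewrite -dsumZ; exact: ncball_dil.
  rewrite (gfun_congr _ _ hD (dsumZ _ _ _)).
  exact: gD.
- move=> n X S hX hSX uS; rewrite /dil.
  have hS : B n (conjmt S (r%:C *: X)) by rewrite -conjmtZ; exact: ncball_dil.
  rewrite (gfun_congr _ _ hS (conjmtZ _ _ _)).
  exact: gS.
- by exists M => n X hX; exact: gM.
Qed.

Definition ncpoly_dil (p : ncpoly R d) : ncpoly R d :=
  [seq (t.1 * r%:C ^+ size t.2, t.2) | t <- p].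

Lemma ncpoly_dilE p n (X : mtuple R d n) :
  ncpoly_eval (ncpoly_dil p) X = ncpoly_eval p (r%:C *: X).
Proof.
rewrite /ncpoly_eval big_map; apply: eq_bigr => t _ /=.
by rewrite -scalerA -[in RHS]/(wordmx _ _) wordmxZ.
Qed.

Lemma dil_Acont g : in_Acont g -> in_Acont (dil g).
Proof.
move=> [gH ga]; split; first exact: dil_Hinf.
move=> e e0; have [p hp] := ga e e0; exists (ncpoly_dil p) => n X hX.
by rewrite ncpoly_dilE; exact: hp.
Qed.

End FixedRadius.

Lemma wordmx_bound n (X : mtuple R d n) w : B n X ->
  mxnorm (wordmx X w) <= C0 ^+ size w.
Proof.
move=> hX; apply/mxnorm_fro; first exact: exprn_ge0.
move=> v; rewrite -frn_le ?exprn_ge0 //.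
elim: w => [|j w IH].
  by rewrite /wordmx big_nil mul1mx expr0 mul1r.
rewrite /wordmx big_cons -/(wordmx X w) -mulmxA exprS -mulrA.
by apply: le_trans (Bbound hX _ _) _; rewrite ler_wpM2l.
Qed.

Lemma bernoulli_pow (r : R) m : 0 <= r -> r <= 1 -> 1 - r ^+ m <= m%:R * (1 - r).
Proof.
move=> r0 r1; elim: m => [|m IH]; first by rewrite expr0 subrr mul0r.
have -> : 1 - r ^+ m.+1 = (1 - r) + r * (1 - r ^+ m) by rewrite exprS; ring.
rewrite -natr1 mulrDl mul1r addrC lerD2r.
apply: le_trans IH; apply: ler_piMl => //.
by rewrite subr_ge0 exprn_ile1.
Qed.

Lemma ncpoly_bounded (p : ncpoly R d) : exists M : R, forall n (X : mtuple R d n),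
  B n X -> mxnorm (ncpoly_eval p X) <= M.
Proof.
exists (\sum_(t <- p) Re `|t.1| * C0 ^+ size t.2) => n X hX.
rewrite /ncpoly_eval; elim: p => [|t p IH]; first by rewrite !big_nil mxnorm0.
rewrite !big_cons; apply: le_trans (mxnormD _ _) _; apply: lerD => //.
apply: le_trans (mxnormZ _ _) _; apply: ler_wpM2l; first exact: Re_norm_ge0.
exact: wordmx_bound.
Qed.

Lemma ncpoly_dil_close (p : ncpoly R d) : exists2 M : R, 0 <= M &
  forall (r : R), 0 <= r -> r <= 1 -> forall n (X : mtuple R d n),
  B n X -> mxnorm (ncpoly_eval p X - ncpoly_eval p (r%:C *: X)) <= M * (1 - r).
Proof.
pose m (t : C * seq 'I_d) : R := Re `|t.1| * ((size t.2)%:R * C0 ^+ size t.2).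
have m0 t : 0 <= m t by rewrite /m !mulr_ge0 ?Re_norm_ge0 ?exprn_ge0.
exists (\sum_(t <- p) m t); first exact: sumr_ge0.
move=> r r0 r1 n X hX; rewrite /ncpoly_eval -sumrB mulr_suml.
elim: p => [|t p IH]; first by rewrite !big_nil mxnorm0.
rewrite !big_cons; apply: le_trans (mxnormD _ _) _; apply: lerD => //.
rewrite -/(wordmx X t.2) -/(wordmx (r%:C *: X) t.2) wordmxZ -scalerBr.
rewrite -{1}[wordmx X t.2]scale1r -scalerBl.
apply: le_trans (mxnormZ _ _) _; rewrite /m -mulrA ler_wpM2l ?Re_norm_ge0 //.
apply: le_trans (mxnormZ _ _) _.
have -> : Re `|1 - r%:C ^+ size t.2 : C| = 1 - r ^+ size t.2.
  rewrite -rmorphXn -(rmorph1 (real_complex R)) -rmorphB ger0_norm //.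
  by rewrite realC_ge0 subr_ge0 exprn_ile1.
rewrite mulrAC; apply: ler_pM; rewrite ?mxnorm_ge0 ?wordmx_bound //.
  by rewrite subr_ge0 exprn_ile1.
exact: bernoulli_pow.
Qed.

(** A three-term estimate through a polynomial p close to g: p approximates g at X and at rX, and
    p(X) - p(rX) is O(1 - r) uniformly because words are bounded on the ball. *)
Lemma Acont_dil_close (g : gfun B) (e : R) : in_Acont g -> 0 < e ->
  exists2 eta, eta < 1 & forall r (r0 : 0 <= r) (r1 : r <= 1), eta <= r ->
    forall n X hX, mxnorm (g n X hX - dil r0 r1 g hX) <= e.
Proof.
move=> [_ ga] e0; have e3 : 0 < e / 3 by rewrite divr_gt0.
have [p hp] := ga _ e3; have [M M0 hM] := ncpoly_dil_close p.
have M1 : 0 < M + 1 by rewrite ltr_wpDl.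
exists (1 - e / 3 / (M + 1)); first by rewrite ltrBlDr ltrDl divr_gt0.
move=> r r0 r1 hr n X hX.
set p1 := ncpoly_eval p X; set p2 := ncpoly_eval p (r%:C *: X).
have -> : g n X hX - dil r0 r1 g hX =
  (g n X hX - p1) + (p1 - p2) + ((-1) *: (dil r0 r1 g hX - p2)).
  by rewrite scaleN1r opprB !addrA !subrK.
have -> : e = e / 3 + e / 3 + e / 3 by field.
apply: le_trans (mxnormD _ _) _; apply: lerD.
  apply: le_trans (mxnormD _ _) _; apply: lerD; first exact: hp.
  apply: le_trans (hM _ r0 r1 _ _ hX) _.
  apply: (@le_trans _ _ ((M + 1) * (1 - r))).
    by rewrite ler_wpM2r ?subr_ge0 // lerDl.
  have : 1 - r <= e / 3 / (M + 1) by lra.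
  by rewrite ler_pdivlMr // mulrC.
apply: le_trans (mxnormZ _ _) _; rewrite normrN1 mul1r; exact: hp.
Qed.

End Dilation.

(** * Lifting from the subvariety *)

Section Lifting.
Variables (R : realType) (d : nat) (HR HS : completeNormedModType R[i]).
Hypotheses (hHR : is_hilbert HR) (hHS : is_hilbert HS).
Variable Q : 'I_d -> {linear HR -> HS}.
Hypotheses (Qbounded : forall j, continuous (Q j)) (Qindep : lin_indep Q).
Local Notation C := R[i].
Local Notation Re := complex.Re.
Local Notation B := (ncball Q).

Lemma is_ncfunZ (W : ncdom R d) (c : C) (f : gfun W) : is_ncfun f -> is_ncfun (c *: f).
Proof.
move=> [fD fS]; split=> [n m X Y hX hY hXY|n X S hX hSX uS].
  rewrite -[LHS]/(c *: f _ _ hXY) (fD _ _ _ _ hX hY).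
  by rewrite (@scale_block_mx _ n.+1 m.+1 n.+1 m.+1) !scaler0.
rewrite -[LHS]/(c *: f _ _ hSX) (fS _ _ _ hX hSX uS).
by rewrite -[(c *: f) n X hX]/(c *: f _ _ hX) -scalerAr -scalerAl.
Qed.

Lemma blkappZ m N (c : C) (F : 'I_N -> 'I_N -> 'M[C]_m) v :
  blkapp (fun i j => c *: F i j) v = c *: blkapp F v.
Proof.
rewrite /blkapp scaler_sumr; apply: eq_bigr => i _; rewrite scaler_sumr.
by apply: eq_bigr => j _; rewrite -!scalemxAl.
Qed.

Lemma Re_norm_realC (a : R) : 0 <= a -> Re `|a%:C : C| = a.
Proof. by move=> a0; rewrite ger0_norm // realC_ge0. Qed.

Section Subvariety.
Variables (k : alg_kind) (V : ncdom R d).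
Hypothesis hV : subvariety Q k V.
Let VB := subvariety_sub hV.

(** Division by [c] reduces to the contractive case. An empty [V] provides no base point for the
    filter; the zero function is then an extension. *)
Lemma ncfun_extension_scaled N (f : 'I_N -> 'I_N -> gfun V) (c : R) : 0 < c ->
  (forall i j, is_ncfun (f i j)) ->
  (forall n (X : mtuple R d n) (hX : V X) v,
     frn (blkapp (fun i j => @f i j n X hX) v) <= c * frn v) ->
  exists (F : 'I_N -> 'I_N -> gfun B) (a : seq 'I_d -> 'M[C]_N),
  [/\ forall i j, in_Hinf (F i j),
      forall n (X : mtuple R d n) (hX : B n X) v,
        frn (blkapp (fun i j => F i j n X hX) v) <= c * frn v,
      forall i j n (X : mtuple R d n) (hX : B n X) (hV : V X),
        F i j n X hX = @f i j n X hV &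
      forall rho e, 0 < rho -> rho < 1 -> 0 < e ->
        exists K, forall n (X : mtuple R d n) (hX : B n X), Qbound Q rho X ->
          forall v, frn (blkapp (fun i j => F i j n X hX) v - mxpoly a K X v) <=
            e * frn v].
Proof.
move=> c0 fnc fc.
have Hnorm (F : 'I_N -> 'I_N -> gfun B) : (forall i j, is_ncfun (F i j)) ->
    (forall n (X : mtuple R d n) (hX : B n X) v,
        frn (blkapp (fun i j => F i j n X hX) v) <= c * frn v) ->
    forall i j, in_Hinf (F i j).
  move=> Fnc Fc i j; split; first exact: Fnc.
  exists c => n X hX; apply: (@mxnorm_entry _ _ _ (fun i j => F i j n X hX)) => [|v].
    exact: ltW.
  by rewrite -frn_le ?(ltW c0) //; exact: Fc.
have [[n0 [Z0 hZ0]]|V0] := pselect (exists n (Z : mtuple R d n), V Z); last first.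
  have z0 n (v : 'M[C]_(n.+1, N)) : blkapp (fun i j : 'I_N => 0 : 'M[C]_n.+1) v = 0.
    by rewrite /blkapp big1 // => i _; rewrite big1 // => j _; rewrite !mul0mx.
  have p0 n K (X : mtuple R d n) v : mxpoly (fun _ => 0 : 'M[C]_N) K X v = 0.
    rewrite /mxpoly big1 // => l _; rewrite /homog big1 // => w _.
    by rewrite mulmx0.
  have bd n (v : 'M[C]_(n.+1, N)) e : 0 < e -> frn (0 : 'M[C]_(n.+1, N)) <= e * frn v.
    by move=> e0; rewrite frn0 mulr_ge0 ?frn_ge0 // ltW.
  have nc0 (i j : 'I_N) : is_ncfun ((fun i j => 0 : gfun B) i j).
    by have := is_ncfunZ 0 (proj1 (@in_Hinf1 R d B)); rewrite scale0r.
  exists (fun _ _ => 0), (fun _ => 0); split.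
  - apply: Hnorm => // n X hX v.
    rewrite -[blkapp _ _]/(blkapp (fun i j : 'I_N => 0 : 'M[C]_n.+1) v) z0.
    exact: bd.
  - move=> n X hX v.
    rewrite -[blkapp _ _]/(blkapp (fun i j : 'I_N => 0 : 'M[C]_n.+1) v) z0.
    exact: bd.
  - by move=> i j n X hX hV'; case: V0; exists n, X.
  - move=> rho e r0 r1 e0; exists 0%N => n X hX _ v.
    rewrite -[blkapp _ _]/(blkapp (fun i j : 'I_N => 0 : 'M[C]_n.+1) v) z0 p0 subr0.
    exact: bd.
have [bR [hbR bRE]] := is_hilbert_inner hHR.
have [bS [hbS bSE]] := is_hilbert_inner hHS.
have [k0 k00 Qk0] := continuous_sqnorm_bound Qbounded.
pose ci : C := (c^-1)%:C.
have cci : c%:C * ci = 1 by rewrite /ci -rmorphM /= mulfV ?gt_eqF.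
have ci0 : 0 <= c^-1 by rewrite invr_ge0 ltW.
have [||F [a [Fnc Fc FV Fa]]] := @ncfun_extension R d HR HS Q bR bS hbR hbS bRE bSE
  k0 k00 Qk0 B V (fun n X => ncball_Qbound k00 Qk0 X) VB
  (fun n m X Y => subvariety_dsum k00 Qk0 hV (X := X) (Y := Y))
  (fun n X S => subvariety_sim hV (X := X) (S := S))
  N (fun i j => ci *: f i j) _ _ n0 Z0 hZ0.
- by move=> i j; apply: is_ncfunZ.
- move=> n X hX v.
  rewrite -[blkapp _ _]/(blkapp (fun i j => ci *: @f i j n X hX) v) blkappZ.
  rewrite -[leRHS]mul1r -(expr1n _ 2) -frn_le // frnZ Re_norm_realC // mul1r.
  by rewrite ler_pdivrMl //.
have Feval n X hX v : blkapp (fun i j => (c%:C *: F i j) n X hX) v =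
    c%:C *: blkapp (fun i j => F i j n X hX) v by exact: blkappZ.
exists (fun i j => c%:C *: F i j), (fun w => c%:C *: a w).
have Fc' n (X : mtuple R d n) (hX : B n X) v :
     frn (blkapp (fun i j => (c%:C *: F i j) n X hX) v) <= c * frn v.
  rewrite Feval frnZ Re_norm_realC ?(ltW c0) // ler_pM2l //.
  by rewrite -[leRHS]mul1r frn_le // expr1n mul1r; exact: Fc.
split.
- by apply: Hnorm => // i j; exact: is_ncfunZ.
- exact: Fc'.
- move=> i j n X hX hVX; rewrite -[LHS]/(c%:C *: F i j n X hX) (FV _ _ _ _ hX hVX).
  by rewrite -[(ci *: f i j) n X hVX]/(ci *: @f i j n X hVX) scalerA cci scale1r.
- move=> rho e r0 r1 e0; have [K HK] := Fa rho (e / c) r0 r1 (divr_gt0 e0 c0).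
  exists K => n X hX Xr v; rewrite Feval.
  have -> : mxpoly (fun w => c%:C *: a w) K X v = c%:C *: mxpoly a K X v.
    rewrite /mxpoly scaler_sumr; apply: eq_bigr => l _; rewrite /homog scaler_sumr.
    by apply: eq_bigr => w _; rewrite -scalemxAr.
  rewrite -scalerBr frnZ Re_norm_realC ?(ltW c0) //.
  have ce : c * (e / c) = e by rewrite mulrCA mulfV ?gt_eqF // mulr1.
  by have := HK n X hX Xr v; rewrite -(ler_pM2l c0) mulrA ce.
Qed.

End Subvariety.
End Lifting.

Section QuotientLift.
Variables (R : realType) (d : nat) (HR HS : completeNormedModType R[i]).
Hypotheses (hHR : is_hilbert HR) (hHS : is_hilbert HS).
Variable Q : 'I_d -> {linear HR -> HS}.
Hypotheses (Qbounded : forall j, continuous (Q j)) (Qindep : lin_indep Q).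
Local Notation C := R[i].
Local Notation Re := complex.Re.
Local Notation B := (ncball Q).

Definition mk_ncalg k (W : ncdom R d) (f : gfun W) (hf : in_algebra k f) : ncalg k W :=
  NcAlg (asboolT hf).

Lemma evalblk_restr k (V W : ncdom R d) (VW : ncsub V W) N (F : 'M[ncalg k W]_N)
    n (X : mtuple R d n) (hX : V n X) :
  evalblk (map_mx (restr k VW) F) hX = evalblk F (VW _ _ hX).
Proof.
by apply/funext => i; apply/funext => j; rewrite /evalblk mxE.
Qed.

Lemma ncalg_ext k (W : ncdom R d) (F G : ncalg k W) :
  (forall n X hX, (F : gfun W) n X hX = (G : gfun W) n X hX) -> F = G.
Proof. by move=> E; apply/val_inj/gfunP. Qed.

Lemma lift_Hinf (V : ncdom R d) (hV : subvariety Q Hinf V) N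
    (f : 'M[ncalg Hinf V]_N) (c : R) : 0 < c -> algnorm Hinf V N f <= c ->
  exists G : 'M[ncalg Hinf B]_N,
    map_mx (restr Hinf (subvariety_sub hV)) G = f /\ algnorm Hinf B N G <= c.
Proof.
move=> c0 fc.
have [|n X hX v|F [a [FH Fc FV _]]] := @ncfun_extension_scaled R d HR HS hHR hHS Q
  Qbounded Hinf V hV N (fun i j => f i j : gfun V) c c0.
- by move=> i j; exact: ncalg_ncfun.
- apply: le_trans (evalblk_fro f hX v) _.
  by apply: ler_wpM2r => //; exact: frn_ge0.
pose G : 'M[ncalg Hinf B]_N := \matrix_(i, j) @mk_ncalg Hinf _ (F i j) (FH i j).
have GE n (X : mtuple R d n) (hX : B n X) : evalblk G hX = fun i j => F i j n X hX.
  by apply/funext => i; apply/funext => j; rewrite /evalblk mxE.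
exists G; split.
  by apply/matrixP => i j; apply: ncalg_ext => n X hX; rewrite !mxE; exact: FV.
by apply: algnorm_fro_le (ltW c0) _ => n X hX v; rewrite GE; exact: Fc.
Qed.

Lemma lift_homogeneous (V : ncdom R d) (hV : subvariety Q Acont V) N
    (F0 : 'M[ncalg Acont B]_N) (c e : R) :
  homogeneous V -> 0 < c -> 0 < e ->
  algnorm Acont V N (map_mx (restr Acont (subvariety_sub hV)) F0) <= c ->
  exists G : 'M[ncalg Acont B]_N,
    map_mx (restr Acont (subvariety_sub hV)) G =
      map_mx (restr Acont (subvariety_sub hV)) F0 /\
    algnorm Acont B N G <= c + e.
Proof.
set VB := subvariety_sub hV => Vhom c0 e0 fc.
have [bR [hbR bRE]] := is_hilbert_inner hHR.
have [bS [hbS bSE]] := is_hilbert_inner hHS.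
have [k0 k00 Qk0] := continuous_sqnorm_bound Qbounded.
have [C0 C00 Bb] := ncball_bounded k00 Qk0 hbS bSE Qindep.
have [|n X hX v|F [a [FH Fc FV Fa]]] := @ncfun_extension_scaled R d HR HS hHR hHS Q
  Qbounded Acont V hV N (fun i j => gfun_restr VB (F0 i j)) c c0.
- by move=> i j; exact: (ncalg_ncfun (restr Acont VB (F0 i j))).
- apply: (@le_trans _ _ (c * frn v)) => //.
  have := evalblk_fro (map_mx (restr Acont VB) F0) hX v.
  rewrite evalblk_restr => h; apply: le_trans h _.
  by apply: ler_wpM2r => //; exact: frn_ge0.
(* The correction changes each of the N^2 entries by at most [e1], and N^2 e1 <= e. *)
pose e1 := e / (N%:R ^+ 2 + 1).
have e10 : 0 < e1 by rewrite divr_gt0 // ltr_wpDl // sqr_ge0.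
have eta_ex i j := Acont_dil_close k00 Qk0 C00 Bb (ncalgP (F0 i j)) e10.
pose eta (p : 'I_N * 'I_N) := s2val (cid2 (eta_ex p.1 p.2)).
have eta1 p : eta p < 1 by rewrite /eta; case: cid2.
have etaP i j := s2valP' (cid2 (eta_ex i j)).
(* There are finitely many entries, so one radius below 1 serves them all; the base value 1/2 keeps
   it positive. *)
pose r := \big[Num.max/2^-1]_p eta p.
have r1' : r < 1 by apply/bigmax_ltP; split => //; lra.
have r0' : 0 < r.
  by apply: lt_le_trans (_ : 2^-1 <= r); [rewrite invr_gt0|exact: bigmax_ge_id].
have r0 := ltW r0'; have r1 := ltW r1'.
pose D := @dil R d HR HS Q k0 k00 Qk0 r r0 r1.
have Dclose i j n X hX : mxnorm ((F0 i j : gfun B) n X hX - D (F0 i j) n X hX) <= e1.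
  apply: etaP; apply: (@le_bigmax _ _ _ _ eta (i, j)).
have rQ n (X : mtuple R d n) : B n X -> Qbound Q r (r%:C *: X).
  move=> /(ncball_Qbound k00 Qk0) [s [s0 s1 hs]].
  apply: Qbound_le (QboundZ r%:C hs); rewrite Re_norm_realC //.
    by rewrite mulr_ge0 ?ltW.
  by rewrite ler_piMr ?ltW.
(* [F] is only in H^oo, but its dilation is in A(D_Q): rX stays in the ball of radius [r], where the
   Taylor polynomials of [F] converge uniformly. *)
have DA i j : in_Acont (D (F i j)).
  split; first exact: dil_Hinf.
  move=> e' e'0; have [K HK] := Fa r e' r0' r1' e'0.
  exists [seq (a w j i * r%:C ^+ size w, w) | l <- iota 0 K, w <- words d l].
  move=> n X hX.
  have -> : ncpoly_eval [seq (a w j i * r%:C ^+ size w, w) | l <- iota 0 K,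
      w <- words d l] X = polyblk a K (r%:C *: X) i j.
    rewrite /ncpoly_eval big_allpairs_dep /polyblk -(big_mkord xpredT (fun l =>
      \sum_(w <- words d l) a w j i *: wordmx (r%:C *: X) w)) /index_iota subn0.
    apply: eq_bigr => l _; apply: eq_bigr => w _ /=.
    by rewrite wordmxZ scalerA.
  apply: (@mxnorm_entry _ _ _ (fun i j => D (F i j) n X hX -
    polyblk a K (r%:C *: X) i j)) => [|v]; first exact: ltW.
  rewrite -blkappB -mxpoly_blk -frn_le ?(ltW e'0) //.
  exact: (HK n _ (ncball_dil k00 Qk0 r0 r1 hX) (rQ n X hX) v).
(* The function F(rX) + F0(X) - F0(rX); the factors 1 and the splitting -1 = -2 + 1 only fit it to
   the shape of [in_AcontB]. *)
have GA i j : in_Acont (1 *: D (F i j) + (1 *: (F0 i j : gfun B) + (-1) *: D (F0 i j))).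
  apply: in_AcontB => //; apply: in_AcontB; first exact: (ncalgP (F0 i j)).
  have DA0 : in_Acont (D (F0 i j)) by apply: dil_Acont; exact: (ncalgP (F0 i j)).
  have := in_AcontB (-2) DA0 DA0.
  by rewrite -{2}[D (F0 i j)]scale1r -scalerDl (_ : -2 + 1 = -1 :> C) //; ring.
pose G : 'M[ncalg Acont B]_N := \matrix_(i, j) @mk_ncalg Acont _ _ (GA i j).
have GE n (X : mtuple R d n) (hX : B n X) : evalblk G hX =
    fun i j => D (F i j) n X hX + ((F0 i j : gfun B) n X hX - D (F0 i j) n X hX).
  apply/funext => i; apply/funext => j; rewrite /evalblk mxE.
  rewrite -[LHS]/(1 *: D (F i j) n X hX +
    (1 *: (F0 i j : gfun B) n X hX + (-1) *: D (F0 i j) n X hX)).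
  by rewrite !scale1r scaleN1r.
exists G; split.
  apply/matrixP => i j; apply: ncalg_ext => n X hX; rewrite mxE [in RHS]mxE.
  rewrite -[LHS]/(evalblk G (VB _ _ hX) i j) GE.
  (* Homogeneity is used here: rX is again in [V], where [F] and [F0] agree, so the two dilations
     cancel. *)
  have hrX : V n (r%:C *: X) by apply: Vhom => //; exact: unit_interval_norm.
  have -> : D (F i j) n X (VB n X hX) = D (F0 i j) n X (VB n X hX).
    rewrite /D /dil (FV _ _ _ _ _ hrX) /gfun_restr.
    exact: gfun_congr.
  by rewrite addrCA subrr addr0.
apply: algnorm_fro_le; first by rewrite addr_ge0 ?ltW.
move=> n X hX v; rewrite GE.
have -> : blkapp (fun i j => D (F i j) n X hX + ((F0 i j : gfun B) n X hX -
    D (F0 i j) n X hX)) v = blkapp (fun i j => D (F i j) n X hX) v +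
    blkapp (fun i j => (F0 i j : gfun B) n X hX - D (F0 i j) n X hX) v.
  rewrite /blkapp -big_split; apply: eq_bigr => i _; rewrite -big_split.
  by apply: eq_bigr => j _; rewrite !mulmxDl.
apply: le_trans (frnD _ _) _; rewrite mulrDl; apply: lerD; first exact: Fc.
apply: le_trans (blkapp_le_sum _ _) _; apply: ler_wpM2r; first exact: frn_ge0.
apply: (@le_trans _ _ (\sum_(i < N) \sum_(j < N) e1)).
  by apply: ler_sum => i _; apply: ler_sum => j _; exact: Dclose.
rewrite !sumr_const !card_ord -mulrnA -mulr_natr natrM -expr2 /e1.
rewrite mulrAC ler_pdivrMr ?ltr_wpDl ?sqr_ge0 // ler_wpM2l ?(ltW e0) //.
by rewrite lerDl.
Qed.

(** Rescaling requires a positive bound, and the norm may be 0. It is therefore raised by [e] for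
    H^oo, and by [e / 2] for A(D_Q), where the dilation costs the other half. *)
Lemma lift_restriction k (V : ncdom R d) (hV : subvariety Q k V) N
    (F0 : 'M[ncalg k B]_N) (e : R) :
  k = Hinf \/ homogeneous V -> 0 < e ->
  exists G : 'M[ncalg k B]_N,
    map_mx (restr k (subvariety_sub hV)) G =
      map_mx (restr k (subvariety_sub hV)) F0 /\
    algnorm k B N G <= algnorm k V N (map_mx (restr k (subvariety_sub hV)) F0) + e.
Proof.
move=> kV e0; have pos := algnorm_ge0 (map_mx (restr k (subvariety_sub hV)) F0).
case: k hV F0 kV pos => hV F0 kV pos; last first.
  by apply: lift_Hinf; rewrite ?lerDl ?ltW // ltr_wpDl.
case: kV => // Vhom; have e2 : 0 < e / 2 by rewrite divr_gt0.
have [|G [GR GN]] := lift_homogeneous (hV := hV) (F0 := F0) Vhom (ltr_wpDl pos e2) e2.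
  by rewrite lerDl ltW.
by exists G; split => //; apply: le_trans GN _; rewrite -addrA -splitr.
Qed.

End QuotientLift.

(** * Completeness of A(W) and surjectivity of the restriction *)

Section Completeness.
Variables (R : realType) (d : nat).
Local Notation C := R[i].

Lemma mxnorm_le0 m n (A : 'M[C]_(m, n)) : mxnorm A <= 0 -> A = 0.
Proof.
move=> A0; apply: fro_eq0; have := mxnorm_fro_mul A 1%:M; rewrite mulmx1.
have -> : mxnorm A = 0 by apply/eqP; rewrite eq_le A0 mxnorm_ge0.
by rewrite expr0n mul0r.
Qed.

Lemma mxnormB m n (A B : 'M[C]_(m, n)) : mxnorm (A - B) = mxnorm (B - A).
Proof.
have le (M M' : 'M[C]_(m, n)) : mxnorm (M - M') <= mxnorm (M' - M).
  rewrite -opprB -scaleN1r; apply: le_trans (mxnormZ _ _) _.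
  by rewrite normrN1 mul1r.
by apply/eqP; rewrite eq_le !le.
Qed.

Lemma half_pow_small (e : R) : 0 < e -> exists m, 2^-1 ^+ m <= e.
Proof. by move=> e0; apply: pow_small => //; rewrite ?invr_ge0 //; lra. Qed.

(* Completeness of A(W): the limit along a free ultrafilter of a sequence with
   summable increments is a uniform limit. *)
Lemma Acont_complete (W : ncdom R d) (S : nat -> gfun W) :
  (forall m, in_Acont (S m)) ->
  (forall m n X hX, mxnorm (S m.+1 n X hX - S m n X hX) <= 3 * 2^-1 ^+ m) ->
  exists2 F : gfun W, in_Acont F &
    forall m n X hX, mxnorm (F n X hX - S m n X hX) <= 6 * 2^-1 ^+ m.
Proof.
move=> SA Sstep; pose de m : R := 2^-1 ^+ m.
have de0 m : 0 < de m by rewrite exprn_gt0 // invr_gt0.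
have Stail m l n X hX :
    mxnorm (S (m + l)%N n X hX - S m n X hX) <= 6 * (de m - de (m + l)%N).
  elim: l => [|l IH]; first by rewrite addn0 !subrr mulr0 mxnorm0.
  rewrite addnS -[S (m + l).+1 _ _ _](subrK (S (m + l)%N n X hX)) -addrA.
  apply: le_trans (mxnormD _ _) _; have h1 := Sstep (m + l)%N n X hX.
  have : de (m + l).+1 = 2^-1 * de (m + l)%N by rewrite /de exprS.
  move: h1 IH; rewrite -/(de (m + l)%N); lra.
have Sdist m l n X hX : (m <= l)%N -> mxnorm (S l n X hX - S m n X hX) <= 6 * de m.
  move=> ml; rewrite -(subnKC ml); apply: le_trans (Stail _ _ _ _ _) _.
  by rewrite ler_wpM2l // lerBlDr lerDl ltW.
have [U [UU subU]] := ultraFilterLemma eventually_filter.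
have Uge m : U [set l | (m <= l)%N] by apply: subU; exists m.
have Fex n X hX : exists A, umx U (fun l => S l n X hX) A.
  apply: (@umx_exists _ _ _ _ _ _ _
    ((6 + mxnorm (S 0%N n X hX)) ^+ 2 * fro (1%:M : 'M[C]_n.+1))).
  apply: filterS (Uge 0%N) => l _ /=; rewrite -[S l n X hX]mulmx1.
  apply: le_trans (mxnorm_fro_mul _ _) _; apply: ler_wpM2r; first exact: fro_ge0.
  rewrite ler_pXn2r ?nnegrE ?addr_ge0 ?mxnorm_ge0 //.
  rewrite -[X in mxnorm X](subrK (S 0%N n X hX)); apply: le_trans (mxnormD _ _) _.
  rewrite lerD2r; apply: le_trans (Sdist 0%N l n X hX (leq0n l)) _.
  by rewrite /de expr0 mulr1.
pose F : gfun W := fun n X hX => sval (cid (Fex n X hX)).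
have Fu n X hX : umx U (fun l => S l n X hX) (F n X hX) by rewrite /F; case: cid.
have Fdist m n X hX : mxnorm (F n X hX - S m n X hX) <= 6 * de m.
  have d6 : 0 <= 6 * de m by rewrite mulr_ge0 // ltW.
  apply/mxnorm_fro => // w.
  apply: (umx_fro_le (U := U) (umxMr w (umxD (Fu n X hX) (umx_cst _)))).
  apply: filterS (Uge m) => l ml /=.
  by have [h _] := mxnorm_fro (S l n X hX - S m n X hX) d6; apply: h; exact: Sdist.
exists F; last exact: Fdist.
split; first split.
- by apply: (umx_ncfun (U := U) (g := S)) => // m; case: (SA m) => [[]].
- have [[_ [M HM]] _] := SA 0%N; exists (6 * de 0%N + M) => n X hX.
  rewrite -[X in mxnorm X](subrK (S 0%N n X hX)).
  by apply: le_trans (mxnormD _ _) _; apply: lerD.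
(* [m] is chosen with 2^-m <= e / 12, so that 6 2^-m <= e / 2; approximating [S m] by a polynomial
   takes the other half. *)
- move=> e e0; have [m hm] := half_pow_small (divr_gt0 e0 (ltr0Sn _ 11)).
  have [_ /(_ (e / 2) (divr_gt0 e0 (ltr0Sn _ 1)))[p hp]] := SA m.
  exists p => n X hX; rewrite -[F n X hX](subrK (S m n X hX)) -addrA.
  apply: le_trans (mxnormD _ _) _; rewrite [leRHS]splitr; apply: lerD => //.
  apply: le_trans (Fdist m n X hX) _; rewrite /de.
  by move: hm; lra.
Qed.

End Completeness.

Section Surjectivity.
Variables (R : realType) (d : nat) (HR HS : completeNormedModType R[i]).
Hypotheses (hHR : is_hilbert HR) (hHS : is_hilbert HS).
Variable Q : 'I_d -> {linear HR -> HS}.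
Hypotheses (Qbounded : forall j, continuous (Q j)) (Qindep : lin_indep Q).
Local Notation C := R[i].
Local Notation Re := complex.Re.
Local Notation B := (ncball Q).

Lemma mxnorm_le_algnorm k (W : ncdom R d) (F : ncalg k W) n X hX :
  mxnorm ((F : gfun W) n X hX) <= algnorm k W 1 (const_mx F).
Proof.
have -> : (F : gfun W) n X hX = evalblk (const_mx F : 'M[ncalg k W]_1) hX 0 0.
  by rewrite /evalblk mxE.
apply: mxnorm_entry => [|v]; first exact: algnorm_ge0.
by rewrite -frn_le ?algnorm_ge0 //; exact: evalblk_fro.
Qed.

Lemma algnorm_const_le k (W : ncdom R d) (F : ncalg k W) (c : R) : 0 <= c ->
  (forall n X hX, mxnorm ((F : gfun W) n X hX) <= c) ->
  algnorm k W 1 (const_mx F) <= c.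
Proof.
move=> c0 H; apply: algnorm_fro_le => // n X hX v.
apply: le_trans (blkapp_le_sum _ _) _; rewrite !big_ord1 /evalblk mxE.
by apply: ler_wpM2r; [exact: frn_ge0|exact: H].
Qed.

Lemma ncpoly_Acont (p : ncpoly R d) :
  in_Acont ((fun n X _ => ncpoly_eval p X) : gfun B).
Proof.
have [bS [hbS bSE]] := is_hilbert_inner hHS.
have [k0 k00 Qk0] := continuous_sqnorm_bound Qbounded.
have [C0 C00 Bb] := ncball_bounded k00 Qk0 hbS bSE Qindep.
split; last by move=> e e0; exists p => n X hX; rewrite subrr mxnorm0 ltW.
split; last first.
  by have [M HM] := ncpoly_bounded C00 Bb p; exists M => n X hX; exact: HM.
apply: intertwine_ncfun => n m X Y _ _ P PX.
rewrite /ncpoly_eval mulmx_sumr mulmx_suml; apply: eq_bigr => t _.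
by rewrite -scalemxAr -scalemxAl; congr (_ *: _); exact: wordmx_intertwine.
Qed.

(** For H^oo a norm-controlled lift exists directly. For A(V) the function is a uniform limit of
    polynomials on [V]; their successive differences are lifted to A(D_Q) with geometrically
    decreasing norms, and the lifts are summed there. *)
Lemma restr_surjective k (V : ncdom R d) (hV : subvariety Q k V) :
  k = Hinf \/ homogeneous V ->
  forall f : ncalg k V, exists F, restr k (subvariety_sub hV) F = f.
Proof.
case: k hV => hV kV f; last first.
  have [||G [GR _]] := lift_Hinf hHR hHS Qbounded hV
    (f := (const_mx f : 'M[ncalg Hinf V]_1)) (c := algnorm Hinf V 1 (const_mx f) + 1).
  - by rewrite ltr_wpDl ?algnorm_ge0.
  - by rewrite lerDl.
  exists (G 0 0); have := congr1 (fun A => fun_of_matrix A 0 0) GR.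
  by rewrite !mxE.
set VB := subvariety_sub hV.
pose de m : R := 2^-1 ^+ m.
have de0 m : 0 < de m by rewrite exprn_gt0 // invr_gt0.
have [_ fA] := ncalgP f.
pose p m := sval (cid (fA (de m) (de0 m))).
have pf m n X hX : mxnorm ((f : gfun V) n X hX - ncpoly_eval (p m) X) <= de m.
  by rewrite /p; case: cid.
pose P m : ncalg Acont B := @mk_ncalg _ _ Acont _ _ (ncpoly_Acont (p m)).
(* On [V] both polynomials are within [de m] of [f], so their difference has norm at most
   [2 * de m]; the lift costs one more [de m]. *)
have gex m : exists g : ncalg Acont B,
    restr Acont VB g = restr Acont VB (P m.+1 - P m) /\
    forall n X hX, mxnorm ((g : gfun B) n X hX) <= 3 * de m.
  have [G [GR GN]] := lift_restriction hHR hHS Qbounded Qindep hV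
    (const_mx (P m.+1 - P m) : 'M[ncalg Acont B]_1) kV (de0 m).
  exists (G 0 0); split.
    by have := congr1 (fun A => fun_of_matrix A 0 0) GR; rewrite !mxE.
  move=> n X hX; apply: le_trans (mxnorm_le_algnorm _ _) _.
  have -> : const_mx (G 0 0) = G by apply/matrixP => i j; rewrite mxE !ord1.
  apply: le_trans GN _; rewrite -/VB.
  have -> : 3 * de m = 2 * de m + de m by ring.
  rewrite lerD2r.
  rewrite (_ : map_mx _ _ = const_mx (restr Acont VB (P m.+1 - P m))); last first.
    by apply/matrixP => i j; rewrite !mxE.
  apply: algnorm_const_le => [|n' X' hX']; first by rewrite mulr_ge0 // ltW.
  rewrite -[X in mxnorm X]/(ncpoly_eval (p m.+1) X' - ncpoly_eval (p m) X').
  rewrite -[ncpoly_eval (p m.+1) X'](subrK ((f : gfun V) n' X' hX')) -addrA.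
  apply: le_trans (mxnormD _ _) _; rewrite mxnormB.
  have h1 := pf m.+1 n' X' hX'; have h2 := pf m n' X' hX'.
  have : de m.+1 = 2^-1 * de m by rewrite /de exprS.
  by have := de0 m; lra.
pose g m := sval (cid (gex m)).
have gR m : restr Acont VB (g m) = restr Acont VB (P m.+1 - P m).
  by rewrite /g; case: cid => ? [].
have gN m n X hX : mxnorm ((g m : gfun B) n X hX) <= 3 * de m.
  by rewrite /g; case: cid => ? [].
pose S m := P 0%N + \sum_(l < m) g l.
have SS m : S m.+1 = S m + g m by rewrite /S big_ord_recr /= addrA.
have SR m : restr Acont VB (S m) = restr Acont VB (P m).
  elim: m => [|m IH]; first by rewrite /S big_ord0 addr0.
  have rD (F G : ncalg Acont B) : restr Acont VB (F + G) =
    restr Acont VB F + restr Acont VB G by exact: raddfD.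
  by rewrite SS rD IH gR -rD addrC subrK.
have [|m n X hX|F FA Fdist] := @Acont_complete _ _ B (fun m => S m : gfun B).
- by move=> m; exact: (ncalgP (S m)).
- rewrite SS -[(S m + g m : gfun B) n X hX]/((S m : gfun B) n X hX +
    (g m : gfun B) n X hX).
  by rewrite addrC addKr; exact: gN.
exists (@mk_ncalg _ _ Acont _ _ FA); apply: ncalg_ext => n X hX.
rewrite -[LHS]/(F n X (VB n X hX)).
apply/eqP; rewrite -subr_eq0; apply/eqP/mxnorm_le0/ler_addgt0Pr => e e0.
rewrite add0r; have [m hm] := half_pow_small (divr_gt0 e0 (ltr0Sn _ 6)).
rewrite -[F n X _](subrK ((S m : gfun B) n X (VB n X hX))) -addrA.
apply: le_trans (mxnormD _ _) _.
have SE : (S m : gfun B) n X (VB n X hX) = ncpoly_eval (p m) X.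
  exact: (congr1 (fun h : ncalg Acont V => (h : gfun V) n X hX) (SR m)).
have h1 := Fdist m n X (VB n X hX).
have h2 := pf m n X hX; rewrite mxnormB -SE in h2.
rewrite -/(de m) in h1 hm; move: h1 h2 hm; lra.
Qed.

End Surjectivity.

Theorem theorem4p8 (R : realType) (d : nat)
    (HR HS : completeNormedModType R[i])
    (hHR : is_hilbert HR) (hHS : is_hilbert HS)
    (Q : 'I_d -> {linear HR -> HS})
    (Qbounded : forall j, continuous (Q j)) (Qindep : lin_indep Q)
    (k : alg_kind) (V : ncdom R d) (hV : subvariety Q k V) :
  let VB := subvariety_sub hV in
  [/\ complete_contraction (algnorm k (ncball Q)) (algnorm k V)
        (restr k VB),
      (forall F : ncalg k (ncball Q), restr k VB F = 0 <-> F \in vanishing V) &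
      (k = Hinf \/ homogeneous V) ->
        [/\ linear (restr_quot k VB),
            monoid_morphism (restr_quot k VB),
            bijective (restr_quot k VB) &
            complete_isometry (quotnorm k (ncball Q) V) (algnorm k V)
              (restr_quot k VB)]].
Proof.
move=> VB.
have contraction : complete_contraction (algnorm k (ncball Q)) (algnorm k V)
    (restr k VB).
  move=> N M; apply: algnorm_fro_le => [|n X hX v]; first exact: algnorm_ge0.
  by rewrite evalblk_restr; exact: evalblk_fro.
have ker F : restr k VB F = 0 <-> F \in vanishing V.
  split=> [F0|/asboolP F0]; last by apply: ncalg_ext => n X hX; exact: F0.
  apply/asboolP => n X hX vX.
  have := congr1 (fun h : ncalg k V => (h : gfun V) n X vX) F0.
  rewrite -[LHS]/((F : gfun (ncball Q)) n X (VB n X vX)) => E.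
  by rewrite (Prop_irrelevance hX (VB n X vX)).
have rB F G : restr k VB (F - G) = restr k VB F - restr k VB G by exact: raddfB.
split=> // kV.
have lin : linear (restr_quot k VB).
  move=> c; elim/quotalgW=> F; elim/quotalgW=> G.
  rewrite -[c *: _]pi_scaleq -pi_addq !restr_quot_pi; exact: restr_linear.
have mon : monoid_morphism (restr_quot k VB).
  split; first by rewrite [LHS]restr_quot_pi; exact: (restr_monoid_morphism k VB).1.
  elim/quotalgW=> F; elim/quotalgW=> G.
  rewrite -[_ * _]pi_mulq !restr_quot_pi; exact: (restr_monoid_morphism k VB).2.
split=> //.
  have surj f : exists q, restr_quot k VB q = f.
    have [F FE] := restr_surjective hHR hHS Qbounded Qindep hV kV f.
    by exists (\pi_(quotalg k (ncball Q) V) F)%qT; rewrite restr_quot_pi.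
  have inj : injective (restr_quot k VB).
    elim/quotalgW=> F; elim/quotalgW=> G; rewrite !restr_quot_pi => E.
    by apply/quotalg_eqP/ker; rewrite rB E subrr.
  exists (fun f => sval (cid (surj f))) => [q|f]; last by case: cid.
  by apply: inj; case: cid.
move=> N M.
set A := [set algnorm k (ncball Q) N F | F in
  [set F | map_mx \pi_(quotalg k (ncball Q) V)%qT F = M]].
have restrE (F : 'M[ncalg k (ncball Q)]_N) :
    map_mx \pi_(quotalg k (ncball Q) V)%qT F = M ->
    map_mx (restr_quot k VB) M = map_mx (restr k VB) F.
  by move=> <-; apply/matrixP => i j; rewrite !mxE restr_quot_pi.
have F0M : map_mx \pi_(quotalg k (ncball Q) V)%qT (map_mx repr M) = M.
  by apply/matrixP => i j; rewrite !mxE reprK.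
have A0 : A !=set0 by exists (algnorm k (ncball Q) N (map_mx repr M)), (map_mx repr M).
(* All representatives of [M] have the same restriction, so contractivity bounds it by their
   infimum; a representative with norm within [e] of the restricted norm gives the converse. *)
apply/eqP; rewrite eq_le; apply/andP; split.
  by apply: lb_le_inf => // _ [F FM <-]; rewrite (restrE F FM); exact: contraction.
apply/ler_addgt0Pr => e e0.
have [G [GR GN]] := lift_restriction hHR hHS Qbounded Qindep hV (map_mx repr M) kV e0.
rewrite (restrE _ F0M); apply: le_trans GN.
apply: ge_inf; first by exists 0 => _ [F _ <-]; exact: algnorm_ge0.
exists G => //=; rewrite -F0M; apply/matrixP => i j; rewrite !mxE.
apply/quotalg_eqP/ker; rewrite rB; apply/eqP; rewrite subr_eq0; apply/eqP.
by have := congr1 (fun A => fun_of_matrix A i j) GR; rewrite !mxE.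
Qed.
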